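(* Let $G$ be a sequentially complete, minimal, totally disconnected Hausdorff topological Abelian group. Then for every prime $p$ the subgroup $td_p(G)$ is closed in $G$, and $G$ is topologically isomorphic to $\prod_{p\in\mathbb P} td_p(G)$.
   Context: $\mathbb P$ is the set of primes. For a prime $p$, an element $x$ of a topological Abelian group $H$ is quasi-$p$-torsion if either $x$ has order a power of $p$, or $\langle x\rangle$ is topologically isomorphic to $\mathbb Z$ with the $p$-adic topology; $td_p(H)$ is the subgroup of quasi-$p$-torsion elements. A Hausdorff topological group is minimal if there is no strictly coarser Hausdorff group topology on it. A topological Abelian group is sequentially complete if it is sequentially closed in its completion (equivalently, every Cauchy sequence converges). *)

(* Defs.v *)
From HB Require Import structures.
From mathcomp Require Import all_boot all_order all_algebra.
From mathcomp Require Import all_classical.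
From mathcomp Require Import topology tvs ring.

Set Implicit Arguments.
Unset Strict Implicit.
Unset Printing Implicit Defensive.

Import Order.TTheory GRing.Theory Num.Theory.

Local Open Scope classical_set_scope.
Local Open Scope ring_scope.

Definition cauchy_seq (G : topologicalZmodType) (u : nat -> G) : Prop :=
  u mn.1 - u mn.2 @[mn --> (\oo, \oo)] --> (0 : G).

Definition sequentially_complete (G : topologicalZmodType) : Prop :=
  forall u : nat -> G, cauchy_seq u -> exists l : G, u @ \oo --> l.

Definition top_iso (G H : topologicalZmodType) : Prop :=
  exists (f : {additive G -> H}) (g : H -> G),
    [/\ cancel f g, cancel g f, continuous f & continuous g].

Record group_topology (G : zmodType) := GroupTopology {
  gt_open : set_system G ;
  gt_openT : gt_open setT ;
  gt_openI : setI_closed gt_open ;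
  gt_open_bigU : forall (I : Type) (f : I -> set G),
    (forall i, gt_open (f i)) -> gt_open (\bigcup_i f i) ;
  gt_add : forall (x y : G) (U : set G), gt_open U -> U (x + y) ->
    exists V W : set G, [/\ gt_open V, V x, gt_open W, W y &
      forall v w, V v -> W w -> U (v + w)] ;
  gt_opp : forall U : set G, gt_open U -> gt_open (-%R @^-1` U)
}.

Definition retopologized (G : zmodType) (tau : group_topology G) : Type := G.

Section Retopologized.
Variables (G : zmodType) (tau : group_topology G).
Local Notation Gt := (retopologized tau).

HB.instance Definition _ := GRing.Zmodule.on Gt.
HB.instance Definition _ := isOpenTopological.Build Gt
  (gt_openT tau) (@gt_openI _ tau) (@gt_open_bigU _ tau).

Lemma retopologized_openE (U : set Gt) : open U = gt_open tau U.
Proof. by []. Qed.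

Let add_cont : continuous (fun x : Gt * Gt => x.1 + x.2).
Proof.
move=> [x y] A /=; rewrite nbhsE => -[U [oU Uxy] UA].
have [V [W [oV Vx oW Wy VWU]]] := gt_add oU Uxy.
exists (V, W) => /=.
  by split; apply: open_nbhs_nbhs; split.
by move=> [v w] [Vv Ww]; apply/UA/VWU.
Qed.

Let opp_cont : continuous (-%R : Gt -> Gt).
Proof. by apply/continuousP => U; exact: gt_opp. Qed.

HB.instance Definition _ :=
  PreTopologicalNmodule_isTopologicalNmodule.Build Gt add_cont.
HB.instance Definition _ :=
  TopologicalNmodule_isTopologicalZmodule.Build Gt opp_cont.

End Retopologized.

Definition minimal_group (G : topologicalZmodType) : Prop :=
  forall tau : group_topology G, hausdorff_space (retopologized tau) ->
    gt_open tau `<=` @open G -> gt_open tau = @open G.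

Record subgroup (G : zmodType) := Subgroup {
  subgroup_set :> set G ;
  subgroup0 : subgroup_set 0 ;
  subgroupB : forall x y,
    subgroup_set x -> subgroup_set y -> subgroup_set (x - y)
}.

Definition subgroup_type (G : zmodType) (S : subgroup G) : Type := set_type S.

Section SubgroupTopology.
Variables (G : topologicalZmodType) (S : subgroup G).
Local Notation H := (subgroup_type S).

HB.instance Definition _ := SubChoice.copy H (set_type S).

Let S_zmod_closed : zmod_closed (fun x : G => x \in subgroup_set S).
Proof.
split; first by apply/mem_set/subgroup0.
by move=> x y /set_mem Sx /set_mem Sy; apply/mem_set/subgroupB.
Qed.

HB.instance Definition _ :=
  GRing.SubChoice_isSubZmodule.Build G _ H S_zmod_closed.
HB.instance Definition _ := Topological.copy H (set_type S).

Lemma subgroup_val_continuous : continuous (val : H -> G).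
Proof. exact: initial_continuous. Qed.

Lemma subgroup_cvg (F : set_system H) (x : H) : Filter F ->
  val @ F --> val x -> F --> x.
Proof.
move=> FF Fx A [_ [[B oB <-] Bx] BA].
apply: (filterS BA); apply: Fx; exact: open_nbhs_nbhs.
Qed.

Let sub_cont : continuous (fun x : H * H => x.1 - x.2).
Proof.
move=> x; apply: subgroup_cvg.
change ((fun y : H * H => val (y.1 - y.2)) @ x --> val (x.1 - x.2)).
have valB (y : H * H) : val (y.1 - y.2) = val y.1 - val y.2 by exact: raddfB.
rewrite valB (_ : (fun y : H * H => val (y.1 - y.2)) =
    (fun y : G * G => y.1 - y.2) \o (fun y : H * H => (val y.1, val y.2)));
  last by apply/funext => y /=; exact: valB.
apply: (@continuous_comp _ _ _ (fun y : H * H => (val y.1, val y.2))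
  (fun y : G * G => y.1 - y.2)); last exact: sub_continuous.
apply: cvg_pair => /=.
- by apply: (continuous_comp cvg_fst); exact: subgroup_val_continuous.
- by apply: (continuous_comp cvg_snd); exact: subgroup_val_continuous.
Qed.

HB.instance Definition _ :=
  PreTopologicalNmodule_isTopologicalZmodule.Build H sub_cont.

End SubgroupTopology.

Definition prod_group (I : Type) (H : I -> topologicalZmodType) : Type :=
  prod_topology H.

Section ProductGroup.
Variables (I : Type) (H : I -> topologicalZmodType).
Local Notation P := (prod_group H).

HB.instance Definition _ := Topological.copy P (prod_topology H).

Let add (f g : P) : P := fun i => f i + g i.
Let opp (f : P) : P := fun i => - f i.
Let zero : P := fun i => 0.

Let addA : associative add.
Proof. by move=> f g h; apply: functional_extensionality_dep => i; apply: addrA. Qed.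
Let addC : commutative add.
Proof. by move=> f g; apply: functional_extensionality_dep => i; exact: addrC. Qed.
Let add0 : left_id zero add.
Proof. by move=> f; apply: functional_extensionality_dep => i; exact: add0r. Qed.
Let addN : left_inverse zero opp add.
Proof. by move=> f; apply: functional_extensionality_dep => i; exact: addNr. Qed.

HB.instance Definition _ := GRing.isZmodule.Build P addA addC add0 addN.

Lemma prod_group_proj_continuous i : continuous (fun f : P => f i).
Proof. exact: (@proj_continuous {classic I} H i). Qed.

Lemma prod_group_cvg (F : set_system P) (f : P) : Filter F ->
  (forall i, (fun g : P => g i) @ F --> f i) -> F --> f.
Proof.
move=> FF Ff; apply/cvg_sup => i A [_ [[B oB <-] Bf] BA].
by apply: (filterS BA); apply: Ff; exact: open_nbhs_nbhs.
Qed.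

Let sub_cont : continuous (fun x : P * P => x.1 - x.2).
Proof.
move=> x; apply: prod_group_cvg => i.
apply: (@continuous_comp _ _ _ (fun y : P * P => (y.1 i, y.2 i))
  (fun y : H i * H i => y.1 - y.2)); last exact: sub_continuous.
apply: cvg_pair => /=.
- apply: (@continuous_comp _ _ _ fst (fun f : P => f i)); first exact: cvg_fst.
  exact: prod_group_proj_continuous.
- apply: (@continuous_comp _ _ _ snd (fun f : P => f i)); first exact: cvg_snd.
  exact: prod_group_proj_continuous.
Qed.

HB.instance Definition _ :=
  PreTopologicalNmodule_isTopologicalZmodule.Build P sub_cont.

End ProductGroup.

(* The integers with the p-adic topology: the sets m + p^k Z form a base of
   neighbourhoods of m. *)
Definition padic_int (p : nat) : Type := int.

Section PadicInt.
Variable p : nat.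
Local Notation Zp := (padic_int p).

HB.instance Definition _ := GRing.Zmodule.on Zp.

Definition padic_coset (k : nat) (m : Zp) : set Zp :=
  [set n : Zp | exists q : int, n = m + q * (p ^ k)%:Z :> int].

Definition padic_nbhs (m : Zp) : set_system Zp :=
  [set A | exists k, padic_coset k m `<=` A].

HB.instance Definition _ := hasNbhs.Build Zp padic_nbhs.

Lemma padic_coset_self k m : padic_coset k m m.
Proof. by exists 0; rewrite mul0r addr0. Qed.

Lemma padic_coset_trans k m n l :
  padic_coset k m n -> padic_coset k n l -> padic_coset k m l.
Proof. by move=> [q ->] [r ->]; exists (q + r); rewrite mulrDl addrA. Qed.

Lemma padic_coset_le k l m : (k <= l)%N -> padic_coset l m `<=` padic_coset k m.
Proof.
move=> kl n [q ->]; exists (q * (p ^ (l - k))%:Z).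
by rewrite -mulrA -PoszM -expnD subnK.
Qed.

Let padic_filter m : ProperFilter (padic_nbhs m).
Proof.
apply: Build_ProperFilter_ex.
  by move=> A [k kA]; exists m; apply: kA; exact: padic_coset_self.
split; first by exists 0%N.
  move=> A B [k kA] [l lB]; exists (maxn k l) => n mn; split.
  - by apply: kA; apply: padic_coset_le mn; exact: leq_maxl.
  - by apply: lB; apply: padic_coset_le mn; exact: leq_maxr.
by move=> A B AB [k kA]; exists k; apply: subset_trans AB.
Qed.

Let padic_singleton m (A : set Zp) : padic_nbhs m A -> A m.
Proof. by move=> [k]; apply; exact: padic_coset_self. Qed.

Let padic_nbhs_nbhs m (A : set Zp) :
  padic_nbhs m A -> padic_nbhs m (padic_nbhs^~ A).
Proof.
move=> [k kA]; exists k => n mn; exists k => l nl.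
by apply: kA; exact: padic_coset_trans nl.
Qed.

HB.instance Definition _ := Nbhs_isNbhsTopological.Build Zp
  padic_filter padic_singleton padic_nbhs_nbhs.

Let sub_cont : continuous (fun x : Zp * Zp => x.1 - x.2).
Proof.
move=> [m n] A [k kA].
exists (padic_coset k m, padic_coset k n); first by split; exists k.
move=> [m' n'] [/= [q Em] [r En]]; apply: kA; exists (q - r).
rewrite Em En mulrBl opprD !addrA; congr (_ - _).
by rewrite addrAC.
Qed.

HB.instance Definition _ :=
  PreTopologicalNmodule_isTopologicalZmodule.Build Zp sub_cont.

End PadicInt.

Section Cyclic.
Variable G : zmodType.

Let cyclic_set (x : G) : set G := [set x *~ n | n in [set: int]].

Let cyclic0 x : cyclic_set x 0.
Proof. by exists 0. Qed.

Let cyclicB x y z : cyclic_set x y -> cyclic_set x z -> cyclic_set x (y - z).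
Proof. by move=> [m _ <-] [n _ <-]; exists (m - n) => //; rewrite mulrzBr. Qed.

Definition cyclic_subgroup (x : G) : subgroup G :=
  Subgroup (@cyclic0 x) (@cyclicB x).

Definition has_order (x : G) (n : nat) : Prop :=
  [/\ (0 < n)%N, x *+ n = 0 & forall m, (0 < m < n)%N -> x *+ m <> 0].

End Cyclic.

Definition quasi_p_torsion (G : topologicalZmodType) (p : nat) (x : G) : Prop :=
  (exists k : nat, has_order x (p ^ k)) \/
  top_iso (subgroup_type (cyclic_subgroup x)) (padic_int p).

Definition td (G : topologicalZmodType) (p : nat) : set G :=
  [set x | quasi_p_torsion p x].
Arguments td : clear implicits.

(* When G is Hausdorff and p is prime, x is quasi-p-torsion iff every
   neighbourhood of 0 contains some p^k <x>; hence td G p is a subgroup. *)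
Section TdSubgroup.
Variable G : topologicalZmodType.
Implicit Types x y : G.

Definition padic_small (p : nat) x := forall U : set G, nbhs (0 : G) U ->
  exists k, forall q : int, U (x *~ (q * (p ^ k)%:Z)).

Lemma quasi_p_torsion_small p x : quasi_p_torsion p x -> padic_small p x.
Proof.
move=> [[k [_ xk _]]|[f [g [fK gK _ cg]]]] U U0.
  exists k => q; rewrite mulrC mulrzA -pmulrn xk mul0rz.
  exact: nbhs_singleton.
have xin : x \in subgroup_set (cyclic_subgroup x).
  by apply/mem_set; exists 1.
pose e : subgroup_type (cyclic_subgroup x) := exist _ x xin.
have valM n : val (e *~ n) = x *~ n by rewrite (raddfMz val).
have g0 : g 0 = 0 by rewrite -(raddf0 f) fK.
have : nbhs (0 : padic_int p) (g @^-1` (val @^-1` U)).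
  apply: cg; rewrite g0; apply: subgroup_val_continuous.
  by rewrite (raddf0 val).
move=> [k kU]; exists k => q.
rewrite -valM -(fK (e *~ _)); apply: kU; exists (f e * q : int).
by rewrite add0r raddfMz mulrzz mulrA.
Qed.

Let smallB p x y : padic_small p x -> padic_small p y -> padic_small p (x - y).
Proof.
move=> sx sy U U0.
have := @sub_continuous G (0, 0); rewrite /continuous_at/= subr0 => /(_ U U0).
move=> [[V W] [/= V0 W0] VWU].
have [k kV] := sx V V0; have [l lW] := sy W W0.
exists (k + l)%N => q; rewrite mulrzBl.
apply: (VWU (_, _)); split => /=.
- by rewrite expnD mulnC PoszM mulrA; exact: kV.
- by rewrite expnD PoszM mulrA; exact: lW.
Qed.

Hypothesis hG : hausdorff_space G.

Let nbhs_neq0 x : x != 0 -> exists2 U : set G, nbhs (0 : G) U & ~ U x.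
Proof.
move=> x0; have : ~ cluster (nbhs (0 : G)) x.
  by move=> /hG x0'; rewrite x0' eqxx in x0.
move=> /existsNP[A] /existsNP[B] /not_implyP[A0] /not_implyP[Bx] nAB.
exists A => // Ax; apply: nAB; exists x; split => //.
exact: nbhs_singleton Bx.
Qed.

Let eq0_nbhs x : (forall U : set G, nbhs (0 : G) U -> U x) -> x = 0.
Proof.
by move=> Ux; apply/eqP/negPn/negP => /nbhs_neq0 [U /Ux].
Qed.

Let small_order p x n : prime p -> padic_small p x -> (0 < n)%N -> x *+ n = 0 ->
  exists k, has_order x (p ^ k).
Proof.
move=> pp sx n0 xn.
have ex : exists m, (0 < m)%N && (x *+ m == 0) by exists n; rewrite n0 xn eqxx.
case: (ex_minnP ex) => m /andP[m0 /eqP xm] minm.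
have [U U0 Um] : exists2 U : set G, nbhs (0 : G) U &
    forall i, (i < m)%N -> U (x *+ i) -> x *+ i = 0.
  elim: (m) => [|l [U U0 Ul]]; first by exists setT => //; exact: filterT.
  have [xl|/nbhs_neq0 [V V0 nV]] := eqVneq (x *+ l) 0.
    exists U => // i; rewrite ltnS leq_eqVlt => /predU1P[->//|]; exact: Ul.
  exists (U `&` V); first exact: filterI.
  move=> i; rewrite ltnS leq_eqVlt => /predU1P[-> [_ /nV]//|il [Ui _]].
  exact: Ul.
have [k kU] := sx U U0; have {kU} := kU 1; rewrite mul1r -pmulrn => kU.
have xmod j : x *+ j = x *+ (j %% m).
  by rewrite {1}(divn_eq j m) mulrnDr mulnC mulrnA xm mul0rn add0r.
move: kU; rewrite xmod => /(Um _ (ltn_pmod _ m0)) xk.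
have : (m %| p ^ k)%N.
  rewrite /dvdn; case: posnP => [//|kpos].
  have := minm (p ^ k %% m)%N; rewrite kpos xk eqxx => /(_ isT).
  by rewrite leqNgt ltn_pmod.
move=> /(dvdn_pfactor _ _ pp)[j _ mE]; exists j; rewrite -mE.
split=> // i /andP[i0 im] xi.
by have := minm i; rewrite i0 xi eqxx leqNgt im => /(_ isT).
Qed.

Let nbhs_mulrn (V : set G) N : nbhs (0 : G) V ->
  exists2 W : set G, nbhs (0 : G) W & forall i w, (i < N)%N -> W w -> V (w *+ i).
Proof.
move=> V0; elim: N => [|N [W W0 WV]]; first by exists setT => //; exact: filterT.
suff [W' W'0 W'V] : exists2 W' : set G, nbhs (0 : G) W' &
    forall w, W' w -> V (w *+ N).
  exists (W `&` W'); first exact: filterI.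
  move=> i w; rewrite ltnS leq_eqVlt => /predU1P[-> [_ /W'V]//|iN [Ww _]].
  exact: WV.
clear W W0 WV; elim: N V V0 => [|N IH] V V0.
  by exists setT; [exact: filterT|move=> w _; exact: nbhs_singleton V0].
have := @add_continuous G (0, 0); rewrite /continuous_at/= addr0 => /(_ V V0).
move=> [[A B] [/= A0 B0] ABV].
have [W W0 WB] := IH B B0; exists (A `&` W); first exact: filterI.
move=> w [Aw Ww]; rewrite mulrS; apply: (ABV (_, _)); split => //=.
exact: WB.
Qed.

Let small_dvd p x n : prime p -> padic_small p x ->
  (forall m, (0 < m)%N -> x *+ m <> 0) ->
  exists2 U : set G, nbhs (0 : G) U & forall m : int, U (x *~ m) ->
    exists q : int, m = q * (p ^ n)%:Z.
Proof.
move=> pp sx xinf.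
case: n => [|n].
  by exists setT => [|m _]; [exact: filterT|exists m; rewrite mulr1].
apply: contrapT => nU.
apply: (xinf (p ^ n)%N); first by rewrite expn_gt0 prime_gt0.
apply: eq0_nbhs => U U0.
have := @add_continuous G (0, 0); rewrite /continuous_at/= addr0 => /(_ U U0).
move=> [[A B] [/= A0 B0] ABU].
have [N NB] := sx B B0.
have [W W0 WA] := nbhs_mulrn (p ^ N) A0.
have [m Wm nm] : exists2 m : int, W (x *~ m) &
    ~ exists q : int, m = q * (p ^ n.+1)%:Z.
  apply: contrapT => nex; apply: nU; exists W => // m Wm.
  by apply: contrapT => nq; apply: nex; exists m.
have pN0 : (p ^ N)%:Z != 0 by rewrite eqz_nat -lt0n expn_gt0 prime_gt0.
have [u [t Put]] : exists (u : nat) (t : int), (u < p ^ N)%N /\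
    (p ^ n)%:Z = u%:Z * m + t * (p ^ N)%:Z.
  have /(dvdn_pfactor _ _ pp)[j _ gE] := dvdn_gcdr `|m|%N (p ^ N).
  have jn : (j <= n)%N.
    rewrite leqNgt; apply/negP => nj; apply: nm; apply/dvdzP.
    rewrite /dvdz /=; apply: (dvdn_trans (dvdn_exp2l p nj)).
    by rewrite -gE dvdn_gcdl.
  have [u [v uv]] := Bezoutz m (p ^ N)%:Z.
  have gE' : gcdz m (p ^ N)%:Z = (p ^ j)%:Z by rewrite /gcdz absz_nat gE.
  pose c := (p ^ (n - j))%:Z.
  have rlt : (`|((u * c) %% (p ^ N)%:Z)%Z| < p ^ N)%N.
    rewrite -ltz_nat gez0_abs ?modz_ge0//.
    by rewrite ltz_pmod// ltz_nat expn_gt0 prime_gt0.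
  exists `|((u * c) %% (p ^ N)%:Z)%Z|%N.
  exists (c * v + ((u * c) %/ (p ^ N)%:Z)%Z * m); split => //.
  rewrite gez0_abs ?modz_ge0//.
  have -> : (p ^ n)%:Z = c * (p ^ j)%:Z by rewrite -PoszM -expnD subnK.
  rewrite -gE' -uv.
  have -> : ((u * c) %% (p ^ N)%:Z)%Z =
      u * c - ((u * c) %/ (p ^ N)%:Z)%Z * (p ^ N)%:Z.
    by rewrite {2}(divz_eq (u * c) (p ^ N)%:Z) addrAC subrr add0r.
  by ring.
case: Put => uN Put.
have -> : x *+ (p ^ n) = (x *~ m) *+ u + x *~ (t * (p ^ N)%:Z).
  by rewrite !pmulrn Put mulrzDr (mulrC u%:Z) !mulrzA.
apply: (ABU (_, _)); split => /=; first exact: WA.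
exact: NB.
Qed.

Let nbhs_shift x (U : set G) : nbhs x U -> nbhs (0 : G) [set z | U (x + z)].
Proof.
move=> Ux; have := @add_continuous G (x, 0).
rewrite /continuous_at/= addr0 => /(_ U Ux) [[A B] [/= Ax B0] ABU].
apply: filterS B0 => z Bz; apply: (ABU (_, _)); split => //=.
exact: nbhs_singleton Ax.
Qed.

Lemma small_quasi_p_torsion p x : prime p -> padic_small p x -> quasi_p_torsion p x.
Proof.
move=> pp sx.
have [[n n0 xn]|xinf] := pselect (exists2 n, (0 < n)%N & x *+ n = 0).
  by left; exact: small_order xn.
have {}xinf m : (0 < m)%N -> x *+ m <> 0 by move=> m0 xm; apply: xinf; exists m.
right.
have inj0 (m : int) : x *~ m = 0 -> m = 0.
  case: m => [[|m]|m] //; first by rewrite -pmulrn => /(xinf m.+1 isT).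
  rewrite NegzE mulrNz -pmulrn => /eqP; rewrite oppr_eq0 => /eqP.
  by move=> /(xinf m.+1 isT).
have inj (m n : int) : x *~ m = x *~ n -> m = n.
  move=> mn; apply/eqP; rewrite -subr_eq0; apply/eqP/inj0.
  by rewrite mulrzBr mn subrr.
pose H := subgroup_type (cyclic_subgroup x).
have xin (m : int) : x *~ m \in subgroup_set (cyclic_subgroup x).
  by apply/mem_set; exists m.
pose g (m : padic_int p) : H := exist _ (x *~ m) (xin m).
have /choice[f fE] : forall y : H, exists m : padic_int p, x *~ m = val y.
  by move=> [y /= yx]; have [m _ <-] := set_mem yx; exists m.
have fA : zmod_morphism f.
  move=> y z; apply: inj; rewrite fE mulrzBr !fE; exact: raddfB.
pose fM := GRing.isZmodMorphism.Build H (padic_int p) f fA.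
pose F : {additive H -> padic_int p} := HB.pack f fM.
exists F, g; split.
- by move=> y; apply: val_inj; rewrite /= fE.
- by move=> m; apply: inj; rewrite fE.
- move=> y A [k kA].
  have [U U0 Uk] := small_dvd k pp sx xinf.
  have : nbhs (val y) [set z | U (z - val y)].
    have := @sub_continuous G (val y, val y).
    rewrite /continuous_at/= subrr => /(_ U U0) [[V W] [/= Vy Wy] VWU].
    apply: filterS Vy => z Vz; apply: (VWU (_, _)); split => //=.
    exact: nbhs_singleton Wy.
  move=> /(@subgroup_val_continuous _ _ y) Uy.
  change (nbhs y (F @^-1` A)).
  apply: (@filterS _ (nbhs y) _ _ _ _ Uy) => z /= Uzy.
  apply: kA; have [q fq] : exists q : int, f z - f y = q * (p ^ k)%:Z :> int.
    by apply: Uk; rewrite mulrzBr !fE.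
  by exists q; rewrite -fq addrC subrK.
- move=> m; apply: (@subgroup_cvg _ _ (g @ m) (g m)
    (fmap_filter _ (nbhs_filter m))).
  move=> U /= Um.
  have [k kU] := sx _ (nbhs_shift Um).
  exists k => n [q ->] /=.
  by have := kU q; rewrite /= -mulrzDr.
Qed.

Let td0 p : td G p 0.
Proof.
left; exists 0%N; split => // m /andP[m0]; rewrite expn0 ltnS leqn0.
by move=> /eqP mE; rewrite mE in m0.
Qed.

Let tdB p x y : prime p -> td G p x -> td G p y -> td G p (x - y).
Proof.
move=> pp /quasi_p_torsion_small sx /quasi_p_torsion_small sy.
by apply: small_quasi_p_torsion => //; exact: smallB.
Qed.

Definition td_subgroup (p : {p : nat | prime p}) : subgroup G :=
  @Subgroup G (td G (val p)) (@td0 (val p))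
    (fun x y => @tdB (val p) x y (valP p)).

End TdSubgroup.

(* Main.v *)
(** By the theorem of Prodanov and Stoyanov a minimal abelian group [G] is
    precompact, so its topology is the one induced by its continuous characters
    [G -> R/Z], and minimality says that no smaller point separating family of
    characters generates the same topology.  Suppose some character has infinite
    order.  If the character group had infinite rank, compactness of the
    annihilators of subgroups of countable index (sequential completeness) and
    their total disconnectedness would give a character group [Y] of non-torsion
    index which still separates points, against minimality.  If its rank is
    finite, a sequence of very small elements of [G], suitably multiplied,
    converges to a nontrivial one-parameter subgroup of [G], against total
    disconnectedness.  Hence every character has finite order: [G] has a base of
    open subgroups [V] with [n G] contained in [V] for some [n > 0], and the
    idempotents of the profinite integers split [G] into its parts [td_p(G)].

    Precompactness rests on one consequence of minimality: a group topology
    whose zero neighbourhoods have trivial adherence is finer than the given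
    one.  If [G] were not precompact, there would be a sequence in [G] so
    independent that the Bohr topology of the free abelian group on it has
    trivial adherence (by Foelner's theorem) without converging to 0. *)

Require Import Defs.
From HB Require Import structures.
From mathcomp Require Import all_boot all_order all_algebra.
From mathcomp Require Import all_classical.
From mathcomp Require Import topology tvs reals normedtype trigo.
From mathcomp Require Import ring lra zify.

Set Implicit Arguments.
Unset Strict Implicit.
Unset Printing Implicit Defensive.

Import Order.TTheory GRing.Theory Num.Theory.
Import numFieldNormedType.Exports.

Local Open Scope classical_set_scope.
Local Open Scope ring_scope.

(** Foelner's theorem needs a set covered by finitely many translates of a small set, which is just
    what precompactness asserts. The circle is broken by a cruder filter base, of combinations with
    coefficients at most [2 ^ (j - m)]: it shows that some [n G] is so covered. Foelner's theorem is
    applied to the sequence with its terms from index [n] on multiplied by [n], and the sequence is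
    chosen so that small combinations have coefficients divisible by [n] there.

    Sequential completeness only yields limits of sequences, which is why countable index matters
    for the compactness of annihilators. On such an annihilator total disconnectedness makes every
    character finite, so multiples of given independent characters vanish on it. These are sent to
    [1 / n!] because every rational is an integer multiple of some [1 / n!]: each character then
    differs from a multiple of one vanishing on the annihilator by an element of the kernel, and the
    kernel separates points. In finite rank factorials reappear: multiples of [k!] are eventually
    divisible by any [l], so limits exist for all characters, not only for combinations of the
    chosen ones. *)

(** * Neighbourhoods of zero in a topological abelian group *)

Section GroupNbhs.
Variable G : topologicalZmodType.
Implicit Types (U V W : set G) (x y : G).

Lemma nbhs0_sub U : nbhs (0 : G) U ->
  exists2 W, nbhs (0 : G) W & forall x y, W x -> W y -> U (x - y).
Proof.
move=> U0; have := @sub_continuous G (0, 0).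
rewrite /continuous_at/= subr0 => /(_ U U0) [[A B] [/= A0 B0] ABU].
exists (A `&` B); first exact: filterI.
by move=> x y [Ax _] [_ By]; apply: (ABU (_, _)).
Qed.

Lemma nbhs0_add U : nbhs (0 : G) U ->
  exists2 W, nbhs (0 : G) W & forall x y, W x -> W y -> U (x + y).
Proof.
move=> U0; have := @add_continuous G (0, 0).
rewrite /continuous_at/= addr0 => /(_ U U0) [[A B] [/= A0 B0] ABU].
exists (A `&` B); first exact: filterI.
by move=> x y [Ax _] [_ By]; apply: (ABU (_, _)).
Qed.

Lemma nbhs0_shift x U : nbhs x U <-> nbhs (0 : G) [set z | U (x + z)].
Proof.
split=> [Ux|U0].
  have := @add_continuous G (x, 0).
  rewrite /continuous_at/= addr0 => /(_ U Ux) [[A B] [/= Ax B0] ABU].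
  apply: filterS B0 => z Bz; apply: (ABU (_, _)); split => //=.
  exact: nbhs_singleton Ax.
have := @sub_continuous G (x, x).
rewrite /continuous_at/= subrr => /(_ _ U0) [[A B] [/= Ax Bx] ABU].
apply: filterS Ax => z Az.
have := ABU (z, x) (conj Az (nbhs_singleton Bx)).
by rewrite /= addrC subrK.
Qed.

Lemma nbhs0_opp U : nbhs (0 : G) U -> nbhs (0 : G) [set x | U (- x)].
Proof. by move=> U0; apply: (@opp_continuous G 0); rewrite oppr0. Qed.

Lemma nbhs0_sym U : nbhs (0 : G) U -> exists D, [/\ nbhs (0 : G) D,
  (forall x, D x -> D (- x)), D `<=` U & D 0].
Proof.
move=> U0; exists (U `&` [set x | U (- x)]); split.
- by apply: filterI => //; exact: nbhs0_opp.
- by move=> x [Ux Uxn]; split => //=; rewrite opprK.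
- by move=> x [].
- by split => /=; rewrite ?oppr0; exact: nbhs_singleton.
Qed.

Lemma nbhs0_half U : nbhs (0 : G) U -> exists D, [/\ nbhs (0 : G) D,
  (forall x, D x -> D (- x)), D 0, (forall x y, D x -> D y -> U (x + y)) &
  (forall x y, D x -> D y -> U (x - y))].
Proof.
move=> U0; have [W W0 WU] := nbhs0_add U0.
have [D [D0 Dn DW Dz]] := nbhs0_sym W0.
exists D; split => // x y Dx Dy; first by apply: WU; exact: DW.
by apply: WU; apply: DW => //; exact: Dn.
Qed.

Hypothesis hG : hausdorff_space G.

Lemma nbhs0_eq0 x : (forall U, nbhs (0 : G) U -> U x) -> x = 0.
Proof.
move=> Ux; apply/esym/hG => A B A0 Bx.
by exists x; split; [exact: Ux|exact: nbhs_singleton Bx].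
Qed.

End GroupNbhs.

(* In a minimal group, a filter base of zero neighbourhoods of some group
   topology converges to 0 as soon as its adherence is trivial: otherwise the
   sets [x + F + U] would define a strictly coarser Hausdorff topology. *)
Section MinimalityPrinciple.
Variables (G : topologicalZmodType) (FF : set (set G)).
Hypothesis FFn0 : exists F, FF F.
Hypothesis FF0 : forall F, FF F -> F 0.
Hypothesis FFI : forall F F', FF F -> FF F' ->
  exists2 F'', FF F'' & F'' `<=` F `&` F'.
Hypothesis FFB : forall F, FF F ->
  exists2 F', FF F' & forall x y, F' x -> F' y -> F (x - y).

Let nb (x : G) (A : set G) := exists F U, [/\ FF F, nbhs (0 : G) U &
  forall f u, F f -> U u -> A (x + (f + u))].
Let int (A : set G) : set G := [set z | nb z A].

Let nb_self x A : nb x A -> A x.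
Proof.
move=> [F [U [FFF U0 FUA]]]; have := FUA 0 0 (FF0 FFF) (nbhs_singleton U0).
by rewrite !addr0.
Qed.

Let nb_sub x A B : A `<=` B -> nb x A -> nb x B.
Proof.
by move=> AB [F [U [FFF U0 FUA]]]; exists F, U; split=> // f u Ff Uu; apply/AB/FUA.
Qed.

Let FFD F : FF F ->
  exists2 F', FF F' & forall x y, F' x -> F' y -> F (x + y).
Proof.
move=> /FFB[F1 FF1 F1F]; have [F2 FF2 F21] := FFB FF1.
have [F3 FF3 F3s] := FFI FF1 FF2.
exists F3 => // x y /F3s[F1x _] /F3s[_ F2y].
rewrite -(opprK y); apply: F1F => //; rewrite -sub0r.
by apply: F21 => //; exact: FF0.
Qed.

Let nb_nb x A : nb x A -> nb x (int A).
Proof.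
move=> [F [U [FFF U0 FUA]]].
have [F' FF' F'F] := FFD FFF; have [W W0 WU] := nbhs0_add U0.
exists F', W; split=> // f u Ff Wu; exists F', W; split=> // f' u' Ff' Wu'.
have -> : x + (f + u) + (f' + u') = x + ((f + f') + (u + u')).
  by rewrite -addrA; congr (_ + _); rewrite addrACA.
by apply: FUA; [exact: F'F|exact: WU].
Qed.

Let nb_I x A B : nb x A -> nb x B -> nb x (A `&` B).
Proof.
move=> [F [U [FFF U0 FUA]]] [F' [U' [FFF' U0' FUB]]].
have [F'' FF'' F''s] := FFI FFF FFF'.
exists F'', (U `&` U'); split=> //; first exact: filterI.
move=> f u /F''s[Ff Ff'] [Uu Uu']; split; [exact: FUA|exact: FUB].
Qed.

Let op : set_system G := [set O | O `<=` int O].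

Let op_int A : op (int A).
Proof. by move=> x /nb_nb. Qed.

Let opT : op setT.
Proof. by move=> x _; have [F FFF] := FFn0; exists F, setT; split=> //; exact: filterT. Qed.

Let opI : setI_closed op.
Proof. by move=> A B Aop Bop x [/Aop ? /Bop ?]; exact: nb_I. Qed.

Let opU : forall (I : Type) (f : I -> set G),
  (forall i, op (f i)) -> op (\bigcup_i f i).
Proof.
move=> I f fop x [i _ /fop fx]; apply: nb_sub fx => y fy; by exists i.
Qed.

Let opD : forall (x y : G) (U : set G), op U -> U (x + y) ->
    exists V W : set G, [/\ op V, V x, op W, W y &
      forall v w, V v -> W w -> U (v + w)].
Proof.
move=> x y O Oop /Oop[F [U [FFF U0 FUA]]].
have [F' FF' F'F] := FFD FFF; have [W W0 WU] := nbhs0_add U0.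
pose A z := [set t | exists f u, [/\ F' f, W u & t = z + (f + u)]].
have nA z : nb z (A z) by exists F', W; split=> // f u ? ?; exists f, u.
exists (int (A x)), (int (A y)); split; do ?[exact: op_int|exact: nA].
move=> v w /nb_self[f [u [Ff Wu ->]]] /nb_self[f' [u' [Ff' Wu' ->]]].
have -> : x + (f + u) + (y + (f' + u')) = (x + y) + ((f + f') + (u + u')).
  by rewrite addrACA; congr (_ + _); rewrite addrACA.
by apply: FUA; [exact: F'F|exact: WU].
Qed.

Let opN : forall U : set G, op U -> op (-%R @^-1` U).
Proof.
move=> O Oop x /= /Oop[F [U [FFF U0 FUA]]].
have [F' FF' F'F] := FFB FFF.
exists F', [set u | U (- u)]; split=> //; first exact: nbhs0_opp.
move=> f u Ff Uu /=; rewrite !opprD; apply: FUA => //.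
by rewrite -sub0r; apply: F'F => //; exact: FF0.
Qed.

Let tau := GroupTopology opT opI opU opD opN.

Lemma minimal_group_cvg : minimal_group G ->
  (forall g, (forall F U, FF F -> nbhs (0 : G) U -> exists2 f, F f & U (g - f)) ->
    g = 0) ->
  forall U, nbhs (0 : G) U -> exists2 F, FF F & F `<=` U.
Proof.
move=> Gmin FFg U U0.
(* Two points that [tau] does not separate differ by an element of the adherence of the filter
   base. *)
have htau : hausdorff_space (retopologized tau).
  move=> p q pq; apply/eqP; rewrite -subr_eq0; apply/eqP; apply: FFg => F V FFF V0.
  have [F' FF' F'F] := FFB FFF; have [W W0 WV] := nbhs0_sub V0.
  pose A (z : G) := [set t | exists f u, [/\ F' f, W u & t = z + (f + u)]].
  have nA z : nb z (A z) by exists F', W; split=> // f u ? ?; exists f, u.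
  have oA z : nbhs (z : retopologized tau) (A z).
    rewrite nbhsE; exists (int (A z)).
      by split; [exact: op_int|exact: nA].
    by move=> t /nb_self.
  have [t [[f [u [Ff Wu tE]]] [f' [u' [Ff' Wu' tE']]]]] := pq _ _ (oA p) (oA q).
  exists (f' - f); first exact: F'F.
  have -> : p - q - (f' - f) = u' - u.
    have -> : (p : G) = t - (f + u) by rewrite tE addrK.
    have -> : (q : G) = t - (f' + u') by rewrite tE' addrK.
    have -> : t - (f + u) - (t - (f' + u')) = (f' - f) + (u' - u).
      by rewrite opprB addrC addrA subrK opprD addrACA.
    by rewrite addrAC subrr add0r.
  exact: WV.
have sub : gt_open tau `<=` @open G.
  move=> O Oop; rewrite openE => x /Oop[F [V [FFF V0 FVO]]].
  rewrite /interior; apply/nbhs0_shift; apply: filterS V0 => v Vv /=.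
  by have := FVO 0 v (FF0 FFF) Vv; rewrite add0r.
have E := Gmin tau htau sub.
move: U0; rewrite nbhsE => -[O [Oo O0] OU].
have : gt_open tau O by rewrite E.
move=> /(_ 0 O0)[F [V [FFF V0 FVO]]].
exists F => // f Ff; apply: OU.
by have := FVO f 0 Ff (nbhs_singleton V0); rewrite add0r addr0.
Qed.

End MinimalityPrinciple.

(** * Reals modulo the integers *)

Section NearInt.
Variable R : realType.
Implicit Types (r s e : R).

(** Closeness to 0 in R/Z. Working with real lifts avoids a quotient type; identities modulo 1
    become membership in [Num.int]. *)
Definition near_int e r := exists k : int, `|r - k%:~R| < e.

Lemma near_intD e e' r s : near_int e r -> near_int e' s ->
  near_int (e + e') (r + s).
Proof.
move=> [k kr] [l ls]; exists (k + l); rewrite intrD opprD addrACA.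
by rewrite (le_lt_trans (ler_normD _ _))// ltrD.
Qed.

Lemma near_intN e r : near_int e r -> near_int e (- r).
Proof. by move=> [k kr]; exists (- k); rewrite intrN -opprD normrN. Qed.

Lemma near_intB e e' r s : near_int e r -> near_int e' s ->
  near_int (e + e') (r - s).
Proof. by move=> re /near_intN; exact: near_intD. Qed.

Lemma near_int_le e e' r : e <= e' -> near_int e r -> near_int e' r.
Proof. by move=> ee' [k kr]; exists k; exact: lt_le_trans ee'. Qed.

Lemma near_int_int e (k : int) : 0 < e -> near_int e k%:~R.
Proof. by move=> e0; exists k; rewrite subrr normr0. Qed.

Lemma near_int0 e : 0 < e -> near_int e 0.
Proof. exact: (@near_int_int e 0). Qed.

Lemma near_int_norm e r : `|r| < e -> near_int e r.
Proof. by move=> re; exists 0; rewrite subr0. Qed.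

Lemma not_near_int e r : (forall k : int, e <= `|r - k%:~R|) -> ~ near_int e r.
Proof. by move=> er [k]; rewrite ltNge er. Qed.

Lemma near_int_eqmod e r s : r - s \is a Num.int -> near_int e r -> near_int e s.
Proof.
move=> /intrP[k rs] [l rl]; exists (l - k).
by rewrite intrB -rs opprB addrA [s + _]addrC subrK.
Qed.

Lemma not_int_far r : r \isn't a Num.int ->
  exists e, [/\ 0 < e, e <= 1 / 2 & ~ near_int e r].
Proof.
move=> nr; pose t := r - (Num.floor r)%:~R.
have t0 : 0 < t.
  rewrite lt_neqAle subr_ge0 floor_le andbT eq_sym subr_eq0.
  by apply: contra nr => /eqP ->; exact: intr_int.
have t1 : t < 1 by have := floorD1_gt r; rewrite intrD -ltrBlDl.
exists (Num.min t (1 - t)); split.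
- by rewrite lt_min t0 subr_gt0.
- by rewrite ge_min; apply/orP; have [?|?] := lerP t (1 / 2); [left|right]; lra.
apply: not_near_int => k; rewrite ge_min.
have -> : r - k%:~R = t + (Num.floor r - k)%:~R by rewrite /t intrB addrA subrK.
have [k0|k0] := lerP 0 (Num.floor r - k).
  have : (0 : R) <= (Num.floor r - k)%:~R by rewrite ler0z.
  by move=> ?; apply/orP; left; rewrite ger0_norm; lra.
have : (Num.floor r - k)%:~R <= (-1)%:~R :> R by rewrite ler_int -ltzD1.
by rewrite intrN => kk; apply/orP; right; rewrite ler0_norm; lra.
Qed.

Lemma near_int_lim r : (forall e, 0 < e -> near_int e r) -> r \is a Num.int.
Proof. by move=> H; apply: contrapT => /negP/not_int_far[e [/H + _]]. Qed.

End NearInt.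

(** * Cosine and sine on the circle R/Z *)

Section CircleTrig.
Variable R : realType.
Implicit Types (e x y : R).

Lemma pi2_gt0 : 0 < pi *+ 2 :> R.
Proof. by rewrite pmulrn_lgt0 ?pi_gt0. Qed.

(** Real and imaginary parts of exp(2 pi i x): the Fourier analysis below is done in real
    arithmetic. *)
Definition cos1 x : R := cos (pi *+ 2 * x).
Definition sin1 x : R := sin (pi *+ 2 * x).

Lemma cos1D x y : cos1 (x + y) = cos1 x * cos1 y - sin1 x * sin1 y.
Proof. by rewrite /cos1 mulrDr cosD. Qed.
Lemma sin1D x y : sin1 (x + y) = sin1 x * cos1 y + cos1 x * sin1 y.
Proof. by rewrite /sin1 mulrDr sinD. Qed.
Lemma cos1N x : cos1 (- x) = cos1 x.
Proof. by rewrite /cos1 mulrN cosN. Qed.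
Lemma sin1N x : sin1 (- x) = - sin1 x.
Proof. by rewrite /sin1 mulrN sinN. Qed.
Lemma cos1_0 : cos1 0 = 1. Proof. by rewrite /cos1 mulr0 cos0. Qed.
Lemma sin1_0 : sin1 0 = 0. Proof. by rewrite /sin1 mulr0 sin0. Qed.
Lemma cos1_le1 x : cos1 x <= 1. Proof. exact: cos_le1. Qed.
Lemma cos1_geN1 x : -1 <= cos1 x. Proof. exact: cos_geN1. Qed.

Lemma cos1M x y : cos1 x * cos1 y = (cos1 (x + y) + cos1 (x - y)) / 2.
Proof. by rewrite !cos1D cos1N sin1N; field. Qed.

Lemma cossin1_nat (n : nat) : cos1 n%:R = 1 /\ sin1 n%:R = 0.
Proof.
elim: n => [|n [IHc IHs]]; first by rewrite cos1_0 sin1_0.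
have c1 : cos1 1 = 1 by rewrite /cos1 mulr1 cos2pi.
have s1 : sin1 1 = 0 by rewrite /sin1 mulr1 sin2pi.
by rewrite -natr1 cos1D sin1D IHc IHs c1 s1 !mulr1 !mulr0 subr0 addr0.
Qed.

Lemma cossin1_int (k : int) : cos1 k%:~R = 1 /\ sin1 k%:~R = 0.
Proof.
case: k => n; first exact: cossin1_nat.
rewrite NegzE intrN cos1N sin1N -pmulrn.
by have [-> ->] := cossin1_nat n.+1; rewrite oppr0.
Qed.

Lemma cos1Dz x (k : int) : cos1 (x + k%:~R) = cos1 x.
Proof. by rewrite cos1D; have [-> ->] := cossin1_int k; rewrite mulr1 mulr0 subr0. Qed.
Lemma sin1Dz x (k : int) : sin1 (x + k%:~R) = sin1 x.
Proof. by rewrite sin1D; have [-> ->] := cossin1_int k; rewrite mulr1 mulr0 addr0. Qed.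

Lemma cos1_ge0 x : near_int (1 / 4) x -> 0 <= cos1 x.
Proof.
move=> [k]; rewrite ltr_norml => /andP[kx xk].
have -> : cos1 x = cos1 (x - k%:~R) by rewrite -intrN cos1Dz.
have p0 := pi_gt0 R.
by apply: cos_ge0_pihalf; rewrite -mulr_natr; apply/andP; split; nra.
Qed.

Lemma cos1_le e x : 0 <= e -> ~ near_int e x -> cos1 x <= cos1 e.
Proof.
move=> e0 ne; pose t := x - (Num.floor x)%:~R.
have -> : cos1 x = cos1 t by rewrite /t -intrN cos1Dz.
have t0 : 0 <= t by rewrite subr_ge0 floor_le.
have t1 : t < 1.
  by have := floorD1_gt x; rewrite intrD -ltrBlDl.
have et : e <= t.
  rewrite leNgt; apply/negP => te; apply: ne; exists (Num.floor x).
  by rewrite ger0_norm.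
have et' : e <= 1 - t.
  rewrite leNgt; apply/negP => te; apply: ne; exists (Num.floor x + 1).
  by rewrite intrD opprD addrA -/t distrC ger0_norm// subr_ge0 ltW.
have p0 := pi_gt0 R.
suff H (u : R) : e <= u -> u <= 1 / 2 -> cos1 u <= cos1 e.
  have [t2|/ltW t2] := lerP t (1 / 2); first exact: H.
  have -> : cos1 t = cos1 (1 - t).
    by rewrite -cos1N addrC -[1]/(1%:~R) cos1Dz.
  by apply: H => //; lra.
move=> eu u2; rewrite leNgt; apply/negP; rewrite ltr_cos ?in_itv/=.
- by rewrite (ltr_pM2l pi2_gt0) ltNge eu.
- by rewrite -mulr_natr; apply/andP; split; nra.
- by rewrite -mulr_natr; apply/andP; split; nra.
Qed.

Lemma cos1_lt1 e : 0 < e -> e <= 1 / 2 -> cos1 e < 1.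
Proof.
move=> e0 e2; rewrite -cos1_0 ltr_cos ?in_itv/=.
- by rewrite mulr0 mulr_gt0// pi2_gt0.
- by have := pi_gt0 R; rewrite -mulr_natr => ?; apply/andP; split; nra.
- by have := pi_gt0 R; rewrite -mulr_natr => ?; apply/andP; split; nra.
Qed.

Lemma cos1_neq1 x : x \isn't a Num.int -> cos1 x < 1.
Proof.
move=> /not_int_far[e [e0 e2 ne]].
by apply: le_lt_trans (cos1_lt1 e0 e2); apply: cos1_le => //; exact: ltW.
Qed.

End CircleTrig.

(** * Bogolyubov's lemma in finite groups *)

Section Bogolyubov.
Variables (R : realType) (r M : nat).
Hypothesis M0 : (0 < M)%N.
Local Notation Gam := {ffun 'I_r -> 'I_M}.
Implicit Types (a b c d th : Gam) (s u : 'I_r -> int).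

(** A real lift of the character of (Z/M)^r with index [th]. The argument stays an integer vector,
    since combinations of group elements only see integer coefficients. *)
Definition pairing th s : R := (\sum_i (th i)%:Z * s i)%:~R / M%:R.

Lemma pairingD th s u : pairing th (fun i => s i + u i) = pairing th s + pairing th u.
Proof.
rewrite /pairing -mulrDl -intrD -big_split/=; congr (_%:~R / _).
by apply: eq_bigr => i _; rewrite mulrDr.
Qed.

Lemma pairingN th s : pairing th (fun i => - s i) = - pairing th s.
Proof.
rewrite /pairing -mulNr -intrN -sumrN; congr (_%:~R / _).
by apply: eq_bigr => i _; rewrite mulrN.
Qed.

Lemma pairingB th s u : pairing th (fun i => s i - u i) = pairing th s - pairing th u.
Proof. by rewrite pairingD pairingN. Qed.

Let shift (i0 : 'I_r) th : Gam :=
  [ffun i => if i == i0 then Ordinal (ltn_pmod (th i).+1 M0) else th i].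

Let shift_inj i0 : injective (shift i0).
Proof.
move=> th th' /ffunP E; apply/ffunP => i; have := E i; rewrite !ffunE.
case: eqP => // _ /(congr1 val)/= Ei; apply/val_inj => /=.
have /eqP : (1 + th i == 1 + th' i %[mod M])%N by rewrite !add1n; apply/eqP.
by move/eqP; rewrite eqn_modDl !modn_small// => /eqP.
Qed.

Let pairing_shift i0 th s :
  exists k : int, pairing (shift i0 th) s = pairing th s + (s i0)%:~R / M%:R + k%:~R.
Proof.
have [k Ek] : exists k : int, (shift i0 th i0)%:Z = (th i0)%:Z + 1 + k * M%:Z.
  rewrite ffunE eqxx /=; exists (- ((th i0).+1 %/ M)%N%:Z).
  have := divn_eq (th i0).+1 M => /(congr1 Posz); rewrite PoszD PoszM intS => E.
  by lia.
exists (k * s i0); rewrite /pairing.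
have M1 : M%:R != 0 :> R by rewrite pnatr_eq0 -lt0n.
have -> : \sum_i (shift i0 th i)%:Z * s i =
   \sum_i (th i)%:Z * s i + s i0 + k * s i0 * M%:Z.
  rewrite (bigD1 i0)//= [X in _ = X + _ + _](bigD1 i0)//= Ek.
  have -> : \sum_(i < r | i != i0) (shift i0 th i)%:Z * s i =
    \sum_(i < r | i != i0) (th i)%:Z * s i.
    by apply: eq_bigr => i /negbTE ni; rewrite ffunE ni.
  by ring.
by rewrite !intrD [(_ * _ * M%:Z)%:~R]intrM -pmulrn; field.
Qed.

(** Orthogonality of characters: raising one coordinate of [th] permutes the index set and rotates
    the pair of cosine and sine sums by the angle of [beta], a nontrivial rotation, so the pair is
    0. *)
Lemma sum_cos1_pairing s :
  ~ (forall i, (M%:Z %| s i)%Z) -> \sum_th cos1 (pairing th s) = 0.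
Proof.
move=> /existsNP[i0 ns]; pose beta : R := (s i0)%:~R / M%:R.
have M1 : M%:R != 0 :> R by rewrite pnatr_eq0 -lt0n.
have nb : cos1 beta < 1.
  apply: cos1_neq1; apply/negP => /intrP[k bk]; apply: ns; apply/dvdzP; exists k.
  apply/eqP; rewrite -(eqr_int R) intrM -pmulrn -bk /beta divfK//.
pose C := \sum_th cos1 (pairing th s); pose S := \sum_th sin1 (pairing th s).
have CE : C = C * cos1 beta - S * sin1 beta.
  rewrite {1}/C (reindex_inj (@shift_inj i0))/= !mulr_suml -sumrB.
  apply: eq_bigr => th _; have [k ->] := pairing_shift i0 th s.
  by rewrite cos1Dz cos1D.
have SE : S = S * cos1 beta + C * sin1 beta.
  rewrite {1}/S (reindex_inj (@shift_inj i0))/= !mulr_suml -big_split/=.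
  apply: eq_bigr => th _; have [k ->] := pairing_shift i0 th s.
  by rewrite sin1Dz sin1D.
rewrite -/C; apply/eqP.
have : C * ((1 - cos1 beta) ^+ 2 + sin1 beta ^+ 2) = 0.
  have E1 : C * (1 - cos1 beta) = - (S * sin1 beta) by rewrite mulrBr mulr1 {1}CE; ring.
  have E2 : S * (1 - cos1 beta) = C * sin1 beta by rewrite mulrBr mulr1 {1}SE; ring.
  have -> : C * ((1 - cos1 beta) ^+ 2 + sin1 beta ^+ 2) =
    (C * (1 - cos1 beta)) * (1 - cos1 beta) + (C * sin1 beta) * sin1 beta by ring.
  by rewrite E1 -E2; ring.
move/eqP; rewrite mulf_eq0 => /orP[//|/eqP H].
have : 0 < (1 - cos1 beta) ^+ 2 by rewrite exprn_gt0// subr_gt0.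
by have := sqr_ge0 (sin1 beta); lra.
Qed.

Variables (N : nat) (C : {set Gam}).
Hypothesis CN : (#|{: Gam}| <= N * #|C|)%N.

Let df a b : 'I_r -> int := fun i => (a i)%:Z - (b i)%:Z.
(** The squared modulus of the Fourier transform of the indicator of [C]. *)
Let q th : R := \sum_(a in C) \sum_(b in C) cos1 (pairing th (df a b)).

Let q_ge0 th : 0 <= q th.
Proof.
pose z a := pairing th (fun i => (a i)%:Z).
have -> : q th = (\sum_(a in C) cos1 (z a)) ^+ 2 + (\sum_(a in C) sin1 (z a)) ^+ 2.
  rewrite !expr2 !mulr_suml -big_split/=; apply: eq_bigr => a _.
  rewrite !mulr_sumr -big_split/=; apply: eq_bigr => b _.
  by rewrite /df pairingB -/(z a) -/(z b) cos1D cos1N sin1N mulrN opprK.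
by rewrite addr_ge0// sqr_ge0.
Qed.

Let G0 : (0 < #|{: Gam}|)%N.
Proof. by apply/card_gt0P; exists [ffun=> Ordinal M0]. Qed.

Let C0 : (0 < #|C|)%N.
Proof.
rewrite lt0n; apply/negP => /eqP C0; move: CN G0.
by rewrite C0 muln0 leqn0 => /eqP ->.
Qed.

Let pairing0 s : pairing [ffun=> Ordinal M0] s = 0.
Proof. by rewrite /pairing big1 ?mul0r// => i _; rewrite ffunE mul0r. Qed.

Let q0 : q [ffun=> Ordinal M0] = #|C|%:R ^+ 2.
Proof.
rewrite /q (eq_bigr (fun=> #|C|%:R)); last first.
  move=> a _; rewrite (eq_bigr (fun=> 1)) ?sumr_const// => b _.
  by rewrite pairing0 cos1_0.
by rewrite sumr_const -[LHS]mulr_natr expr2.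
Qed.

Let dvd_df a b : (forall i, (M%:Z %| df a b i)%Z) -> a = b.
Proof.
move=> H; apply/ffunP => i; apply: val_inj => /=.
have := H i; rewrite -eqz_mod_dvd => /eqP; rewrite /= !modz_small.
- by case.
- by rewrite /= ltz_nat ltn_ord.
- by rewrite /= ltz_nat ltn_ord.
Qed.

(** Parseval's identity for the indicator of [C]. *)
Let sum_q : \sum_th q th = #|{: Gam}|%:R * #|C|%:R.
Proof.
rewrite /q exchange_big/= (eq_bigr (fun=> #|{: Gam}|%:R)).
  by rewrite sumr_const -[LHS]mulr_natr.
move=> a aC; rewrite exchange_big/= (bigD1 a)//= [X in _ + X]big1 ?addr0.
  rewrite (eq_bigr (fun=> 1)) ?sumr_const// => th _.
  by rewrite /df pairingB subrr cos1_0.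
move=> b /andP[_ ba]; apply: sum_cos1_pairing => /dvd_df ab.
by rewrite ab eqxx in ba.
Qed.

(** The large spectrum of [C]. With this threshold Parseval bounds its size by [N ^ 2], and the
    other frequencies cannot cancel the main term [#|C| ^ 4]. *)
Let L : {set Gam} := [set th | #|C|%:R ^+ 3 / #|{: Gam}|%:R <= q th].

Let L_card : (#|L| <= N ^ 2)%N.
Proof.
have g0 : 0 < #|{: Gam}|%:R :> R by rewrite ltr0n.
have c0 : 0 < #|C|%:R :> R by rewrite ltr0n.
have : #|L|%:R * (#|C|%:R ^+ 3 / #|{: Gam}|%:R) <= #|{: Gam}|%:R * #|C|%:R :> R.
  rewrite -sum_q (bigID (mem L))/= -[leLHS]addr0 lerD ?sumr_ge0//.
  rewrite mulrC mulr_natr -sumr_const; apply: ler_sum => th.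
  by rewrite inE.
rewrite mulrA ler_pdivrMr// => H.
have {}H : #|L|%:R * #|C|%:R ^+ 2 <= #|{: Gam}|%:R ^+ 2 :> R.
  rewrite -(ler_pM2r c0) -mulrA -exprSr; apply: le_trans H _.
  by rewrite expr2 mulrAC.
have : #|L|%:R * #|C|%:R ^+ 2 <= (N ^ 2)%:R * #|C|%:R ^+ 2 :> R.
  apply: le_trans H _; rewrite natrX -exprMn lerXn2r ?nnegrE ?mulr_ge0//.
  by rewrite -natrM ler_nat.
by rewrite ler_pM2r ?exprn_gt0// ler_nat.
Qed.

(** Up to the group order, the sum over [th] of [q th ^+ 2 * cos1 (pairing th s)] counts the
    representations of [s] as [a - b + c - d] modulo [M]. It is positive as soon as the cosines are
    nonnegative on the large spectrum. *)
Lemma bogolyubov : exists2 L : {set Gam}, (#|L| <= N ^ 2)%N &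
  forall s, (forall th, th \in L -> near_int (1 / 4) (pairing th s)) ->
    exists a b c d, [/\ a \in C, b \in C, c \in C, d \in C &
      forall i, (M%:Z %| (a i)%:Z - (b i)%:Z + ((c i)%:Z - (d i)%:Z) - s i)%Z].
Proof.
exists L => // s sL; apply: contrapT => ns.
have g0 : 0 < #|{: Gam}|%:R :> R by rewrite ltr0n.
have c0 : 0 < #|C|%:R :> R by rewrite ltr0n.
have nd a b c d : a \in C -> b \in C -> c \in C -> d \in C ->
  \sum_th cos1 (pairing th (df a b) + pairing th (df c d) - pairing th s) = 0.
  move=> aC bC cC dC.
  rewrite (eq_bigr (fun th => cos1 (pairing th (fun i => df a b i + df c d i - s i)))).
    by apply: sum_cos1_pairing => H; apply: ns; exists a, b, c, d; split.
  by move=> th _; rewrite -pairingD -pairingB.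
have pN th a b : pairing th (df a b) = - pairing th (df b a).
  by rewrite -pairingN; congr pairing; apply/funext => i; rewrite opprB.
have : \sum_th q th ^+ 2 * cos1 (pairing th s) = 0.
  rewrite (eq_bigr (fun th => \sum_(a in C) \sum_(b in C) \sum_(c in C) \sum_(d in C)
      cos1 (pairing th (df a b)) * cos1 (pairing th (df c d)) * cos1 (pairing th s))).
    rewrite exchange_big/= big1// => a aC; rewrite exchange_big/= big1// => b bC.
    rewrite exchange_big/= big1// => c cC; rewrite exchange_big/= big1// => d dC.
    (* A product of three cosines is the mean of four cosines with varying signs; a change of sign
       swaps [a] with [b] or [c] with [d], so [nd] covers all four. *)
    rewrite (eq_bigr (fun th => (1 / 4) *
      ((cos1 (pairing th (df b a) + pairing th (df d c) - pairing th s) +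
        cos1 (pairing th (df a b) + pairing th (df c d) - pairing th s)) +
       (cos1 (pairing th (df b a) + pairing th (df c d) - pairing th s) +
        cos1 (pairing th (df a b) + pairing th (df d c) - pairing th s))))).
      by rewrite -mulr_sumr !big_split/= !nd// !addr0 mulr0.
    move=> th _; rewrite (pN _ b a) (pN _ d c).
    set x := pairing _ (df a b); set y := pairing _ (df c d); set z := pairing _ s.
    rewrite cos1M !mulrDl !(mulrAC _ (2^-1)) !cos1M.
    rewrite -(cos1N (- x - y - z)) -(cos1N (- x + y - z)).
    rewrite (_ : - (- x - y - z) = x + y + z); last by ring.
    rewrite (_ : - (- x + y - z) = x - y + z); last by ring.
    by field.
  move=> th _; rewrite expr2 {1}/q !mulr_suml; apply: eq_bigr => a _.
  rewrite !mulr_suml; apply: eq_bigr => b _.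
  rewrite /q mulr_sumr mulr_suml; apply: eq_bigr => c _.
  by rewrite mulr_sumr mulr_suml.
apply/eqP; rewrite gt_eqF//.
pose th0 : Gam := [ffun=> Ordinal M0]; pose kap : R := #|C|%:R ^+ 3 / #|{: Gam}|%:R.
have k0 : 0 < kap by rewrite divr_gt0// exprn_gt0.
have th0L : th0 \in L.
  rewrite inE q0 ler_pdivrMr// exprSr ler_pM2l ?exprn_gt0// ler_nat.
  exact: max_card.
(* The trivial character contributes [#|C| ^ 4], the rest of [L] a nonnegative amount, the
   complement of [L] at least [- (#|C| ^ 4 - kap * #|C| ^ 2)]. *)
rewrite (bigID (mem L))/= (bigD1 th0)//= q0 pairing0 cos1_0 mulr1.
have H1 : 0 <= \sum_(th in L | th != th0) q th ^+ 2 * cos1 (pairing th s).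
  apply: sumr_ge0 => th /andP[thL _]; rewrite mulr_ge0 ?sqr_ge0//.
  by apply: cos1_ge0; exact: sL.
have H2 : - (kap * (#|{: Gam}|%:R * #|C|%:R - #|C|%:R ^+ 2)) <=
    \sum_(th | th \notin L) q th ^+ 2 * cos1 (pairing th s).
  apply: (@le_trans _ _ (- (kap * \sum_(th | th \notin L) q th))).
    have E : #|{: Gam}|%:R * #|C|%:R = #|C|%:R ^+ 2 +
        \sum_(th in L | th != th0) q th + \sum_(th | th \notin L) q th.
      by rewrite -sum_q (bigID (mem L))/= [X in X + _ = _](bigD1 th0)//= q0.
    have : 0 <= \sum_(th in L | th != th0) q th by apply: sumr_ge0.
    by rewrite lerN2 ler_pM2l// E; lra.
  rewrite mulr_sumr -sumrN; apply: ler_sum => th.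
  rewrite inE -ltNge => qk; rewrite -[leLHS]mulr1 mulNr -mulrN.
  have : q th ^+ 2 <= kap * q th by rewrite expr2 ler_wpM2r// ltW.
  by have := cos1_geN1 (pairing th s); have := sqr_ge0 (q th); nra.
have H3 : kap * (#|{: Gam}|%:R * #|C|%:R) = #|C|%:R ^+ 4.
  by rewrite /kap; field; rewrite gt_eqF.
have H4 : 0 < kap * #|C|%:R ^+ 2 by rewrite mulr_gt0// exprn_gt0.
have H5 : (#|C|%:R ^+ 2) ^+ 2 = #|C|%:R ^+ 4 :> R by rewrite -exprM.
move: H2; rewrite mulrBr H3 H5 opprB; lra.
Qed.

End Bogolyubov.

(** * Foelner's theorem *)

Section Folner.
Variables (R : realType) (G : zmodType) (N : nat) (P D U : set G) (col : G -> 'I_N).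
Hypothesis colD : forall x y, P x -> P y -> col x = col y -> D (x - y).
Hypothesis DU : forall x y z, D x -> D y -> D z -> U (x + y + z).

Section Step.
Variables (r K : nat) (b : 'I_r -> G).
Let comb (d : 'I_r -> int) : G := \sum_i b i *~ d i.
Hypothesis combP : forall d, P (comb d).

Let combB d d' : comb (fun i => d i - d' i) = comb d - comb d'.
Proof. by rewrite /comb -sumrB; apply: eq_bigr => i _; rewrite mulrzBr. Qed.
Let combD d d' : comb (fun i => d i + d' i) = comb d + comb d'.
Proof. by rewrite /comb -big_split; apply: eq_bigr => i _; rewrite mulrzDr. Qed.

(* Pigeonhole: some modulus [M > K] makes the wrap-around vectors [M * u],
   [u] in [{-2,..,2}^r], land in [D]. *)
Let modulus : exists2 M, (K < M)%N & forall u : 'I_r -> int,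
  (forall i, -2 <= u i <= 2) -> D (comb (fun i => M%:Z * u i)).
Proof.
pose V := {ffun 'I_r -> 'I_5}.
pose vec (t : nat) (v : V) : 'I_r -> int := fun i => (K.+1 * t)%:Z * ((v i)%:Z - 2).
pose f (t : 'I_#|{: {ffun V -> 'I_N}}|.+1) : {ffun V -> 'I_N} :=
  [ffun v => col (comb (vec t v))].
have : ~~ injectiveb f.
  apply/negP => /injectiveP/leq_card; by rewrite card_ord ltnn.
move=> /injectivePn[t1 [t2 t12 ft]].
wlog lt12 : t1 t2 t12 ft / (t1 < t2)%N.
  move=> H; have [lt|lt|E] := ltngtP t1 t2; first exact: (H t1 t2).
    by apply: (H t2 t1) => //; rewrite eq_sym.
  by move/val_inj: E => E; rewrite E eqxx in t12.
exists (K.+1 * (t2 - t1))%N; first by rewrite mulSn; have := lt12; rewrite -subn_gt0; case: (t2 - t1)%N => // n _; rewrite mulnS; lia.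
move=> u u2.
have vP i : (`|(u i + 2)%R|%N < 5)%N by have := u2 i; lia.
pose v : V := [ffun i => Ordinal (vP i)].
have := congr1 (fun g : {ffun V -> 'I_N} => g v) ft; rewrite !ffunE => /esym/(colD (combP _) (combP _)).
rewrite -combB; congr (D (comb _)); apply/funext => i; rewrite /vec ffunE /=.
have -> : (`|(u i + 2)%R|%N)%:Z - 2 = u i by have := u2 i; lia.
by rewrite -mulrBl subzn ?leq_mul2l ?(ltnW lt12) ?orbT// mulnBr.
Qed.

(** The most frequent colour fills at least the fraction 1/N of the box of side [M], read as
    (Z/M)^r. Bogolyubov's lemma writes [d] as two differences from that class up to a multiple of
    [M], and the choice of [M] puts the latter into [D]. The number [N ^ 2] of characters depends
    neither on [r] nor on [K], which makes a limit possible. *)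
Lemma folner_step : exists2 c : 'I_(N ^ 2) -> 'I_r -> R,
  (forall t i, 0 <= c t i <= 1) &
  forall d, (forall i, (`|d i| <= K)%N) ->
    (forall t, near_int (1 / 4) (\sum_i (d i)%:~R * c t i)) -> U (comb d).
Proof.
have [M KM MD] := modulus.
have M0 : (0 < M)%N by apply: leq_trans KM.
have MR : 0 < M%:R :> R by rewrite ltr0n.
pose Gam := {ffun 'I_r -> 'I_M}.
pose pt (a : Gam) : 'I_r -> int := fun i => (a i)%:Z.
pose cl (n : 'I_N) : {set Gam} := [set a | col (comb (pt a)) == n]%SET.
have N0 : (0 < #|'I_N|)%N by apply/card_gt0P; exists (col 0).
have [n nmax] := bigop.eq_bigmax (fun n => #|cl n|) N0.
have CN : (#|{: Gam}| <= N * #|cl n|)%N.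
  have -> : #|{: Gam}| = (\sum_n #|cl n|)%N.
    rewrite -sum1_card (partition_big (fun a => col (comb (pt a))) predT)//=.
    by apply: eq_bigr => k _; rewrite -sum1_card; apply: eq_bigl => a; rewrite inE.
  rewrite -[X in (_ <= X * _)%N]card_ord -sum_nat_const; apply: leq_sum => k _.
  by rewrite -nmax; exact: (@bigop.leq_bigmax _ (fun n => #|cl n|)).
have [L LN Lb] := bogolyubov R M0 CN.
pose th0 : Gam := [ffun=> Ordinal M0].
(* When [L] has fewer than [N ^ 2] elements, the list is padded with the trivial character. *)
exists (fun t i => (nth th0 (enum L) t i)%:R / M%:R).
  move=> t i; rewrite divr_ge0//= ler_pdivrMr// mul1r ler_nat.
  by rewrite ltnW// ltn_ord.
move=> d dK dc.
have [|a [a' [c [c' [aC a'C cC c'C dvd]]]]] := Lb d.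
  move=> th thL; have thi : (index th (enum L) < N ^ 2)%N.
    by apply: leq_trans LN; rewrite cardE index_mem mem_enum.
  have := dc (Ordinal thi); congr near_int; rewrite /= nth_index ?mem_enum//.
  rewrite /pairing raddf_sum mulr_suml; apply: eq_bigr => i _ /=.
  by rewrite intrM mulrAC mulrC -pmulrn.
pose u i := (((a i)%:Z - (a' i)%:Z + ((c i)%:Z - (c' i)%:Z) - d i) %/ M%:Z)%Z.
have uE i : u i * M%:Z = (a i)%:Z - (a' i)%:Z + ((c i)%:Z - (c' i)%:Z) - d i.
  exact: divzK.
(* The numerator is at most [2 * (M - 1) + K] in absolute value, which is less than [3 * M] because
   [K < M]. *)
have u2 i : -2 <= - u i <= 2.
  have := uE i; have := dK i.
  move: (ltn_ord (a i)) (ltn_ord (a' i)) (ltn_ord (c i)) (ltn_ord (c' i)).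
  move: (u i) (d i) (a i : nat) (a' i : nat) (c i : nat) (c' i : nat).
  by move=> u' d' x y z t *; nia.
have clD e e' : e \in cl n -> e' \in cl n -> D (comb (pt e) - comb (pt e')).
  by rewrite !inE => /eqP En /eqP En'; apply: colD => //; rewrite En.
have -> : comb d = (comb (pt a) - comb (pt a')) + (comb (pt c) - comb (pt c')) +
    comb (fun i => M%:Z * - u i).
  rewrite -!combB -!combD; congr comb; apply/funext => i.
  by rewrite mulrN mulrC uE /pt; ring.
apply: DU; [exact: clD|exact: clD|exact: MD].
Qed.

End Step.

Lemma ultra_fmap (I T : Type) (F : set_system I) (f : I -> T) :
  UltraFilter F -> UltraFilter (f @ F).
Proof.
move=> FU; apply: Build_UltraFilter => H HP FH; apply/seteqP; split=> // A HA.
have [//|FnA] := in_ultra_setVsetC (f @^-1` A) FU.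
have : H (A `&` ~` A) by apply: filterI => //; exact: FH.
by rewrite setICr => /filter_not_empty.
Qed.

Lemma ultra_lim (I : Type) (F : set_system I) (f : I -> R) : UltraFilter F ->
  (forall i, 0 <= f i <= 1) -> exists l : R, f @ F --> l.
Proof.
move=> FU f01; have := @segment_compact R 0 1.
rewrite compact_ultra => /(_ (f @ F) (ultra_fmap f FU))[].
  by apply: (@filterE _ F) => i /=; rewrite in_itv/=; exact: f01.
by move=> l [_ fl]; exists l.
Qed.

(** Lists of pairs (coefficient, generator) stand for the free group on [J]. The characters found
    for finitely many generators and bounded coefficients converge along an ultrafilter; closeness
    to an integer is an open condition, so it passes from the limit back to a stage that handles the
    given list. *)
Lemma folner (J : eqType) (b : J -> G) :
  (forall l : seq (int * J), P (\sum_(p <- l) b p.2 *~ p.1)) ->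
  exists c : 'I_(N ^ 2) -> J -> R, forall l : seq (int * J),
    (forall t, near_int (1 / 4) (\sum_(p <- l) p.1%:~R * c t p.2)) ->
    U (\sum_(p <- l) b p.2 *~ p.1).
Proof.
move=> bP.
pose coef (s : seq J) (l : seq (int * J)) (i : 'I_(size s)) : int :=
  \sum_(p <- l) (if p.2 == tnth (in_tuple s) i then p.1 else 0).
have sumE (V : zmodType) (s : seq J) (l : seq (int * J)) (h : J -> V) :
    uniq s -> (forall p, p \in l -> p.2 \in s) ->
    \sum_(p <- l) h p.2 *~ p.1 = \sum_i h (tnth (in_tuple s) i) *~ coef s l i.
  move=> us ls; under [RHS]eq_bigr do rewrite mulrz_sumr.
  rewrite exchange_big/= big_seq [RHS]big_seq; apply: eq_bigr => p /ls ps.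
  have pi : (index p.2 s < size s)%N by rewrite index_mem.
  rewrite (bigD1 (Ordinal pi))//= (tnth_nth p.2)/= nth_index// eqxx big1 ?addr0//.
  move=> i; rewrite -val_eqE/= (tnth_nth p.2)/= => ni.
  case: eqP => [E|]; rewrite ?mulr0z//.
  by move: ni; rewrite E index_uniq ?eqxx.
have step (k : seq J * nat) : exists c : 'I_(N ^ 2) -> J -> R,
    (forall t j, 0 <= c t j <= 1) /\
    forall l, (forall p, p \in l -> p.2 \in k.1) ->
      (\sum_(p <- l) `|p.1|%N <= k.2)%N ->
      (forall t, near_int (1 / 4) (\sum_(p <- l) p.1%:~R * c t p.2)) ->
      U (\sum_(p <- l) b p.2 *~ p.1).
  case: k => s0 K /=; pose s := undup s0.
  have [|c c01 cU] := @folner_step (size s) K (fun i => b (tnth (in_tuple s) i)).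
    move=> d; pose l := [seq (d i, tnth (in_tuple s) i) | i <- enum 'I_(size s)].
    by have := bP l; rewrite big_map big_enum.
  pose c' t j := if insub (index j s) is Some i then c t i else 0.
  exists c'; split.
    by move=> t j; rewrite /c'; case: insubP => [i _ _|_]; rewrite ?c01// lexx ler01.
  move=> l ls lK lc.
  have us : uniq s by exact: undup_uniq.
  have {}ls p : p \in l -> p.2 \in s by move/ls; rewrite mem_undup.
  have -> : \sum_(p <- l) b p.2 *~ p.1 =
      \sum_i b (tnth (in_tuple s) i) *~ coef s l i.
    exact: sumE.
  apply: cU.
    move=> i; apply: leq_trans lK; rewrite /coef.
    elim/big_rec2: _ => // p x y _ xy.
    by case: ifP => _; lia.
  move=> t; have := lc t; congr near_int.
  under eq_bigr do rewrite mulrzl.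
  rewrite (sumE _ s)//; apply: eq_bigr => i _; rewrite -mulrzl.
  congr (_ * _).
  rewrite /c' (tnth_nth (tnth (in_tuple s) i))/= index_uniq//.
  by rewrite insubT//= => ?; congr (c t _); exact: val_inj.
have {step} [c cP] := choice step.
pose A (l : seq (int * J)) : set (seq J * nat) := [set k : seq J * nat |
  (forall p, p \in l -> p.2 \in k.1) /\ (\sum_(p <- l) `|p.1|%N <= k.2)%N].
have FF : ProperFilter (filter_from setT A).
  apply: filter_from_proper.
    apply: filter_from_filter; first by exists [::].
    move=> l l' _ _; exists (l ++ l') => // k [lk Kk]; move: Kk; rewrite big_cat/= => Kk.
    by split; (split; [move=> p pl; apply: lk; rewrite mem_cat pl ?orbT|
      apply: leq_trans Kk; rewrite ?leq_addr ?leq_addl]).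
  move=> l _; exists ([seq p.2 | p <- l], (\sum_(p <- l) `|p.1|%N)%N); split => //=.
  by move=> p pl; apply/mapP; exists p.
have [F [FU FA]] := ultraFilterLemma FF.
have lim (tj : 'I_(N ^ 2) * J) : exists z : R, (fun k => c k tj.1 tj.2) @ F --> z.
  by apply: ultra_lim => k; exact: (cP k).1.
have {lim} [z zP] := choice lim.
exists (fun t j => z (t, j)) => l lz.
have limS t : (fun k => \sum_(p <- l) p.1%:~R * c k t p.2) @ F -->
    \sum_(p <- l) p.1%:~R * z (t, p.2).
  elim: l {lz} => [|p l IH].
    by under eq_fun do rewrite big_nil; rewrite big_nil; exact: cvg_cst.
  under eq_fun do rewrite big_cons; rewrite big_cons.
  apply: cvgD => //; apply: cvgMr; exact: (zP (t, p.2)).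
have lF t : F [set k | near_int (1 / 4) (\sum_(p <- l) p.1%:~R * c k t p.2)].
  have [m lm] := lz t; pose e := 1 / 4 - `|\sum_(p <- l) p.1%:~R * z (t, p.2) - m%:~R|.
  have e0 : 0 < e by rewrite subr_gt0.
  have /cvgrPdist_lt/(_ e e0) := limS t; apply: filterS => k ke; exists m.
  set x := \sum_(p <- l) _ * z _ in e ke e0 *; set y := \sum_(p <- l) _.
  rewrite (_ : y - m%:~R = (x - m%:~R) - (x - y)); last by ring.
  by rewrite (le_lt_trans (ler_normB _ _))// -ltrBrDl.
have : F (A l `&` \bigcap_t [set k | near_int (1 / 4) (\sum_(p <- l) p.1%:~R * c k t p.2)]).
  apply: filterI; first by apply: FA; exists l.
  by apply: filterS (filter_forall _ lF) => k kl t _; exact: kl.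
move=> /filter_ex[k [[lk1 lk2] klc]].
by apply: (cP k).2 => // t; exact: klc.
Qed.

End Folner.

(** * Recursive choice, last indices, and the pigeonhole principle on a torus *)

Lemma exists_seq (T : Type) (Q : seq T -> T -> Prop) :
  (forall s, exists x, Q s x) -> exists a : nat -> T, forall n, Q (mkseq a n) (a n).
Proof.
move=> /choice[f fQ]; pose s n := iter n (fun s => rcons s (f s)) [::].
exists (fun n => f (s n)) => n.
suff -> : mkseq (fun n => f (s n)) n = s n by exact: fQ.
by elim: n => // n IH; rewrite mkseqS IH.
Qed.

Lemma exists_last (P : pred nat) r i : (i < r)%N -> P i ->
  exists j, [/\ (i <= j < r)%N, P j & forall k, (j < k < r)%N -> ~~ P k].
Proof.
move=> ir Pi; pose Q := [pred j | (j < r)%N && P j].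
have Qr j : Q j -> (j <= r)%N by case/andP => /ltnW.
have exQ : exists j, Q j by exists i; rewrite /= ir.
case: (ex_maxnP exQ Qr) => j /andP[jr Pj] jmax.
exists j; split => //; first by rewrite jr andbT; apply: jmax; rewrite /= ir.
move=> k /andP[jk kr]; apply/negP => Pk.
by have := jmax k; rewrite /= kr Pk leqNgt jk => /(_ isT).
Qed.

Lemma pigeonhole_torus (R : realType) (v : nat -> nat -> R) (m n0 : nat) (e : R) :
  0 < e -> exists i j, (n0 <= i < j)%N /\
    forall t, (t < m)%N -> near_int e (v i t - v j t).
Proof.
move=> e0; pose Q := (Num.truncn (1 / e)).+1.
have Qe : 1 / Q%:R < e.
  by rewrite ltr_pdivrMr// -ltr_pdivrMl// mulr1 -[X in X < _]mul1r truncnS_gt.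
have Q0 : 0 < Q%:R :> R by rewrite ltr0n.
pose fr (x : R) := x - (Num.floor x)%:~R.
have fr0 x : 0 <= fr x by rewrite subr_ge0 floor_le.
have fr1 x : fr x < 1 by have := floorD1_gt x; rewrite intrD -ltrBlDl.
have bP (x : R) : (Num.truncn (fr x * Q%:R) < Q)%N.
  by rewrite truncn_lt_nat ?mulr_ge0// -[ltRHS]mul1r ltr_pM2r.
pose f (i : 'I_#|{: {ffun 'I_m -> 'I_Q}}|.+1) : {ffun 'I_m -> 'I_Q} :=
  [ffun t : 'I_m => Ordinal (bP (v (n0 + i)%N t))].
have : ~~ injectiveb f.
  apply/negP => /injectiveP/leq_card; by rewrite card_ord ltnn.
move=> /injectivePn[i [j ij fij]].
wlog ltij : i j ij fij / (i < j)%N.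
  move=> H; have [lt|lt|E] := ltngtP i j; first exact: (H i j).
    by apply: (H j i) => //; rewrite eq_sym.
  by move/val_inj: E => E; rewrite E eqxx in ij.
exists (n0 + i)%N, (n0 + j)%N; split; first by rewrite leq_addr ltn_add2l.
move=> t tm; have := congr1 (fun g : {ffun 'I_m -> 'I_Q} => g (Ordinal tm)) fij.
rewrite !ffunE => /(congr1 val)/=.
set x := v _ t; set y := v _ t => xy.
exists (Num.floor x - Num.floor y); apply: lt_trans Qe.
have -> : x - y - (Num.floor x - Num.floor y)%:~R = fr x - fr y.
  by rewrite intrB /fr; ring.
rewrite ltr_pdivlMr// -[X in _ * X]ger0_norm// -normrM mulrBl.
have := truncn_itv (mulr_ge0 (fr0 x) (ltW Q0)).
have := truncn_itv (mulr_ge0 (fr0 y) (ltW Q0)).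
rewrite xy -natr1 ltr_norml => /andP[? ?] /andP[? ?].
by apply/andP; split; lra.
Qed.

(** * Sets covered by finitely many translates *)

Section Covered.
Variable G : zmodType.
Implicit Types (P S W V T : set G) (E : seq G).

Definition covered P W := exists E, forall x, P x -> exists2 e, e \in E & W (x - e).

Definition mulG (n : nat) : set G := [set x *+ n | x in [set: G]].

(** B. H. Neumann's lemma on coverings by cosets, with difference sets in place of subgroups. If [g]
    avoids [E + (S i - S i)], translation by [g] moves what the translates of [S i] cover out of
    their reach, so translates of the other sets would cover everything, and induction applies. *)
Lemma neumann (I : eqType) (s : seq I) (S : I -> set G) :
  (forall i, i \in s ->
    ~ covered setT [set z | exists x y, [/\ S i x, S i y & z = x - y]]) ->
  forall E, exists a, forall i e, i \in s -> e \in E -> ~ S i (a - e).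
Proof.
elim: s => [|i s IH] Ss E; first by exists 0.
have {}IH := IH (fun j js => Ss j (@mem_behead _ (i :: s) j js)).
apply: contrapT => nE.
have cov a : (exists2 e, e \in E & S i (a - e)) \/
    exists j e, [/\ j \in s, e \in E & S j (a - e)].
  apply: contrapT => na; apply: nE; exists a => j e.
  rewrite inE => /predU1P[->|js] eE Sae.
    by apply: na; left; exists e.
  by apply: na; right; exists j, e.
have [g gE] : exists g, forall e, e \in E -> forall x y, S i x -> S i y -> g - e <> x - y.
  apply: contrapT => ng; apply: (Ss i (mem_head _ _)).
  exists E => x _; apply: contrapT => nx; apply: ng; exists x => e eE y z Sy Sz E'.
  by apply: nx; exists e => //; exists y, z.
(* The extra translates exclude that [g + (a - e)] lies in [e' + S j] for one of the other sets. *)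
have [a aE] := IH (E ++ [seq e - g + e' | e <- E, e' <- E]).
have [[e eE Sae]|[j [e [js eE Sae]]]] := cov a; last first.
  by apply: (aE j e) => //; rewrite mem_cat eE.
have [[e' e'E Sg]|[j [e' [js e'E Sg]]]] := cov (g + (a - e)).
  apply: (gE e' e'E _ _ Sg Sae).
  by rewrite [RHS]addrAC addrK.
apply: (aE j (e - g + e') js).
  by rewrite mem_cat; apply/orP; right; apply/allpairsP; exists (e, e').
by rewrite opprD addrA opprB addrCA.
Qed.

(** Neumann's lemma for the preimages of [T i] under multiplication by [k i]. Each translate
    [W i + e] is replaced by one point [a0] of its preimage: any other point of the preimage differs
    from [a0] by a point that [k i] sends into [T i]. *)
Lemma exists_avoid (I : eqType) (s : seq I) (k : I -> nat) (W : I -> set G) :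
  (forall i, i \in s -> exists T V, [/\
    forall x y, W i x -> W i y -> T (x - y),
    forall x y, T x -> T y -> V (x - y) & ~ covered (mulG (k i)) V]) ->
  forall E, exists a, forall i e, i \in s -> e \in E -> ~ W i (a *+ k i - e).
Proof.
move=> H E.
have /choice[T TP] : forall i, exists T : set G, i \in s ->
    (forall x y, W i x -> W i y -> T (x - y)) /\
    exists2 V : set G, forall x y, T x -> T y -> V (x - y) & ~ covered (mulG (k i)) V.
  move=> i; have [/H[T [V [WT TV nV]]]|] := boolP (i \in s); last by exists setT.
  by exists T => _; split => //; exists V.
have /choice[h hP] : forall ie : I * G, exists a0 : G, forall a,
    W ie.1 (a *+ k ie.1 - ie.2) -> W ie.1 (a0 *+ k ie.1 - ie.2).
  move=> [i e] /=; have [[a0 Wa0]|na] := pselect (exists a, W i (a *+ k i - e)).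
    by exists a0.
  by exists 0 => a Wa; exfalso; apply: na; exists a.
have [i /TP[WT [V TV nV] cov]|a aE] := @neumann I s (fun i => [set a | T i (a *+ k i)]) _
    [seq h (i, e) | i <- s, e <- E].
  apply: nV; have [E' E'P] := cov; exists [seq e *+ k i | e <- E'].
  move=> _ [x _ <-]; have [e eE [y [z [Ty Tz xe]]]] := E'P x Logic.I.
  exists (e *+ k i); first by apply/mapP; exists e.
  by rewrite -mulrnBl xe mulrnBl; exact: TV.
exists a => i e si eE Wa; apply: (aE i (h (i, e)) si).
  by apply/allpairsP; exists (i, e).
have [WT _] := TP i si.
have := WT _ _ Wa (hP (i, e) a Wa).
by rewrite /= opprB addrA subrK mulrnBl.
Qed.

Lemma combos (s : seq G) (K : nat) : exists E, forall c : nat -> int,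
  (forall i, (`|c i| <= K)%N) -> \sum_(i < size s) s`_i *~ c i \in E.
Proof.
elim: s => [|x s [E EP]]; first by exists [:: 0] => c _; rewrite big_ord0 mem_head.
exists [seq x *~ (k%:Z - K%:Z) + y | k <- iota 0 (K + K).+1, y <- E] => c cK.
apply/allpairsP; exists (absz (c 0%N + K%:Z)%R, \sum_(i < size s) s`_i *~ c i.+1).
split; first by rewrite mem_iota; have := cK 0%N; move=> /=; lia.
  exact: (EP (fun i => c i.+1)).
rewrite big_ord_recl /=; congr (x *~ _ + _).
by have := cK 0%N; lia.
Qed.

End Covered.

Section FiniteCombinations.
Variables (G : zmodType) (a : nat -> G).

Definition comb (r : nat) (c : nat -> int) : G := \sum_(j < r) a j *~ c j.

Lemma comb_widen r r' c : (forall j, (r <= j)%N -> c j = 0) -> (r <= r')%N ->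
  comb r' c = comb r c.
Proof.
move=> c0 rr'; rewrite /comb (big_ord_widen _ (fun j => a j *~ c j) rr').
rewrite [RHS]big_mkcond; apply: eq_bigr => j _.
by case: ltnP => // /c0 ->; rewrite mulr0z.
Qed.

Lemma combB r c c' : comb r (fun j => c j - c' j) = comb r c - comb r c'.
Proof. by rewrite /comb -sumrB; apply: eq_bigr => i _; rewrite mulrzBr. Qed.

Lemma comb_delta r i : (i < r)%N -> comb r (fun j => (j == i)%:Z) = a i.
Proof.
move=> ir; rewrite /comb (bigD1 (Ordinal ir))//= eqxx mulr1z big1 ?addr0// => j.
by rewrite -val_eqE/= => /negbTE ->.
Qed.

Lemma comb_mkseq r (c : nat -> int) : \sum_(i < size (mkseq a r)) (mkseq a r)`_i *~ c i = comb r c.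
Proof. by rewrite size_mkseq; apply: eq_bigr => i _; rewrite nth_mkseq. Qed.

End FiniteCombinations.

(** * Some multiple of a minimal group is covered by translates of a given neighbourhood *)

Section Star.
Variable G : topologicalZmodType.
Hypothesis hG : hausdorff_space G.
Hypothesis Gmin : minimal_group G.

(** Otherwise a sequence can be chosen whose combinations with coefficients of order [2 ^ j] stay
    apart modulo [W]. The sets [Fm m] then have trivial adherence and converge to 0 by minimality,
    although [a m] belongs to [Fm m] and stays outside [W]. *)
Lemma minimal_mul_covered (U : set G) : nbhs (0 : G) U ->
  exists2 n, (0 < n)%N & covered (mulG n) U.
Proof.
move=> U0; apply: contrapT => nU.
have {}nU n : (0 < n)%N -> ~ covered (mulG n) U.
  by move=> n0 cU; apply: nU; exists n.
have [T [T0 _ _ _ TU]] := nbhs0_half U0.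
have [W [W0 Wn Wz _ WT]] := nbhs0_half T0.
have [s|a aP] := @exists_seq G (fun s x => forall k (c : nat -> int),
    (0 < k <= 2 ^ size s)%N -> (forall i, (`|c i| <= 2 ^ (size s).+1)%N) ->
    ~ W (x *+ k - \sum_(i < size s) s`_i *~ c i)).
  have [E EP] := combos s (2 ^ (size s).+1).
  have [k|a aE] := @exists_avoid G nat (iota 1 (2 ^ size s)) id (fun=> W) _ E.
    rewrite mem_iota => /andP[k0 _]; exists T, U; split => //; exact: nU.
  exists a => k c /andP[k0 k2] cP; apply: aE; last exact: EP.
  by rewrite mem_iota k0 add1n ltnS.
have {}aP j k c : (0 < k <= 2 ^ j)%N -> (forall i, (`|c i| <= 2 ^ j.+1)%N) ->
    ~ W (a j *+ k - comb a j c).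
  by have := aP j k c; rewrite comb_mkseq size_mkseq.
(* Raising [m] by one halves the bound on the coefficients, which absorbs the doubling caused by a
   subtraction. *)
pose Fm m : set G := [set x | exists r c, [/\ forall j, (r <= j)%N -> c j = 0,
  forall j, (j < m)%N -> c j = 0, forall j, (`|c j| <= 2 ^ (j - m))%N & x = comb a r c]].
have Fm_le m m' : (m <= m')%N -> Fm m' `<=` Fm m.
  move=> mm' x [r [c [cr cm c2 ->]]]; exists r, c; split => // j.
    by move=> jm; apply: cm; exact: leq_trans mm'.
  by apply: leq_trans (c2 j) _; rewrite leq_exp2l// leq_sub2l.
have [_ [m _ <-] FW] : exists2 F, range Fm F & F `<=` W.
  apply: (minimal_group_cvg _ _ _ _ Gmin) => //.
  - by exists (Fm 0%N), 0%N.
  - move=> _ [m _ <-]; exists 0%N, (fun=> 0); split => //; by rewrite /comb big_ord0.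
  - move=> _ _ [m _ <-] [m' _ <-]; exists (Fm (maxn m m')); first by exists (maxn m m').
    by move=> x Fx; split; apply: Fm_le Fx; rewrite ?leq_maxl ?leq_maxr.
  - move=> _ [m _ <-]; exists (Fm m.+1); first by exists m.+1.
    move=> _ _ [r [c [cr cm c2 ->]]] [r' [c' [cr' cm' c2' ->]]].
    exists (maxn r r'), (fun j => c j - c' j); split.
    + by move=> j; rewrite geq_max => /andP[? ?]; rewrite cr ?cr' ?subr0.
    + by move=> j jm; rewrite cm ?cm' ?subr0// ltnW.
    + move=> j; have [jm|jm] := leqP j m; first by rewrite cm ?cm'.
      have := c2 j; have := c2' j; rewrite -(subnSK jm) expnS; lia.
    + by rewrite combB (comb_widen a cr (leq_maxl r r')) (comb_widen a cr' (leq_maxr r r')).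
  (* An approximation of [g] from [Fm 0] has its support below some [r]. A second one, from [Fm r],
     must be 0, since its last nonzero coefficient would contradict the choice of that term; hence
     [g] lies in [V]. *)
  move=> g gF; apply: nbhs0_eq0 => // V V0.
  have [W1 [W10 _ _ _ W1W]] := nbhs0_half W0.
  have VW : nbhs (0 : G) (V `&` W1) by exact: filterI.
  have [|_ [r [c [cr _ c2 ->]]] [_ gf]] := gF (Fm 0%N) _ _ VW; first by exists 0%N.
  have [|_ [r' [c' [cr' cm' c2' ->]]] [Vgf' gf']] := gF (Fm r) _ _ VW; first by exists r.
  suff c'0 j : c' j = 0.
    have : comb a r' c' = 0 by rewrite /comb big1// => j _; rewrite c'0 mulr0z.
    by move=> E; rewrite E subr0 in Vgf'.
  apply: contrapT => /eqP c'j.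
  have jr' : (j < r')%N by rewrite ltnNge; apply: contra c'j => /cr' ->.
  have [i [/andP[ji ir'] ci imax]] := @exists_last (fun j => c' j != 0) r' j jr' c'j.
  have ri : (r <= i)%N by rewrite leqNgt; apply/negP => /cm' E; rewrite E eqxx in ci.
  pose d := fun j => if (j < i)%N then c j - c' j else 0.
  have dE : comb a r c - comb a r' c' = - (a i *~ c' i) + comb a i d.
    rewrite -(comb_widen a cr ri) (@comb_widen _ a i.+1 r' c') => [|k ik|//]; last first.
      have [kr|/cr'//] := ltnP k r'; apply/eqP.
      by have := imax k; rewrite ik kr negbK => ->.
    rewrite /comb big_ord_recr/= opprD addrA addrC -sumrB; congr (_ + _).
    by apply: eq_bigr => k _; rewrite /d ltn_ord mulrzBr.
  have dd j' : (`|d j'| <= 2 ^ i.+1)%N.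
    rewrite /d; case: ltnP => // j'i.
    have H1 : (`|c j'| <= 2 ^ i)%N.
      by apply: leq_trans (c2 j') _; rewrite subn0 leq_exp2l// ltnW.
    have H2 : (`|c' j'| <= 2 ^ i)%N.
      by apply: leq_trans (c2' j') _; rewrite leq_exp2l// (leq_trans (leq_subr _ _))// ltnW.
    by rewrite expnS; lia.
  have ki : (0 < `|c' i| <= 2 ^ i)%N.
    rewrite absz_gt0 ci /=; apply: leq_trans (c2' i) _.
    by rewrite leq_exp2l// leq_subr.
  have W1' : W (comb a r c - comb a r' c').
    by have := W1W _ _ gf' gf; rewrite opprB addrC addrA subrK.
  have [c'i|c'i] := lerP 0 (c' i).
    apply: (aP i `|c' i|%N d ki dd).
    have := Wn _ W1'; rewrite dE opprD opprK.
    by rewrite -[X in _ *+ X]/(absz (c' i)) pmulrn gez0_abs.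
  apply: (aP i `|c' i|%N (fun j => - d j) ki) => [j'|]; first by rewrite abszN.
  move: W1'; rewrite dE pmulrn ltz0_abs// mulrNz.
  suff -> : comb a i (fun j => - d j) = - comb a i d by rewrite opprK.
  by rewrite /comb -sumrN; apply: eq_bigr => k _; rewrite mulrNz.

have : W (a m).
  apply: FW; exists m.+1, (fun j => (j == m)%:Z); split.
  - by move=> j jm; rewrite gtn_eqF.
  - by move=> j jm; rewrite ltn_eqF.
  - by move=> j; case: eqP => // ->; rewrite subnn.
  - by rewrite comb_delta.
have := aP m 1%N (fun=> 0); rewrite expn_gt0 mulr1n => /(_ isT).
rewrite /comb big1 => [|i _]; last by rewrite mulr0z.
by rewrite subr0; apply.
Qed.

End Star.

Lemma covered_coloring (G : zmodType) (P A D : set G) :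
  (forall x y, A x -> A y -> D (x - y)) -> covered P A ->
  exists N (col : G -> 'I_N),
    forall x y, P x -> P y -> col x = col y -> D (x - y).
Proof.
move=> AD [E EP].
(* The extra colour keeps the type inhabited when [E] is empty. *)
have /choice[col colP] : forall x, exists i : 'I_(size E).+1,
    P x -> (i < size E)%N /\ A (x - E`_i).
  move=> x; have [Px|] := pselect (P x); last by exists ord0.
  have [e eE Axe] := EP x Px.
  have ie : (index e E < (size E).+1)%N by rewrite ltnS ltnW// index_mem.
  by exists (Ordinal ie) => _; rewrite /= index_mem nth_index.
exists (size E).+1, col => x y /colP[_ Ax] /colP[_ Ay] E'.
have := AD _ _ Ax Ay; rewrite E' opprB addrA subrK; exact.
Qed.

(** * Reduced moduli and independent sequences *)

Section Reduced.
Variable G : topologicalZmodType.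
Implicit Types (W U : set G) (n d : nat).

(** The sum set [n G + W]. *)
Definition mulG_nbhs n W : set G := [set z | exists y, W (z - y *+ n)].

(** For no proper divisor [e] of [n] is the image of [e G] modulo the closure of [n G]
    precompact. *)
Definition reduced n := (0 < n)%N /\ forall e, (e %| n)%N -> (e < n)%N ->
  exists2 W, nbhs (0 : G) W & ~ covered (mulG e) (mulG_nbhs n W).

Let sim d n := forall W, nbhs (0 : G) W -> covered (mulG d) (mulG_nbhs n W).

Let sim_trans d n m : sim d n -> sim n m -> sim d m.
Proof.
move=> dn nm W W0; have [W' [W'0 _ _ W'W _]] := nbhs0_half W0.
have [E EP] := dn W' W'0; have [E' E'P] := nm W' W'0.
exists [seq e + e' | e <- E, e' <- E'] => x dx.
have [e eE [y Wy]] := EP x dx.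
have [|e' e'E [z Wz]] := E'P (y *+ n); first by exists y.
exists (e + e'); first by apply/allpairsP; exists (e, e').
exists z; have := W'W _ _ Wy Wz; congr W.
by rewrite addrA addrA subrK opprD addrA.
Qed.

(** Among the divisors [d] of an admissible [n] with [sim d n] the least one is reduced, by
    transitivity of [sim]. *)
Lemma exists_reduced :
  (forall U, nbhs (0 : G) U -> exists2 n, (0 < n)%N & covered (mulG n) U) ->
  forall U, nbhs (0 : G) U -> exists2 n, reduced n & covered (mulG n) U.
Proof.
move=> star U U0; have [U' [U'0 _ _ U'U _]] := nbhs0_half U0.
have [n n0 [E EP]] := star U' U'0.
have ex : exists d, `[< (d %| n)%N /\ sim d n >].
  exists n; apply/asboolP; split => // W W0; exists [:: 0] => _ [x _ <-].
  by exists 0; rewrite ?inE// subr0; exists x; rewrite subrr; exact: nbhs_singleton.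
case: (ex_minnP ex) => d /asboolP[dn sdn] dmin.
exists d; first split.
- exact: dvdn_gt0 dn.
- move=> e ed led; apply: contrapT => nW.
  have : (d <= e)%N.
    apply: dmin; apply/asboolP; split; first exact: dvdn_trans dn.
    apply: sim_trans sdn => W W0; apply: contrapT => nc; apply: nW.
    by exists W.
  by rewrite leqNgt led.
have [E' E'P] := sdn U' U'0.
exists [seq e + e' | e <- E', e' <- E] => x dx.
have [e eE [y Wy]] := E'P x dx.
have [|e' e'E Wz] := EP (y *+ n); first by exists y.
exists (e + e'); first by apply/allpairsP; exists (e, e').
have := U'U _ _ Wy Wz; congr U.
by rewrite addrA subrK opprD addrA.
Qed.

Lemma reduced_nbhs n : reduced n -> exists2 W, nbhs (0 : G) W &
  forall k, (0 < k < n)%N -> ~ covered (mulG k) (mulG_nbhs n W).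
Proof.
move=> [n0 redn].
suff [W W0 nW] : exists2 W, nbhs (0 : G) W &
    forall e, (e %| n)%N -> (e < n)%N -> ~ covered (mulG e) (mulG_nbhs n W).
  exists W => // k /andP[k0 kn] [E EP].
  (* By Bezout the multiples of [gcdn k n] lie in [k G + n G], so it suffices to treat divisors of
     [n]. *)
  apply: (nW (gcdn k n)); first exact: dvdn_gcdr.
    by apply: leq_ltn_trans kn; rewrite dvdn_leq// dvdn_gcdl.
  exists E => _ [x _ <-]; have [u v uv _] := egcdnP n k0.
  have [|e eE [y Wy]] := EP (x *+ u *+ k); first by exists (x *+ u).
  exists e => //; exists (y - x *+ v); move: Wy; congr W.
  rewrite -mulrnA uv mulrnDr mulrnBl -mulrnA opprB -!addrA addrCA; congr (_ + _).
  by rewrite addrC -!addrA; congr (_ + _); rewrite addrC.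
suff H m : exists2 W, nbhs (0 : G) W & forall e, (e < m)%N ->
    (e %| n)%N -> (e < n)%N -> ~ covered (mulG e) (mulG_nbhs n W).
  by have [W W0 nW] := H n; exists W => // e en le; exact: nW.
elim: m => [|m [W W0 nW]]; first by exists setT => //; exact: filterT.
have [W' W'0 nW'] : exists2 W', nbhs (0 : G) W' &
    (m %| n)%N -> (m < n)%N -> ~ covered (mulG m) (mulG_nbhs n W').
  have [/andP[mn lmn]|nmn] := boolP ((m %| n)%N && (m < n)%N).
    by have [W' W'0 nW'] := redn m mn lmn; exists W'.
  by exists setT; [exact: filterT|move=> mn lmn; rewrite mn lmn in nmn].
exists (W `&` W'); first exact: filterI.
move=> e; rewrite ltnS leq_eqVlt => /predU1P[->|em] en len [E EP].
  apply: nW' => //; exists E => x /EP[e' e'E [y [_ Wy]]].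
  by exists e' => //; exists y.
apply: (nW e em en len); exists E => x /EP[e' e'E [y [Wy _]]].
by exists e' => //; exists y.
Qed.

Lemma mulG_nbhsB n W V : (forall x y, W x -> W y -> V (x - y)) ->
  forall x y, mulG_nbhs n W x -> mulG_nbhs n W y -> mulG_nbhs n V (x - y).
Proof.
move=> WV x y [z Wz] [t Wt]; exists (z - t); have := WV _ _ Wz Wt; congr V.
by rewrite mulrnBl !opprD !opprK addrACA.
Qed.

(** One sequence serves all reduced [n], because the modulus needed for trivial adherence depends on
    a neighbourhood chosen after the sequence. The term [a j] is chosen against the reduced [n <= j]
    only, whence the restriction on [j] in the conclusion. *)
Lemma exists_independent : exists (w : nat -> set G) (a : nat -> G),
  (forall n, nbhs (0 : G) (w n)) /\
  forall n r c, reduced n -> (forall j, (r <= j)%N -> c j = 0) ->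
    w n (comb a r c) -> forall j, (n <= j)%N -> (n%:Z %| c j)%Z.
Proof.
have /choice[w wP] : forall n, exists W, nbhs (0 : G) W /\ (reduced n ->
    exists T V, [/\ forall x y, mulG_nbhs n W x -> mulG_nbhs n W y -> T (x - y),
      forall x y, T x -> T y -> V (x - y) &
      forall k, (0 < k < n)%N -> ~ covered (mulG k) V]).
  move=> n; have [/reduced_nbhs[W W0 nW]|] := pselect (reduced n); last first.
    by exists setT; split => //; exact: filterT.
  have [W' W'0 W'W] := nbhs0_sub W0; have [W'' W''0 W''W'] := nbhs0_sub W'0.
  exists W''; split => // _; exists (mulG_nbhs n W'), (mulG_nbhs n W); split => //.
  - exact: mulG_nbhsB.
  - exact: mulG_nbhsB.
have [s|a aP] := @exists_seq G (fun s x => forall n k (c : nat -> int),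
    reduced n -> (n <= size s)%N -> (0 < k < n)%N ->
    (forall i, (`|c i| <= size s)%N) ->
    ~ mulG_nbhs n (w n) (x *+ k - \sum_(i < size s) s`_i *~ c i)).
  have [E EP] := combos s (size s).
  pose I := [seq p <- [seq (n, k) | n <- iota 0 (size s).+1, k <- iota 1 (size s)] |
    `[< reduced p.1 >] && (p.2 < p.1)%N].
  have [[n k]|a aE] := @exists_avoid G (nat * nat)%type I snd
      (fun p => mulG_nbhs p.1 (w p.1)) _ E.
    rewrite mem_filter => /andP[/andP[/asboolP redn kn]].
    move=> /allpairsPdep[n' [k' [_ + [_ kk']]]]; rewrite mem_iota => /andP[k'0 _].
    have [T [V [wT TV nV]]] := (wP n).2 redn.
    by exists T, V; split => //; apply: nV; rewrite kn kk' k'0.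
  exists a => n k c redn ns /andP[k0 kn] cs; apply: (aE (n, k)); last exact: EP.
  rewrite mem_filter; apply/andP; split; first by rewrite kn andbT; exact/asboolP.
  apply/allpairsP; exists (n, k); split => //; rewrite mem_iota.
    by rewrite add0n ltnS.
  by rewrite k0 add1n ltnS (leq_trans _ ns)// ltnW.
have {}aP j n k c : reduced n -> (n <= j)%N -> (0 < k < n)%N ->
    (forall i, (`|c i| <= j)%N) -> ~ mulG_nbhs n (w n) (a j *+ k - comb a j c).
  by have := aP j n k c; rewrite comb_mkseq size_mkseq.
exists w, a; split; first by move=> n; exact: (wP n).1.
move=> n r c redn cr wc j nj; apply: contrapT => /negP ncj.
have n0 : (0 < n)%N by case: redn.
have nz : n%:Z != 0 by rewrite eqz_nat -lt0n.
have jr : (j < r)%N by rewrite ltnNge; apply: contra ncj => /cr ->; exact: dvdz0.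
have [i [/andP[ji ir] ci imax]] :=
  @exists_last (fun j => ~~ (n%:Z %| c j)%Z) r j jr ncj.
have ni : (n <= i)%N by exact: leq_trans ji.
(* Remainders modulo [n] are below [n <= i], so they respect the bound under which [a i] was chosen;
   the quotients disappear into [n G]. *)
pose k := `|(c i %% n%:Z)%Z|%N; pose d j := - (c j %% n%:Z)%Z.
have kE : (c i %% n%:Z)%Z = k%:Z by rewrite gez0_abs// modz_ge0.
have k0n : (0 < k < n)%N.
  rewrite -!ltz_nat -kE ltz_pmod// andbT lt_def modz_ge0// andbT.
  by apply: contra ci => /eqP/dvdz_mod0P.
apply: (aP i n k d redn ni k0n).
  move=> j'; rewrite /d abszN; apply: leq_trans ni.
  by rewrite ltnW// -ltz_nat gez0_abs ?modz_ge0// ltz_pmod.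
exists (- comb a r (fun j => (c j %/ n%:Z)%Z)); move: wc; congr (w n).
rewrite mulNrn opprK.
pose c' j := if (j <= i)%N then (c j %% n%:Z)%Z else 0.
have -> : a i *+ k - comb a i d = comb a r c'.
  rewrite (@comb_widen _ a i.+1 r c') => [|j' ij'|//]; last first.
    by rewrite /c' leqNgt ij'.
  rewrite /comb big_ord_recr /= /c' leqnn kE -pmulrn addrC -sumrN; congr (_ + _).
  by apply: eq_bigr => j' _; rewrite ltnW// /d mulrNz opprK.
rewrite /comb -sumrMnl -big_split/=; apply: eq_bigr => j' _.
rewrite pmulrn -mulrzA -mulrzDr; congr (_ *~ _); rewrite /c'.
case: leqP => ij'; first by rewrite addrC -divz_eq.
rewrite add0r; have := imax j'; rewrite ij' ltn_ord negbK => /(_ isT) nd.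
by rewrite divzK.
Qed.

End Reduced.

(** * Minimal groups are precompact *)

Section Precompact.
Variables (R : realType) (G : topologicalZmodType).
Hypothesis hG : hausdorff_space G.
Hypothesis Gmin : minimal_group G.

(* The Bohr topology of the free abelian group on [a 0, a 1, ...] *)
Let bohr (a : nat -> G) (m : nat) (Y : nat -> nat -> R) (e : R) : set G :=
  [set x | exists r c, [/\ forall j, (r <= j)%N -> c j = 0, x = comb a r c &
    forall t, (t < m)%N -> near_int e (comb (Y t) r c)]].

Let bohr_family a : set (set G) := [set F | exists m Y e, 0 < e /\ F = bohr a m Y e].

Let bohr_cvg (a : nat -> G) :
  (forall g, (forall F U, bohr_family a F -> nbhs (0 : G) U ->
     exists2 f, F f & U (g - f)) -> g = 0) ->
  forall U, nbhs (0 : G) U -> exists m Y e, 0 < e /\ bohr a m Y e `<=` U.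
Proof.
move=> H U U0.
suff [_ [m [Y [e [e0 ->]]]] FU] : exists2 F, bohr_family a F & F `<=` U.
  by exists m, Y, e.
apply: (minimal_group_cvg _ _ _ _ Gmin) => //.
- by exists (bohr a 0%N (fun=> fun=> 0) 1), 0%N, (fun=> fun=> 0), 1.
- move=> _ [m [Y [e [e0 ->]]]]; exists 0%N, (fun=> 0); split => //.
    by rewrite /comb big_ord0.
  by move=> t _; rewrite /comb big_ord0; exact: near_int0.
- move=> _ _ [m [Y [e [e0 ->]]]] [m' [Y' [e' [e'0 ->]]]].
  pose Z t := if (t < m)%N then Y t else Y' (t - m)%N.
  pose d := Num.min e e'.
  have d0 : 0 < d by rewrite lt_min e0.
  exists (bohr a (m + m') Z d); first by exists (m + m')%N, Z, d.
  move=> x [r [c [cr -> cZ]]]; split; exists r, c; split => // t tm.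
    have := cZ t (ltn_addr _ tm); rewrite /Z tm; apply: near_int_le.
    by rewrite ge_min lexx.
  have := cZ (m + t)%N; rewrite ltn_add2l => /(_ tm).
  rewrite /Z ltnNge leq_addr /= addKn; apply: near_int_le.
  by rewrite ge_min lexx orbT.
- move=> _ [m [Y [e [e0 ->]]]]; exists (bohr a m Y (e / 2)).
    by exists m, Y, (e / 2); rewrite divr_gt0.
  move=> _ _ [r [c [cr -> cY]]] [r' [c' [cr' -> cY']]].
  exists (maxn r r'), (fun j => c j - c' j); split.
  + by move=> j; rewrite geq_max => /andP[? ?]; rewrite cr ?cr' ?subr0.
  + by rewrite combB (comb_widen a cr (leq_maxl r r')) (comb_widen a cr' (leq_maxr r r')).
  + move=> t tm; rewrite combB (comb_widen _ cr (leq_maxl r r')).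
    rewrite (comb_widen _ cr' (leq_maxr r r')) [e]splitr.
    by apply: near_intB; [exact: cY|exact: cY'].
Qed.

(** If [n > 1] is reduced, convergence puts a Bohr set inside [w n]. By pigeonhole it contains some
    [a i - a j] with [n <= i < j], whose coefficient -1 is not divisible by [n]. What remains is
    trivial adherence of the Bohr topology. *)
Theorem minimal_precompact (U : set G) : nbhs (0 : G) U -> covered setT U.
Proof.
move=> U0; have star := minimal_mul_covered hG Gmin.
have [n redn [E EP]] := exists_reduced star U0.
have [n1|n1] := leqP n 1.
  exists E => x _; apply: EP; exists x => //.
  by have -> : n = 1%N by apply/eqP; rewrite eqn_leq n1; case: redn.
exfalso; have [w [a [w0 wP]]] := exists_independent G.
have [|m [Y [e [e0 FW]]]] := @bohr_cvg a _ _ (w0 n); last first.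
  have [i [j [/andP[ni ij] vij]]] := pigeonhole_torus (fun j t => Y t j) m n e0.
  pose c k : int := (k == i)%:Z - (k == j)%:Z.
  have cj k : (j.+1 <= k)%N -> c k = 0.
    by move=> jk; rewrite /c !gtn_eqF ?subr0// (ltn_trans ij).
  have : (n%:Z %| c j)%Z.
    apply: (wP n j.+1 c redn cj) => //; last by rewrite ltnW// (leq_ltn_trans ni).
    apply: FW; exists j.+1, c; split => // t tm.
    by rewrite combB !comb_delta ?(ltn_trans ij)//; exact: vij.
  by rewrite /c gtn_eqF// eqxx sub0r dvdzE /= dvdn1 => /eqP n1'; rewrite n1' in n1.
move=> g gF; apply: nbhs0_eq0 => // V V0.
have [V1 [V10 _ _ V1V _]] := nbhs0_half V0.
have [V2 [V20 _ _ V2V1 _]] := nbhs0_half V10.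
have [D [D0 _ Dz DV2 _]] := nbhs0_half V20.
have DDD x y z : D x -> D y -> D z -> V1 (x + y + z).
  move=> Dx Dy Dz'; apply: V2V1; first exact: DV2.
  by rewrite -[z]addr0; exact: DV2.
have [A [A0 _ _ _ AD]] := nbhs0_half D0.
(* From here on [n] is another reduced modulus, adapted to [A]. *)
have {n redn E EP n1} [n redn [E EP]] := exists_reduced star A0.
have n0 : (0 < n)%N by case: redn.
have nz : n%:Z != 0 by rewrite eqz_nat -lt0n.
(* Combinations of the [b j] lie in [n G] plus the span of finitely many terms, and finitely many
   translates of [A] cover that sum. *)
pose b j := if (j < n)%N then a j else a j *+ n.
pose P : set G := [set x | exists c y, x = comb a n c + y *+ n].
have PD x y : P x -> P y -> P (x + y).
  move=> [c [z ->]] [c' [z' ->]]; exists (fun j => c j + c' j), (z + z').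
  rewrite mulrnDl addrACA; congr (_ + _).
  by rewrite /comb -big_split; apply: eq_bigr => i _; rewrite mulrzDr.
have Pl (l : seq (int * nat)) : P (\sum_(p <- l) b p.2 *~ p.1).
  elim/big_rec: _ => [|[z j] x _ Px].
    exists (fun=> 0), 0; rewrite mul0rn addr0 /comb big1// => i _; exact: mulr0z.
  apply: PD => //=; rewrite /b; case: ltnP => jn.
    exists (fun k => (k == j)%:Z * z), 0.
    rewrite mul0rn addr0 /comb -(comb_delta a jn) /comb mulrz_suml.
    by apply: eq_bigr => i _; rewrite mulrzA.
  exists (fun=> 0), (a j *~ z); rewrite /comb big1 ?add0r => [|i _]; last exact: mulr0z.
  by rewrite !pmulrn -!mulrzA mulrC.
have Pcov : covered P A.
  have [E' E'P] := combos (mkseq a n) n.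
  exists [seq e + e' | e <- E', e' <- E] => _ [c [y ->]].
  have [|e' e'E Ae'] := EP ((y + comb a n (fun j => (c j %/ n%:Z)%Z)) *+ n).
    by exists (y + comb a n (fun j => (c j %/ n%:Z)%Z)).
  exists (comb a n (fun j => (c j %% n%:Z)%Z) + e').
    apply/allpairsP; exists (comb a n (fun j => (c j %% n%:Z)%Z), e'); split => //=.
    rewrite -comb_mkseq; apply: (E'P (fun j => (c j %% n%:Z)%Z)) => j.
    by rewrite ltnW// -ltz_nat gez0_abs ?modz_ge0// ltz_pmod.
  move: Ae'; congr A; rewrite opprD addrA; congr (_ - _).
  have -> : comb a n c = comb a n (fun j => (c j %% n%:Z)%Z) +
      comb a n (fun j => (c j %/ n%:Z)%Z) *+ n.
    rewrite /comb -sumrMnl -big_split/=; apply: eq_bigr => j _.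
    by rewrite pmulrn -mulrzA -mulrzDr addrC -divz_eq.
  by rewrite mulrnDl [RHS]addrC -[X in - _ + X]addrA addKr addrC.
have [N [col colD]] := covered_coloring AD Pcov.
have [y yP] := folner R colD DDD Pl.
(* Division by [n] turns characters given on the generators [b j] into characters on the [a j]. *)
pose Y t j := if insub t is Some t' then (if (j < n)%N then y t' j else y t' j / n%:R) else 0.
(* Every element of a small Bohr set close to [g] has coefficients divisible
   by [n] from index [n] on, since the characters [c_j / n] detect this. *)
have W0 : nbhs (0 : G) (V1 `&` w n) by exact: filterI.
have [W1 [W10 _ _ _ W1W]] := nbhs0_half W0.
have W10' : nbhs (0 : G) (V1 `&` W1) by exact: filterI.
have [|f [r [c [cr fE cY]]] [V1f W1f]] := gF (bohr a (N ^ 2) Y (1 / 4)) _ _ W10'.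
  by exists (N ^ 2)%N, Y, (1 / 4); rewrite divr_gt0.
have cn j : (n <= j)%N -> (n%:Z %| c j)%Z.
  move=> nj; pose dl := fun k : nat => if k == j then (n%:R)^-1 : R else 0.
  have ninv : 0 < (n%:R)^-1 :> R by rewrite invr_gt0 ltr0n.
  have [|f' [r' [c' [cr' f'E c'Y]]] [_ W1f']] :=
    gF (bohr a 1 (fun=> dl) (n%:R)^-1) _ _ W10'; first by exists 1%N, (fun=> dl), (n%:R)^-1.
  have cc' : (n%:Z %| c j - c' j)%Z.
    apply: (wP n (maxn r r') (fun j => c j - c' j)) => //.
      by move=> k; rewrite geq_max => /andP[? ?]; rewrite cr ?cr' ?subr0.
    rewrite combB (comb_widen a cr (leq_maxl r r')) (comb_widen a cr' (leq_maxr r r')).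
    rewrite -fE -f'E; have [_] := W1W _ _ W1f' W1f.
    by rewrite opprB addrC addrA subrK.
  rewrite -(subrK (c' j) (c j)); apply: rpredD => //.
  have [jr'|/cr' ->] := ltnP j r'; last exact: dvdz0.
  have := c'Y 0%N isT; rewrite /comb (bigD1 (Ordinal jr'))//= {1}/dl eqxx big1 ?addr0; last first.
    by move=> k; rewrite -val_eqE /dl /= => /negbTE ->; exact: mul0rz.
  move=> [k kc]; apply/dvdzP; exists k; apply/eqP; rewrite -subr_eq0.
  have nR : 0 < n%:R :> R by rewrite ltr0n.
  have {}kc : `|(c' j - k * n%:Z)%:~R| < 1 :> R.
    have -> : (c' j - k * n%:Z)%:~R = (n%:R^-1 *~ c' j - k%:~R) * n%:R :> R.
      by rewrite -[_^-1 *~ _]mulrzl mulrBl divfK ?lt0r_neq0// intrB intrM -pmulrn.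
    by rewrite normrM (ger0_norm (ltW nR)) -ltr_pdivlMr// mul1r.
  by move: kc; rewrite -intr_norm -[1]/(1%:~R) ltr_int -abszE ltz_nat ltnS leqn0 absz_eq0.
rewrite -(subrK f g); apply: V1V => //.
pose l := [seq (if (j < n)%N then c j else (c j %/ n%:Z)%Z, j) | j <- iota 0 r].
have lE (T : zmodType) (h : int -> nat -> T) : \sum_(p <- l) h p.1 p.2 =
    \sum_(j < r) h (if (j < n)%N then c j else (c j %/ n%:Z)%Z) j.
  by rewrite big_map /= -[r in iota 0 r]subn0 big_mkord.
have -> : f = \sum_(p <- l) b p.2 *~ p.1.
  rewrite fE (lE G (fun z j => b j *~ z)); apply: eq_bigr => j _.
  rewrite /b; case: ltnP => // nj.
  by rewrite pmulrn -mulrzA mulrC divzK ?cn.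
apply: yP => t; rewrite (lE R (fun z j => z%:~R * y t j)).
have := cY t (ltn_ord t); congr near_int.
apply: eq_bigr => j _; rewrite /Y valK.
case: ltnP => nj; first by rewrite mulrzl.
rewrite -mulrzl -[in LHS](divzK (cn j nj)) intrM -pmulrn -mulrA; congr (_ * _).
by rewrite mulrCA divff ?mulr1// pnatr_eq0 -lt0n.
Qed.

End Precompact.

(** * Characters of the torus separate points from closed subgroups *)

Section TorusSeparation.
Variable R : realType.

(** Rotating the pair of cosine and sine sums by [beta] changes it by end terms only, each at most
    2; inverting the identity minus this rotation gives the bound, with 6 = 2 * 2 + 2 * 1 in the
    numerator. *)
Lemma dirichlet_bound (beta : R) : beta \isn't a Num.int ->
  exists2 B : R, 0 < B & forall alpha Q, `|\sum_(k < Q) cos1 (alpha + beta *+ k)| <= B.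
Proof.
move=> nb; pose c := cos1 beta; pose s := sin1 beta.
have c1 : c < 1 by exact: cos1_neq1.
have den : 0 < (1 - c) ^+ 2 + s ^+ 2.
  by rewrite ltr_wpDr ?sqr_ge0// exprn_gt0// subr_gt0.
exists (6 / ((1 - c) ^+ 2 + s ^+ 2)); first by rewrite divr_gt0.
move=> alpha Q; pose f k := cos1 (alpha + beta *+ k); pose g k := sin1 (alpha + beta *+ k).
set C := \sum_(k < Q) _; pose S := \sum_(k < Q) g k.
have e1 : C * c - S * s = C + (f Q - f 0%N).
  transitivity (\sum_(k < Q) f k.+1).
    rewrite !mulr_suml -sumrB; apply: eq_bigr => k _.
    by rewrite /f mulrSr addrA [RHS]cos1D.
  have := telescope_sumr f (leq0n Q); rewrite big_mkord => <-.
  by rewrite -big_split/=; apply: eq_bigr => k _; rewrite addrC subrK.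
have e2 : S * c + C * s = S + (g Q - g 0%N).
  transitivity (\sum_(k < Q) g k.+1).
    rewrite !mulr_suml -big_split; apply: eq_bigr => k _.
    by rewrite /g mulrSr addrA [RHS]sin1D.
  have := telescope_sumr g (leq0n Q); rewrite big_mkord => <-.
  by rewrite -big_split/=; apply: eq_bigr => k _; rewrite addrC subrK.
have E : C * ((1 - c) ^+ 2 + s ^+ 2) = - (f Q - f 0%N) * (1 - c) + (g Q - g 0%N) * s.
  have -> : f Q - f 0%N = C * c - S * s - C by rewrite e1 [RHS]addrC addKr.
  have -> : g Q - g 0%N = S * c + C * s - S by rewrite e2 [RHS]addrC addKr.
  by ring.
rewrite ler_pdivlMr// -(ger0_norm (ltW den)) -normrM E ler_norml.
have := cos1_le1 (alpha + beta *+ Q); have := cos1_geN1 (alpha + beta *+ Q).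
have := cos1_le1 (alpha + beta *+ 0); have := cos1_geN1 (alpha + beta *+ 0).
have := cos1_geN1 beta; have sle (x : R) : -1 <= sin1 x <= 1.
  by rewrite sin_geN1 sin_le1.
move: (sle beta) (sle (alpha + beta *+ Q)) (sle (alpha + beta *+ 0)).
rewrite -/(f Q) -/(f 0%N) -/(g Q) -/(g 0%N) -/c -/s.
move=> /andP[? ?] /andP[? ?] /andP[? ?] ? ? ? ? ?.
have H1 : `|(f Q - f 0%N) * (1 - c)| <= 2 * 2.
  by rewrite normrM ler_pM// ler_norml; apply/andP; split; lra.
have H2 : `|(g Q - g 0%N) * s| <= 2 * 1.
  by rewrite normrM ler_pM// ler_norml; apply/andP; split; lra.
move: H1 H2; rewrite !ler_norml => /andP[? ?] /andP[? ?]; apply/andP; split; lra.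
Qed.

(** Bernoulli's inequality raised to the power [m.+1] outgrows a polynomial of degree [m]. *)
Lemma exp_beats_poly (m : nat) (rho : R) : 0 <= rho < 1 ->
  exists L : nat, rho ^+ L * (2 * (m * L).+1%:R ^+ m) < 1.
Proof.
move=> /andP[]; rewrite le_eqVlt => /predU1P[<- _|r0 r1].
  by exists 1%N; rewrite expr1 mul0r.
pose x := rho^-1 - 1; have x0 : 0 < x by rewrite subr_gt0 invf_gt1.
pose A : R := ((m * m.+1).+1)%:R; pose y := 2 * A ^+ m / x ^+ m.+1.
have A0 : 0 < A by rewrite ltr0n.
pose k := (Num.truncn y).+1; exists (m.+1 * k)%N.
have yk : y < k%:R by exact: truncnS_gt.
have k0 : 0 < k%:R :> R by rewrite ltr0n.
have bern n : 1 + x *+ n <= (1 + x) ^+ n.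
  elim: n => [|n IH]; first by rewrite mulr0n addr0 expr0.
  rewrite exprS mulrS; apply: le_trans (ler_wpM2l _ IH); last by rewrite addr_ge0// ltW.
  have : 0 <= x * (x *+ n) by rewrite mulr_ge0 ?mulrn_wge0// ltW.
  by move: (x *+ n) => z xz; nra.
have H1 : (x * k%:R) ^+ m.+1 < (1 + x) ^+ (m.+1 * k).
  have h : x * k%:R < (1 + x) ^+ k.
    by rewrite mulr_natr; apply: lt_le_trans (bern k); rewrite ltrDr.
  rewrite mulnC exprM ltr_pXn2r// nnegrE; first by rewrite mulr_ge0// ltW.
  by rewrite exprn_ge0// addr_ge0// ltW.
have H2 : (m * (m.+1 * k)).+1%:R ^+ m <= (A * k%:R) ^+ m.
  apply: lerXn2r; rewrite ?nnegrE ?mulr_ge0//.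
  by rewrite /A -natrM ler_nat /k mulnA; move: (m * m.+1)%N (Num.truncn y) => M z; nia.
have xE : 1 + x = rho^-1 by rewrite /x addrC subrK.
rewrite mulrC -ltr_pdivlMr ?exprn_gt0// div1r -exprVn -xE.
apply: le_lt_trans H1.
have : 2 * A ^+ m <= x ^+ m.+1 * k%:R.
  by move: (ltW yk); rewrite /y ler_pdivrMr ?exprn_gt0// [leRHS]mulrC.
move=> H3; apply: (@le_trans _ _ (2 * (A * k%:R) ^+ m)); first by rewrite ler_pM2l.
rewrite !exprMn mulrA (exprSr k%:R) [k%:R ^+ m * _]mulrC mulrA.
by rewrite ler_pM2r ?exprn_gt0.
Qed.

Variable m : nat.
Implicit Types (u v s : 'I_m -> R) (n : 'I_m -> int).

Definition dotp n u : R := \sum_i u i *~ n i.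

Lemma dotpD n u v : dotp n (fun i => u i + v i) = dotp n u + dotp n v.
Proof. by rewrite /dotp -big_split; apply: eq_bigr => i _; rewrite mulrzDl. Qed.

Lemma dotpMn n u k : dotp n (fun i => u i *+ k) = dotp n u *+ k.
Proof.
rewrite /dotp -sumrMnl; apply: eq_bigr => i _.
by rewrite !pmulrn -!mulrzA mulrC.
Qed.

Lemma dotpDl n n' u : dotp (fun i => n i + n' i) u = dotp n u + dotp n' u.
Proof. by rewrite /dotp -big_split; apply: eq_bigr => i _; rewrite mulrzDr. Qed.

Lemma dotpBl n n' u : dotp (fun i => n i - n' i) u = dotp n u - dotp n' u.
Proof. by rewrite /dotp -sumrB; apply: eq_bigr => i _; rewrite mulrzBr. Qed.

Section TrigPoly.

Definition teval (T : seq (R * ('I_m -> int))) u := \sum_(q <- T) q.1 * cos1 (dotp q.2 u).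

Let wf K (q : R * ('I_m -> int)) := 0 <= q.1 /\ forall i, (`|q.2 i| <= K)%N.

(** Nonnegative coefficients and frequencies at most [K]; the class is closed under products since a
    product of cosines is a mean of two cosines. *)
Definition trigpoly K (f : ('I_m -> R) -> R) := exists T,
  (forall j, (j < size T)%N -> wf K (nth (0, fun=> 0) T j)) /\ f = teval T.

Let trigpolyE K T : (forall j, (j < size T)%N -> wf K (nth (0, fun=> 0) T j)) <->
  List.Forall (wf K) T.
Proof.
split=> [|H].
  elim: T => [//|q T IH] H; constructor; first exact: (H 0%N).
  by apply: IH => j jT; exact: (H j.+1).
by elim: H => [//|q T' wq _ IH] [//|j] jT; exact: IH.
Qed.

Let trigpolyM1 K K' q T : wf K q -> List.Forall (wf K') T ->
  exists2 T', List.Forall (wf (K + K')) T' &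
    forall u, q.1 * cos1 (dotp q.2 u) * teval T u = teval T' u.
Proof.
move=> [q0 qK]; elim: T => [|q' T IH] TK'.
  by exists [::] => // u; rewrite /teval !big_nil mulr0.
have := TK'; inversion 1 as [|? ? [q'0 q'K'] TK'']; subst.
have [T' T'K E] := IH TK''.
exists [:: (q.1 * q'.1 / 2, fun i => q.2 i + q'.2 i),
  (q.1 * q'.1 / 2, fun i => q.2 i - q'.2 i) & T'].
  constructor; first by split => [|i /=]; [rewrite divr_ge0 ?mulr_ge0|have := qK i; have := q'K' i; lia].
  constructor => //; by split => [|i /=]; [rewrite divr_ge0 ?mulr_ge0|have := qK i; have := q'K' i; lia].
move=> u; rewrite /teval !big_cons /= -/(teval T u) -/(teval T' u) mulrDr E addrA.
congr (_ + _); rewrite dotpDl dotpBl.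
have -> : q.1 * cos1 (dotp q.2 u) * (q'.1 * cos1 (dotp q'.2 u)) =
  q.1 * q'.1 * (cos1 (dotp q.2 u) * cos1 (dotp q'.2 u)) by ring.
by rewrite cos1M; field.
Qed.

Lemma trigpolyM K K' f g : trigpoly K f -> trigpoly K' g ->
  trigpoly (K + K') (fun u => f u * g u).
Proof.
move=> [T [/trigpolyE TK ->]] [T' [/trigpolyE T'K ->]].
suff [T'' T''K E] : exists2 T'', List.Forall (wf (K + K')) T'' &
    forall u, teval T u * teval T' u = teval T'' u.
  by exists T''; split; [exact/trigpolyE|apply/funext].
elim: TK => [|q {}T qK _ [T1 T1K E1]]; first by exists [::] => // u; rewrite /teval !big_nil mul0r.
have [T2 T2K E2] := trigpolyM1 qK T'K.
exists (T2 ++ T1); first by apply/List.Forall_app.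
by move=> u; rewrite {1}/teval big_cons mulrDl E2 -/(teval T u) E1 /teval big_cat.
Qed.

Lemma trigpoly1 K : trigpoly K (fun=> 1).
Proof.
exists [:: (1, fun=> 0)]; split.
  by case=> // _; split => //=; rewrite ler01.
apply/funext => u; rewrite /teval big_seq1 /= /dotp big1 ?cos1_0 ?mulr1//.
Qed.

(** This kernel is nonnegative, equals 1 at 0 and decays exponentially in [L] away from the integer
    points, while its degree grows only linearly. *)
Lemma trigpoly_kernel L : trigpoly (m * L)
  (fun u => (\prod_i ((1 + cos1 (u i)) / 2)) ^+ L).
Proof.
suff tp1 : trigpoly m (fun u => \prod_i ((1 + cos1 (u i)) / 2)).
  elim: L => [|L IH]; first by under eq_fun do rewrite expr0; exact: trigpoly1.
  under eq_fun do rewrite exprS; rewrite mulnS; exact: trigpolyM.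
have H (r : seq 'I_m) : trigpoly (size r) (fun u => \prod_(i <- r) ((1 + cos1 (u i)) / 2)).
  elim: r => [|i r IH]; first by under eq_fun do rewrite big_nil; exact: trigpoly1.
  under eq_fun do rewrite big_cons; apply: (@trigpolyM 1%N) => //.
  exists [:: (1 / 2, fun=> 0); (1 / 2, fun j => (j == i)%:Z)]; split.
    by case=> [|[|//]] _ /=; split => //=; [rewrite divr_ge0|rewrite divr_ge0|move=> j; case: eqP].
  apply/funext => u; rewrite /teval !big_cons big_nil /=.
  rewrite {1}/dotp big1 ?cos1_0; last by move=> j _; exact: mulr0z.
  rewrite /dotp (bigD1 i)//= eqxx mulr1z big1 ?addr0; last first.
    by move=> j /negbTE ->; exact: mulr0z.
  by field.
have := H (enum 'I_m); rewrite size_enum_ord; by under eq_fun do rewrite big_enum.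
Qed.

(* Averaging over a grid of mesh [1 / K.+1] isolates the zero frequency. *)
Lemma trigpoly_mass0 K T (P : ('I_m -> int) -> Prop) : P (fun=> 0) ->
  (forall j, (j < size T)%N -> wf K (nth (0, fun=> 0) T j)) ->
  (forall u, 0 <= teval T u) -> teval T (fun=> 0) = 1 ->
  1 <= K.+1%:R ^+ m * \sum_(q <- T | `[< P q.2 >]) q.1.
Proof.
move=> P0 TK T0 T1; pose Gam := {ffun 'I_m -> 'I_K.+1}.
pose pt (th : Gam) : 'I_m -> R := fun i => (th i)%:R / K.+1%:R.
have ptE th n : dotp n (pt th) = pairing R th n.
  rewrite /dotp /pairing raddf_sum mulr_suml; apply: eq_bigr => i _ /=.
  by rewrite -mulrzl /pt intrM -pmulrn mulrA [_%:~R * _]mulrC.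
apply: (@le_trans _ _ (\sum_th teval T (pt th))).
  rewrite (bigD1 [ffun=> ord0])//= -[leLHS]addr0 lerD ?sumr_ge0//.
  rewrite (_ : pt _ = fun=> 0) ?T1//; apply/funext => i.
  by rewrite /pt ffunE mul0r.
have -> : K.+1%:R ^+ m = #|{: Gam}|%:R :> R by rewrite card_ffun !card_ord natrX.
rewrite /teval exchange_big/=.
move/trigpolyE: TK => {T0 T1}; elim=> [|q T' [q0 qK] _ IH]; first by rewrite !big_nil mulr0.
rewrite !big_cons; case: asboolP => [_|nP].
  rewrite mulrDr lerD// -mulr_sumr mulrC ler_wpM2r//.
  apply: (@le_trans _ _ (\sum_(th : Gam) 1)); last by rewrite sumr_const.
  by apply: ler_sum => th _; exact: cos1_le1.
rewrite -mulr_sumr (eq_bigr (fun th => cos1 (pairing R th q.2))) => [|th _]; last by rewrite ptE.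
rewrite sum_cos1_pairing ?mulr0 ?add0r// => dv; apply: nP.
rewrite (_ : q.2 = fun=> 0)//; apply/funext => i.
have := dv i; have := qK i => qi /dvdzP[k qE].
have [k0|k0] := eqVneq k 0; first by rewrite qE k0 mul0r.
by move: qi k0; rewrite qE => qi k0; exfalso; nia.
Qed.

End TrigPoly.

Variable S : set ('I_m -> R).
Hypothesis S0 : S (fun=> 0).
Hypothesis SD : forall s s', S s -> S s' -> S (fun i => s i + s' i).

Let ann n := forall s, S s -> dotp n s \is a Num.int.

(** One frequency at a time: averaging along a long progression of multiples of some [s] in [S] with
    [dotp n s] not integral makes the mean for [n] small. The arbitrary shift [x] preserves the
    bounds already obtained. *)
Let averaging (T : seq ('I_m -> int)) (eta : R) : 0 < eta ->
  exists (I : finType) (sg : I -> 'I_m -> R), [/\ (0 < #|I|)%N, forall i, S (sg i) &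
    List.Forall (fun n => ~ ann n ->
      forall x : R, `|\sum_i cos1 (dotp n (sg i) + x)| <= eta * #|I|%:R) T].
Proof.
move=> eta0; elim: T => [|n T [I [sg [I0 Ssg sgT]]]].
  by exists unit, (fun _ _ => 0); split; rewrite ?card_unit.
have [an|nan] := pselect (ann n).
  by exists I, sg; split => //; constructor.
have [s [Ss ns]] : exists s, S s /\ dotp n s \isn't a Num.int.
  apply: contrapT => H; apply: nan => s Ss.
  by apply: contrapT => /negP ns; apply: H; exists s.
have [B B0 BP] := dirichlet_bound ns.
pose Q := (Num.truncn (B / eta)).+1.
have QB : B <= eta * Q%:R.
  by rewrite mulrC -ler_pdivrMr// ltW// truncnS_gt.
have Ss' k : S (fun i => s i *+ k).
  elim: k => [|k IH]; first by under eq_fun do rewrite mulr0n.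
  by under eq_fun do rewrite mulrS; exact: SD.
exists (I * 'I_Q)%type, (fun (p : I * 'I_Q) i => sg p.1 i + s i *+ p.2); split.
- by rewrite card_prod card_ord muln_gt0 I0.
- by move=> [i k] /=; exact: SD.
have E n' x : \sum_(p : I * 'I_Q) cos1 (dotp n' (fun i => sg p.1 i + s i *+ p.2) + x) =
    \sum_i \sum_(k < Q) cos1 (dotp n' (sg i) + dotp n' s *+ k + x).
  rewrite pair_big; apply: eq_bigr => -[i k] _ /=.
  by rewrite dotpD dotpMn.
have cE : #|{: I * 'I_Q}|%:R = #|I|%:R * Q%:R :> R.
  by rewrite card_prod card_ord natrM.
constructor.
  move=> _ x; rewrite E cE; apply: le_trans (ler_norm_sum _ _ _) _.
  apply: (@le_trans _ _ (\sum_(i : I) (eta * Q%:R))); last first.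
    by rewrite sumr_const -[leLHS]mulr_natr mulrAC mulrA.
  apply: ler_sum => i _; apply: le_trans QB.
  under eq_bigr do rewrite addrAC; exact: BP.
apply: List.Forall_impl sgT => n' H nn' x; rewrite E cE exchange_big/=.
apply: le_trans (ler_norm_sum _ _ _) _.
apply: (@le_trans _ _ (\sum_(k < Q) (eta * #|I|%:R))); last first.
  by rewrite sumr_const card_ord -[leLHS]mulr_natr mulrA.
by apply: ler_sum => k _; under eq_bigr do rewrite -addrA; exact: H.
Qed.

(** Otherwise every frequency integral on [S] is integral at [t], so the mean of the kernel at
    [s - t] over suitable [s] in [S] is at least the mass of these frequencies minus a small error,
    hence at least [1 / (2 * D)] with [D] polynomial in [L]. But each value is at most [rho ^+ L],
    as some coordinate of [s - t] is far from the integers. *)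
Theorem torus_separation (t : 'I_m -> R) (delta : R) : 0 < delta ->
  (forall s, S s -> exists i, ~ near_int delta (s i - t i)) ->
  exists n, (forall s, S s -> dotp n s \is a Num.int) /\ dotp n t \isn't a Num.int.
Proof.
move=> d0' tS'; apply: contrapT => nn.
have annt n : ann n -> dotp n t \is a Num.int.
  by move=> an; apply: contrapT => /negP nt; apply: nn; exists n.
pose delta' := Num.min delta (1 / 2).
have d0 : 0 < delta' by rewrite lt_min d0' divr_gt0.
have d2 : delta' <= 1 / 2 by rewrite ge_min lexx orbT.
have tS s : S s -> exists i, ~ near_int delta' (s i - t i).
  move=> /tS'[i ni]; exists i => /near_int_le H; apply: ni; apply: H.
  by rewrite ge_min lexx.
pose rho := (1 + cos1 delta') / 2.
have rho01 : 0 <= rho < 1.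
  have := cos1_geN1 delta'; have := cos1_lt1 d0 d2; rewrite /rho => ? ?.
  by apply/andP; split; lra.
have [L LP] := exp_beats_poly m rho01.
pose f u := (\prod_i ((1 + cos1 (u i)) / 2)) ^+ L.
have fac01 u i : 0 <= (1 + cos1 (u i)) / 2 <= 1.
  by have := cos1_geN1 (u i); have := cos1_le1 (u i) => ? ?; apply/andP; split; lra.
have f0 u : 0 <= f u.
  by rewrite exprn_ge0// prodr_ge0// => i _; case/andP: (fac01 u i).
have f1 : f (fun=> 0) = 1.
  by rewrite /f big1 ?expr1n// => i _; rewrite cos1_0; field.
have [T [TK fT]] := trigpoly_kernel L.
rewrite -/f in fT.
have Tsum : \sum_(q <- T) q.1 = 1.
  rewrite -f1 fT /teval; apply: eq_bigr => q _; rewrite /dotp big1 ?cos1_0 ?mulr1// => i _.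
  exact: mul0rz.
have a0 : ann (fun=> 0).
  by move=> s _; rewrite /dotp big1 ?rpred0// => i _; exact: mulr0z.
have mass : 1 <= (m * L).+1%:R ^+ m * \sum_(q <- T | `[< ann q.2 >]) q.1.
  by apply: (@trigpoly_mass0 (m * L)) => //; [move=> u|]; rewrite -fT.
set M0 := \sum_(q <- T | _) q.1 in mass.
pose D : R := (m * L).+1%:R ^+ m; have D0 : 0 < D by rewrite exprn_gt0.
have eta0 : 0 < (2 * D)^-1 by rewrite invr_gt0 mulr_gt0.
have [I [sg [I0 Ssg sgT]]] := averaging [seq q.2 | q <- T] eta0.
have I0R : 0 < #|I|%:R :> R by rewrite ltr0n.
have up : \sum_i f (fun j => sg i j - t j) <= #|I|%:R * rho ^+ L.
  apply: (@le_trans _ _ (\sum_(i : I) rho ^+ L)); last by rewrite sumr_const mulr_natl.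
  apply: ler_sum => i _; have [j nj] := tS _ (Ssg i).
  rewrite lerXn2r ?nnegrE ?prodr_ge0//; first by move=> k _; case/andP: (fac01 (fun j => sg i j - t j) k).
    by case/andP: rho01.
  rewrite (bigD1 j)//= -[leRHS]mulr1 ler_pM//.
  + by case/andP: (fac01 (fun j => sg i j - t j) j).
  + by rewrite prodr_ge0// => k _; case/andP: (fac01 (fun j => sg i j - t j) k).
  + by have := cos1_le (ltW d0) nj; rewrite /rho; lra.
  + apply: prodr_ile1 => k _; exact: (fac01 (fun j => sg i j - t j) k).
have low : (M0 - (2 * D)^-1) * #|I|%:R <= \sum_i f (fun j => sg i j - t j).
  have -> : \sum_i f (fun j => sg i j - t j) =
      \sum_(q <- T) q.1 * \sum_i cos1 (dotp q.2 (sg i) - dotp q.2 t).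
    rewrite fT /teval exchange_big/=; apply: eq_bigr => q _; rewrite mulr_sumr.
    apply: eq_bigr => i _; congr (_ * cos1 _).
    by rewrite /dotp -sumrB; apply: eq_bigr => j _; rewrite mulrzBl.
  have -> : M0 - (2 * D)^-1 =
      \sum_(q <- T) ((if `[< ann q.2 >] then q.1 else 0) - (2 * D)^-1 * q.1).
    by rewrite sumrB -mulr_sumr Tsum mulr1 -big_mkcond.
  rewrite mulr_suml.
  have {}TK : List.Forall (fun q : R * ('I_m -> int) => 0 <= q.1) T.
    move: TK; clear; elim: T => [//|q T IH] H; constructor; first by have [] := H 0%N.
    by apply: IH => j jT; exact: (H j.+1).
  elim: T TK sgT {fT Tsum mass M0 a0} => [|q T IH] TK sgT; first by rewrite !big_nil.
  inversion TK as [|? ? q0 TK']; inversion sgT as [|? ? sgq sgT']; subst.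
  rewrite !big_cons lerD//; last exact: IH.
  case: asboolP => [aq|naq].
    rewrite (eq_bigr (fun=> 1)) ?sumr_const; last first.
      move=> i _; have /intrP[k ->] := aq _ (Ssg i); have /intrP[l ->] := annt _ aq.
      by rewrite -intrB; have [] := cossin1_int R (k - l).
    by rewrite ler_wpM2r ?(ltW I0R)// gerBl mulr_ge0// ltW.
  rewrite sub0r -mulNr mulrAC mulrC ler_wpM2l// mulNr.
  have := sgq naq (- dotp q.2 t); rewrite ler_norml => /andP[+ _].
  exact.
have := le_trans low up; rewrite mulrC ler_pM2l//.
have H1 : D^-1 <= M0 by rewrite -div1r ler_pdivrMr// mulrC.
have H2 : rho ^+ L < (2 * D)^-1.
  by rewrite -[ltRHS]mul1r ltr_pdivlMr// mulr_gt0.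
have H3 : (2 * D)^-1 * 2 = D^-1 by field; rewrite gt_eqF.
by move: H1 H2 H3; set Di := D^-1; set D2 := (2 * D)^-1; lra.
Qed.

End TorusSeparation.

(** * Continuous characters of a precompact group *)

Section Characters.
Variables (R : realType) (G : topologicalZmodType).

(* Characters [G -> R/Z] are represented by real valued lifts. *)
Definition torus_char (f : G -> R) :=
  (forall x y, f (x + y) - f x - f y \is a Num.int) /\
  (forall e, 0 < e -> nbhs (0 : G) [set x | near_int e (f x)]).

(** Foelner's theorem with all elements of [G] as generators gives characters of the free group on
    [G] only. The limits [S] of their values along formal sums with [pi l] tending to 0 measure the
    failure to descend; an integer combination that is integral on [S] is a continuous character of
    [G]. *)
Lemma precompact_chars_separate : hausdorff_space G ->
  (forall U, nbhs (0 : G) U -> covered setT U) ->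
  forall x : G, x != 0 -> exists2 f, torus_char f & f x \isn't a Num.int.
Proof.
move=> hG pc x x0.
have [U U0 Ux] : exists2 U, nbhs (0 : G) U & ~ U x.
  apply: contrapT => H; move/eqP: x0; apply; apply: (nbhs0_eq0 hG) => U U0.
  by apply: contrapT => nUx; apply: H; exists U.
have [V [V0 _ _ _ VU]] := nbhs0_half U0.
have [V1 [V10 _ _ V1V _]] := nbhs0_half V0.
have [D [D0 _ Dz DV1 _]] := nbhs0_half V10.
have DDD y z t : D y -> D z -> D t -> V (y + z + t).
  move=> Dy Dz' Dt; apply: V1V; first exact: DV1.
  by rewrite -[t]addr0; exact: DV1.
have [A [A0 _ _ _ AD]] := nbhs0_half D0.
have [N [col colD]] := covered_coloring AD (pc _ A0).
have [c cV] := @folner R G N setT D V col colD DDD G id (fun=> Logic.I).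
pose m := (N ^ 2)%N; pose pi (l : seq (int * G)) : G := \sum_(p <- l) p.2 *~ p.1.
pose vec (l : seq (int * G)) (t : 'I_m) : R := \sum_(p <- l) p.1%:~R * c t p.2.
have {}cV l : (forall t, near_int (1 / 4) (vec l t)) -> V (pi l) by exact: cV.
pose S : set ('I_m -> R) := [set s | forall W e, nbhs (0 : G) W -> 0 < e ->
  exists l, W (pi l) /\ forall t, near_int e (s t - vec l t)].
have S0 : S (fun=> 0).
  move=> W e W0 e0; exists [::]; split; first by rewrite /pi big_nil; exact: nbhs_singleton.
  by move=> t; rewrite /vec big_nil subrr; exact: near_int0.
have SD s s' : S s -> S s' -> S (fun i => s i + s' i).
  move=> Ss Ss' W e W0 e0; have [W' [W'0 _ _ W'W _]] := nbhs0_half W0.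
  have e20 : 0 < e / 2 by rewrite divr_gt0.
  have [l [Wl sl]] := Ss _ _ W'0 e20; have [l' [Wl' sl']] := Ss' _ _ W'0 e20.
  exists (l ++ l'); split; first by rewrite /pi big_cat; exact: W'W.
  move=> t; rewrite /vec big_cat /= opprD addrACA [e]splitr.
  by apply: near_intD; [exact: sl|exact: sl'].
(* Half of the 1/4 in Foelner's theorem; the other half pays for approximating a point of [S] by a
   formal sum. *)
have d0 : 0 < 1 / 8 :> R by rewrite divr_gt0.
have [s Ss|n [nS nx]] := torus_separation S0 SD (t := fun t => c t x) d0.
  apply: contrapT => H.
  have {}H i : near_int (1 / 8) (s i - c i x).
    by apply: contrapT => ni; apply: H; exists i.
  have [l [Vl sl]] := Ss V (1 / 8) V0 d0.
  have : V (pi ((-1, x) :: l)).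
    apply: cV => t; rewrite /vec big_cons /= -/(vec l t) mulN1r.
    have := near_intB (H t) (sl t); rewrite (_ : 1 / 8 + 1 / 8 = 1 / 4 :> R); last by lra.
    by congr near_int; rewrite opprB addrC addrA subrK addrC.
  rewrite /pi big_cons /= -/(pi l) mulrN1z => Vlx; apply: Ux.
  by have := VU _ _ Vl Vlx; rewrite opprD opprK addrCA subrr addr0.
exists (fun g => dotp n (fun t => c t g)) => //; split.
  move=> y z; pose l : seq (int * G) := [:: (1, y + z); (-1, y); (-1, z)].
  have : dotp n (vec l) \is a Num.int.
    apply: nS => W e W0 e0; exists l; split.
      rewrite /pi /l !big_cons big_nil /= addr0 mulr1z !mulrN1z -opprD subrr.
      exact: nbhs_singleton.
    by move=> t; rewrite subrr; exact: near_int0.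
  congr (_ \is a Num.int); rewrite /dotp -!sumrB; apply: eq_bigr => t _.
  rewrite -!mulrzBl; congr (_ *~ _).
  by rewrite /vec /l !big_cons big_nil /= mul1r !mulN1r addr0 addrA.
(* Discontinuity gives an ultrafilter tending to 0 along which the values avoid the integers; the
   limit of the vectors [cf] lies in [S], where [n] is integral. *)
move=> e e0; apply: contrapT => ne.
pose f g := dotp n (fun t => c t g); pose B : set G := [set g | ~ near_int e (f g)].
have PF : ProperFilter (within B (nbhs (0 : G))).
  apply: Build_ProperFilter_ex => A' /= A'0; apply: contrapT => nA'.
  apply: ne; apply: (@filterS _ (nbhs (0 : G)) _ _ _ _ A'0) => g gA'; apply: contrapT => nfg.
  by apply: nA'; exists g; exact: gA'.
have [F [FU FB]] := ultraFilterLemma PF.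
pose cf t g := c t g - (Num.floor (c t g))%:~R.
have /choice[s sP] : forall t, exists z : R, cf t @ F --> z.
  move=> t; apply: ultra_lim => g; rewrite subr_ge0 floor_le /= ltW//.
  by have := floorD1_gt (c t g); rewrite intrD -ltrBlDl.
have Ss : S s.
  move=> W d W0 d00.
  have FW : F W by apply: FB; apply: (@filterS _ (nbhs (0 : G)) _ _ _ _ W0) => g Wg _.
  have Fs : F (\bigcap_t [set g | `|s t - cf t g| < d]).
    have H t : F [set g | `|s t - cf t g| < d] by have /cvgrPdist_lt/(_ d d00) := sP t.
    by apply: filterS (filter_forall _ H) => g Hg t _; exact: Hg.
  have [g [Wg gs]] := filter_ex (filterI FW Fs).
  exists [:: (1, g)]; split; first by rewrite /pi big_seq1.
  move=> t; rewrite /vec big_seq1 /= mul1r; exists (- Num.floor (c t g)).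
  by have := gs t Logic.I; rewrite /= /cf opprB intrN opprK addrA addrAC.
have lim : (fun g => dotp n (cf^~ g)) @ F --> dotp n s.
  apply: cvg_big => [|t _]; first exact: add_continuous.
  under eq_fun do rewrite -mulrzl.
  by rewrite -mulrzl; apply: cvgMr; exact: sP.
have /cvgrPdist_lt/(_ e e0) Fe := lim.
have FB' : F B by apply: FB; apply: (@filterE _ (nbhs (0 : G))) => g.
have [g [Bg ge]] := filter_ex (filterI FB' Fe); apply: Bg.
apply: (@near_int_eqmod _ _ (dotp n (cf^~ g))); last first.
  have /intrP[k ks] := nS s Ss; exists k; rewrite -ks distrC.
  exact: ge.
rewrite /f /dotp -sumrB; apply: rpred_sum => t _.
rewrite -mulrzBl /cf addrAC subrr sub0r mulNrz rpredN -mulrzl.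
by rewrite rpredM ?intr_int.
Qed.

End Characters.

(** * Small subgroups of compact totally disconnected groups *)

Section VanDantzig.
Variables (G : topologicalZmodType) (K : set G).
Hypothesis hG : hausdorff_space G.
Hypothesis Gdisc : totally_disconnected [set: G].
Hypothesis K0 : K 0.
Hypothesis KB : forall x y, K x -> K y -> K (x - y).
Hypothesis Kcpt : compact K.
Implicit Types (U V W O B : set G).

Lemma compact_net (A : set G -> set G) :
  (forall V, nbhs (0 : G) V -> exists2 x, A V x & K x) ->
  (forall V V', V `<=` V' -> A V `<=` A V') ->
  exists2 p, K p & forall V W, nbhs (0 : G) V -> nbhs (0 : G) W ->
    exists x, [/\ A V x, K x & W (x - p)].
Proof.
move=> An0 Amono; pose F := filter_from (nbhs (0 : G)) (fun V => A V `&` K).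
have PF : ProperFilter F.
  apply: filter_from_proper; last by move=> V /An0[x Ax Kx]; exists x.
  apply: filter_from_filter; first by exists setT; exact: filterT.
  move=> V V' V0 V'0; exists (V `&` V'); first exact: filterI.
  by move=> x [Ax Kx]; split; split => //; apply: Amono Ax => y [].
have FK : F K by exists setT; [exact: filterT|move=> x []].
have [p [Kp clp]] := Kcpt PF FK; exists p => // V W V0 W0.
have FA : F (A V `&` K) by exists V.
have Wp : nbhs p [set x | W (x - p)].
  apply/nbhs0_shift; apply: filterS W0 => w Ww /=; by rewrite addrC addKr.
by have [x [[Ax Kx] Wx]] := clp _ _ FA Wp; exists x.
Qed.

Let Knp x : K x -> K (- x).
Proof. by move=> Kx; rewrite -sub0r; exact: KB. Qed.
Let KD x y : K x -> K y -> K (x + y).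
Proof. by move=> Kx Ky; rewrite -[y]opprK; apply: KB => //; exact: Knp. Qed.

(** The subgroup generated by the intersection of [K] and [V]. *)
Definition gen V : set G := [set x | exists2 s : seq G,
  forall y, y \in s -> K y /\ (V y \/ V (- y)) & x = \sum_(y <- s) y].

Let gen_sub V V' : V `<=` V' -> gen V `<=` gen V'.
Proof.
move=> VV' x [s sP ->]; exists s => // y /sP[Ky Vy]; split => //.
by case: Vy => /VV'; [left|right].
Qed.

Let genK V : gen V `<=` K.
Proof.
move=> x [s sP ->]; rewrite big_seq; elim/big_rec: _ => // y z /sP[Ky _] Kz.
exact: KD.
Qed.

Let gen1 V x : K x -> V x -> gen V x.
Proof.
move=> Kx Vx; exists [:: x]; last by rewrite big_seq1.
by move=> y; rewrite inE => /eqP ->; split => //; left.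
Qed.

Lemma genB V x y : gen V x -> gen V y -> gen V (x - y).
Proof.
move=> [s sP ->] [s' s'P ->]; exists (s ++ [seq - z | z <- s']).
  move=> z; rewrite mem_cat => /orP[/sP//|/mapP[t /s'P[Kt Vt] ->]].
  by split; [exact: Knp|rewrite opprK; case: Vt; [right|left]].
by rewrite big_cat big_map sumrN.
Qed.

Let gen0 V : gen V 0.
Proof. by exists [::] => //; rewrite big_nil. Qed.

Let C : set G := [set x | forall V, nbhs (0 : G) V -> gen V x].

Let gen_near V x p : gen V x -> K p -> V (x - p) -> gen V p.
Proof.
move=> gx Kp Vxp; rewrite -(subKr x p); apply: genB => //; apply: gen1 => //.
by apply: KB => //; exact: genK gx.
Qed.

(** By compactness, points of every [gen V] outside [O] would cluster at a point of [C]. *)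
Let gen_in O : (forall p, C p -> nbhs p O) ->
  exists2 V, nbhs (0 : G) V & gen V `<=` O.
Proof.
move=> CO; apply: contrapT => nV.
have [V V0|V V' VV'|p Kp pP] := @compact_net (fun V => gen V `\` O).
- apply: contrapT => H; apply: nV; exists V => // x gx; apply: contrapT => nO.
  by apply: H; exists x => //; exact: genK gx.
- by move=> x [gx nO]; split => //; exact: gen_sub gx.
have Cp : C p.
  by move=> V V0; have [x [[gx _] _ Vx]] := pP V V V0 V0; exact: gen_near Vx.
have /nbhs0_shift O0 := CO p Cp.
have [x [[_ nO] _ /=]] := pP setT _ filterT O0.
by rewrite addrC subrK.
Qed.

(** Points of [C] are joined to 0 by chains of small steps that stay near [C]; steps shorter than
    the gap between the two closed pieces never pass from [B] to [B']. *)
Let C_part B B' : closed B -> closed B' -> B `<=` C -> B' `<=` C ->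
  C `<=` B `|` B' -> B `&` B' = set0 -> B 0 -> B' = set0.
Proof.
move=> cB cB' BC B'C CBB' BB' B0.
have [W W0 WP] : exists2 W, nbhs (0 : G) W & forall b b', B b -> B' b' -> ~ W (b - b').
  apply: contrapT => nW.
  have CK x : C x -> K x by move=> /(_ setT filterT) /genK.
  have [V V0|V V' VV'|p Kp pP] := @compact_net
    (fun V => [set b | B b /\ exists2 b', B' b' & V (b - b')]).
  - apply: contrapT => H; apply: nW; exists V => // b b' Bb Bb' Vbb'.
    by apply: H; exists b; [split => //; exists b'|apply: CK; exact: BC].
  - by move=> x [Bx [b' Bb' Vx]]; split => //; exists b' => //; exact: VV'.
  have near (V : set G) : nbhs p V -> nbhs (0 : G) [set x | V (p + x)] by move/nbhs0_shift.
  have : (B `&` B') p.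
    split.
      apply: cB => V /near V0; have [x [[Bx _] _ /=]] := pP setT _ filterT V0.
      by rewrite addrC subrK => Vx; exists x.
    apply: cB' => V /near V0; have [V1 V10 V1V] := nbhs0_sub V0.
    have [x [[_ [b' Bb' V1b']] _ V1x]] := pP V1 V1 V10 V10.
    exists b'; split => //; have := V1V _ _ V1x V1b'.
    by rewrite /= addrA [p + _]addrC subrK subKr.
  by rewrite BB'.
have [W1 [W10 W1n _ _ W1W]] := nbhs0_half W0.
have [W2 [W20 W2n W2z W2W _]] := nbhs0_half W10.
have [p Cp|V V0 gV] := @gen_in [set x | exists2 b, C b & W2 (x - b)].
  apply/nbhs0_shift; apply: filterS W20 => w Ww /=.
  by exists p => //; rewrite addrC addKr.
have [V1 [V10 V1n V1V _]] := nbhs0_sym (filterI V0 W20 : nbhs (0 : G) (V `&` W2)).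
have key x : gen V1 x -> exists2 b, B b & W2 (x - b).
  move=> [s sP ->]; elim: s sP => [|y s IH] sP.
    by exists 0; rewrite // big_nil subr0.
  have [|b Bb Wb] := IH; first by move=> z zs; apply: sP; rewrite inE zs orbT.
  have [Ky V1y] := sP y (mem_head _ _).
  have {}V1y : V1 y by case: V1y => // /V1n; rewrite opprK.
  have [|b' Cb' Wb'] := gV (\sum_(z <- y :: s) z).
    exists (y :: s) => // z /sP[Kz V1z]; split => //.
    by case: V1z => /V1V[? _]; [left|right].
  have [Bb'|B'b'] := CBB' _ Cb'; first by exists b'.
  exfalso; apply: (WP b b' Bb B'b').
  have W2y : W2 (- y) by apply: W2n; have [] := V1V _ V1y.
  have E : b - b' = (- y + (\sum_(z <- y :: s) z - b')) - (\sum_(z <- s) z - b).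
    rewrite big_cons; set t := \sum_(z <- s) z.
    by rewrite -[y + t - b']addrA addKr opprB [RHS]addrC addrA subrK.
  rewrite E; apply: W1W; first exact: W2W.
  by rewrite -[_ - b]addr0; exact: W2W.
apply/seteqP; split => // b' B'b'.
have [b Bb Wb] := key b' (B'C _ B'b' _ V10).
apply: (WP b b' Bb B'b'); rewrite -[_ - _]subr0; apply: W1W; last first.
  by rewrite -[0]addr0; exact: W2W.
by rewrite -opprB -[X in W1 X]addr0; apply: W2W => //; exact: W2n.
Qed.

Let C_closed : closed C.
Proof.
have Kcl : closed K by exact: compact_closed.
move=> p clp V V0.
have Kp : K p.
  apply: Kcl => W /clp[x [Cx Wx]]; exists x; split => //.
  exact: (genK (Cx setT filterT)).
have Wp : nbhs p [set x | V (x - p)].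
  apply/nbhs0_shift; apply: filterS V0 => w Vw /=; by rewrite addrC addKr.
by have [x [Cx /= Vx]] := clp _ Wp; exact: gen_near (Cx V V0) Kp Vx.
Qed.

(** The intersection [C] of all [gen V] is closed and connected, hence trivial. *)
Lemma small_gen U : nbhs (0 : G) U -> exists2 V, nbhs (0 : G) V & gen V `<=` U.
Proof.
move=> U0; apply: gen_in => p Cp; suff -> : p = 0 by [].
have Cc : connected C.
  move=> B [b Bb] [O oO BO] [F cF BF].
  have BC : B `<=` C by rewrite BO => x [].
  have cB : closed B by rewrite BF; exact: closedI.
  pose B' := C `\` B.
  have cB' : closed B'.
    have -> : B' = C `&` ~` O.
      rewrite /B' BO; apply/seteqP; split => x [Cx nx]; split => //.
        by move=> Ox; apply: nx.
      by move=> [_ /nx].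
    by apply: closedI => //; exact: open_closedC.
  have B'C : B' `<=` C by move=> x [].
  have BB' : B `&` B' = set0 by apply/seteqP; split => // x [Bx [_ /(_ Bx)]].
  have CBB' : C `<=` B `|` B'.
    by move=> x Cx; have [Bx|nB] := pselect (B x); [left|right].
  have C0 : C 0 by move=> V _; exact: gen0.
  have [B0|B'0] := CBB' 0 C0.
    have E := C_part cB cB' BC B'C CBB' BB' B0.
    by apply/seteqP; split => // x /CBB'[//|]; rewrite E.
  have E := C_part cB' cB B'C BC _ _ B'0.
  have : B b by [].
  rewrite E//; first by rewrite setUC.
  by rewrite setIC.
have C0 : C 0 by move=> V _; exact: gen0.
have := @connected_component_max _ setT C 0 C0 (@subsetT _ _) Cc p Cp.
by rewrite (Gdisc Logic.I).
Qed.

End VanDantzig.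

(** * Groups of characters *)

Section CharacterGroups.
Variables (R : realType) (G : topologicalZmodType).
Implicit Types (f g : G -> R) (Y : set (G -> R)).

(** A group of characters is represented by all real lifts of its members; containing every integer
    valued function makes membership depend on classes modulo 1 only. *)
Definition char_group Y :=
  (forall f, (forall x, f x \is a Num.int) -> Y f) /\
  (forall f g, Y f -> Y g -> Y (fun x => f x - g x)).

Section Closure.
Variable Y : set (G -> R).
Hypothesis Yg : char_group Y.

Lemma char_group_int f : (forall x, f x \is a Num.int) -> Y f.
Proof. exact: Yg.1. Qed.

Lemma char_groupB f g : Y f -> Y g -> Y (fun x => f x - g x).
Proof. exact: Yg.2. Qed.

Lemma char_group0 : Y (fun=> 0).
Proof. by apply: char_group_int => x; exact: rpred0. Qed.

Lemma char_group_eqmod f g : (forall x, f x - g x \is a Num.int) -> Y f -> Y g.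
Proof.
move=> fg Yf; have := char_groupB Yf (char_group_int fg).
by congr Y; apply/funext => x; rewrite subKr.
Qed.

Lemma char_groupN f : Y f -> Y (fun x => - f x).
Proof.
move=> Yf; have := char_groupB char_group0 Yf.
by congr Y; apply/funext => x; rewrite sub0r.
Qed.

Lemma char_groupD f g : Y f -> Y g -> Y (fun x => f x + g x).
Proof.
move=> Yf Yg'; have := char_groupB Yf (char_groupN Yg').
by congr Y; apply/funext => x; rewrite opprK.
Qed.

Lemma char_groupMz f (k : int) : Y f -> Y (fun x => f x *~ k).
Proof.
move=> Yf.
have H n : Y (fun x => f x *+ n).
  elim: n => [|n IH]; first by under eq_fun do rewrite mulr0n; exact: char_group0.
  by under eq_fun do rewrite mulrS; exact: char_groupD.
case: k => n; first exact: H.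
by under eq_fun do rewrite NegzE mulrNz; apply: char_groupN; exact: H.
Qed.

Lemma char_group_comb (y : nat -> G -> R) r c : (forall t, Y (y t)) ->
  Y (fun x => comb (y^~ x) r c).
Proof.
move=> Yy; elim: r => [|r IH].
  by under eq_fun do rewrite /comb big_ord0; exact: char_group0.
under eq_fun do rewrite /comb big_ord_recr.
by apply: char_groupD => //; exact: char_groupMz.
Qed.

End Closure.

Lemma torus_charD f x y : torus_char f -> f (x + y) - (f x + f y) \is a Num.int.
Proof. by move=> [fD _]; rewrite opprD addrA. Qed.

Lemma torus_char0 f : torus_char f -> f 0 \is a Num.int.
Proof.
move=> [fD _]; have := fD 0 0; rewrite addr0 subrr sub0r rpredN.
exact.
Qed.

Lemma torus_charB f x y : torus_char f -> f (x - y) - (f x - f y) \is a Num.int.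
Proof.
move=> Xf; have := torus_charD (x - y) y Xf; rewrite subrK -rpredN.
by rewrite !opprB addrA addrAC.
Qed.

Lemma torus_charMn f x n : torus_char f -> f (x *+ n) - f x *+ n \is a Num.int.
Proof.
move=> Xf; elim: n => [|n IH]; first by rewrite !mulr0n subr0 torus_char0.
have := rpredD IH (torus_charD x (x *+ n) Xf); rewrite -mulrS.
congr (_ \is a Num.int); rewrite [f x *+ n.+1]mulrS !opprD.
by rewrite addrACA addrCA addrA; ring.
Qed.

Lemma torus_charMz f x (k : int) : torus_char f -> f (x *~ k) - f x *~ k \is a Num.int.
Proof.
move=> Xf; case: k => n; first exact: torus_charMn.
rewrite NegzE !mulrNz -!pmulrn; have := torus_charB 0 (x *+ n.+1) Xf.
rewrite sub0r => H1; have := torus_char0 Xf => H0; have H2 := torus_charMn x n.+1 Xf.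
have -> : f (- (x *+ n.+1)) - - (f x *+ n.+1) =
  (f (- (x *+ n.+1)) - (f 0 - f (x *+ n.+1))) + f 0 - (f (x *+ n.+1) - f x *+ n.+1) by ring.
by apply: rpredB => //; apply: rpredD.
Qed.

Lemma torus_char_group : char_group (@torus_char R G).
Proof.
split=> [f fi|f g [fD fc] [gD gc]].
  split=> [x y|e e0]; first by rewrite !rpredB.
  by apply: filterE => x /=; have /intrP[k ->] := fi x; exact: near_int_int.
split=> [x y|e e0].
  have := rpredB (fD x y) (gD x y); congr (_ \is a Num.int); ring.
have e20 : 0 < e / 2 by rewrite divr_gt0.
apply: filterS (filterI (fc _ e20) (gc _ e20)) => x [fx gx] /=.
by rewrite [e]splitr; exact: near_intB.
Qed.

(** The Bohr sets of a separating [Y] have trivial adherence, so the minimality principle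
    applies. *)
Lemma char_bohr_cvg Y : minimal_group G -> char_group Y -> Y `<=` @torus_char R G ->
  (forall x, (forall f, Y f -> f x \is a Num.int) -> x = 0) ->
  forall U, nbhs (0 : G) U -> exists m (y : nat -> G -> R) (e : R),
    [/\ 0 < e, forall t, Y (y t) &
      forall x, (forall t, (t < m)%N -> near_int e (y t x)) -> U x].
Proof.
move=> Gmin Yg YX Ysep U U0.
pose Bo m (y : nat -> G -> R) e : set G :=
  [set x | forall t, (t < m)%N -> near_int e (y t x)].
pose FF : set (set G) := [set F | exists m y e, [/\ 0 < e, forall t, Y (y t) & F = Bo m y e]].
suff [_ [m [y [e [e0 Yy ->]]]] FU] : exists2 F, FF F & F `<=` U by exists m, y, e.
apply: (minimal_group_cvg _ _ _ _ Gmin) => //.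
- exists (Bo 0%N (fun=> fun=> 0) 1), 0%N, (fun=> fun=> 0), 1; split => // t.
  exact: char_group0.
- move=> _ [m [y [e [e0 Yy ->]]]] t _.
  by have /intrP[k ->] := torus_char0 (YX _ (Yy t)); exact: near_int_int.
- move=> _ _ [m [y [e [e0 Yy ->]]]] [m' [y' [e' [e'0 Yy' ->]]]].
  pose z t := if (t < m)%N then y t else y' (t - m)%N.
  pose d := Num.min e e'; have d0 : 0 < d by rewrite lt_min e0.
  exists (Bo (m + m')%N z d).
    by exists (m + m')%N, z, d; split => // t; rewrite /z; case: ifP.
  move=> x xz; split => t tm.
    have := xz t (ltn_addr _ tm); rewrite /z tm; apply: near_int_le.
    by rewrite ge_min lexx.
  have := xz (m + t)%N; rewrite ltn_add2l => /(_ tm).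
  rewrite /z ltnNge leq_addr /= addKn; apply: near_int_le.
  by rewrite ge_min lexx orbT.
- move=> _ [m [y [e [e0 Yy ->]]]]; exists (Bo m y (e / 2)).
    by exists m, y, (e / 2); split => //; rewrite divr_gt0.
  move=> x x' xy xy' t tm; have := near_intB (xy t tm) (xy' t tm).
  rewrite -splitr; apply: near_int_eqmod.
  by rewrite -rpredN opprB torus_charB//; exact: YX.
move=> x xF; apply: Ysep => f Yf; apply: near_int_lim => e e0.
have e20 : 0 < e / 2 by rewrite divr_gt0.
have [|x' fx' fxx'] := xF (Bo 1%N (fun=> f) (e / 2)) _ _ ((YX _ Yf).2 _ e20).
  by exists 1%N, (fun=> f), (e / 2).
have := near_intD fxx' (fx' 0%N isT); rewrite -splitr; apply: near_int_eqmod.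
have := torus_charD (x - x') x' (YX _ Yf); rewrite subrK -rpredN opprB.
exact.
Qed.

(* [f] depends continuously on characters [y] in [Y]; torus separation for the
   range of [(y, f)] and the point [(0, 1 / 2)] yields a relation. *)
Lemma char_group_torsion_index Y f : minimal_group G -> char_group Y ->
  Y `<=` @torus_char R G ->
  (forall x, (forall f, Y f -> f x \is a Num.int) -> x = 0) ->
  torus_char f -> exists2 l : int, l != 0 & Y (fun x => f x *~ l).
Proof.
move=> Gmin Yg YX Ysep Xf.
have q0 : 0 < 1 / 4 :> R by rewrite divr_gt0.
have [m [y [e [e0 Yy yf]]]] := char_bohr_cvg Gmin Yg YX Ysep (Xf.2 _ q0).
pose v x (i : 'I_m.+1) : R := if (i < m)%N then y i x else f x.
have vX x x' i : v (x + x') i - (v x i + v x' i) \is a Num.int.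
  by rewrite /v; case: ifP => _; apply: torus_charD => //; exact: YX.
pose S : set ('I_m.+1 -> R) := [set s | exists x, forall i, s i - v x i \is a Num.int].
pose t0 (i : 'I_m.+1) : R := if (i < m)%N then 0 else 1 / 2.
pose d := Num.min e (1 / 4); have d0 : 0 < d by rewrite lt_min e0.
have [||s [x sx]|n [nS nt]] := @torus_separation _ _ S _ _ t0 d d0.
- by exists 0 => i; rewrite sub0r rpredN /v; case: ifP => _; apply: torus_char0 => //; exact: YX.
- move=> s s' [x sx] [x' sx']; exists (x + x') => i.
  have := rpredB (rpredD (sx i) (sx' i)) (vX x x' i); congr (_ \is a Num.int); ring.
- apply: contrapT => H.
  have {}H i : near_int d (s i - t0 i) by apply: contrapT => nd; apply: H; exists i.
  have {}H i : near_int d (v x i - t0 i).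
    apply: near_int_eqmod (H i); have := sx i; congr (_ \is a Num.int); ring.
  have fx : near_int (1 / 4) (f x).
    apply: yf => t tm; have := H (widen_ord (leqnSn m) (Ordinal tm)).
    rewrite /v /t0 /= tm subr0; apply: near_int_le; by rewrite ge_min lexx.
  (* Modulo 1 no real is at distance less than 1/4 both from 0 and from 1/2. *)
  have := H ord_max; rewrite /v /t0 /= ltnn => /(near_int_le _).
  move=> /(_ (1 / 4)); rewrite ge_min lexx orbT => /(_ isT) fx'.
  have [k] := near_intB fx fx'; rewrite subKr.
  rewrite (_ : 1 / 4 + 1 / 4 = 1 / 2 :> R); last by lra.
  rewrite ltr_norml => /andP[k1 k2].
  have /[!ltr0z] : 0 < k%:~R :> R by lra.
  have /[!ltr_int] : k%:~R < 1%:~R :> R by lra.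
  by lia.
have nmax : n ord_max != 0.
  apply: contra nt => /eqP n0; rewrite /dotp big1 ?rpred0// => i _.
  rewrite /t0; case: ltnP => [_|im]; first exact: mul0rz.
  by rewrite (_ : i = ord_max) ?n0 ?mulr0z//; apply: val_inj; apply/eqP; rewrite eqn_leq im -ltnS ltn_ord.
exists (n ord_max) => //.
pose n' j := if insub j is Some i then - n i else 0.
apply: (char_group_eqmod Yg _ (char_group_comb Yg m n' Yy)) => x.
have : dotp n (v x) \is a Num.int by apply: nS; exists x => i; rewrite subrr rpred0.
rewrite -rpredN /dotp big_ord_recr /= {2}/v /= ltnn opprD.
congr (_ \is a Num.int); congr (_ - _); rewrite /comb -sumrN; apply: eq_bigr => i _.
by rewrite /v /= ltn_ord /n' insubT ?(leq_trans (ltn_ord i))//= => ?; rewrite mulrNz; congr (- (_ *~ n _)); exact: val_inj.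
Qed.

End CharacterGroups.

(** * Small multiples in precompact groups and on the circle *)

(** Two multiples of [x] with factors up to [size E] lie in one translate; the difference of the
    factors divides [(size E)!], which is independent of [x]. *)
Lemma precompact_mul (G : topologicalZmodType) (U : set G) :
  (forall V, nbhs (0 : G) V -> covered setT V) -> nbhs (0 : G) U ->
  exists2 l, (0 < l)%N & forall x : G, exists k, [/\ (0 < k)%N, (k %| l)%N & U (x *+ k)].
Proof.
move=> pc U0; have [V V0 VU] := nbhs0_sub U0; have [E EP] := pc V V0.
exists (size E)`!; first exact: fact_gt0.
move=> x; have /choice[h hP] : forall j : 'I_(size E).+1, exists i : 'I_(size E),
    V (x *+ j - E`_i).
  move=> j; have [e eE Ve] := EP (x *+ j) Logic.I.
  have ie : (index e E < size E)%N by rewrite index_mem.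
  by exists (Ordinal ie); rewrite /= nth_index.
have : ~~ injectiveb h.
  by apply/negP => /injectiveP/leq_card; rewrite !card_ord ltnn.
move=> /injectivePn[i [j ij hij]].
wlog ltij : i j ij hij / (i < j)%N.
  move=> H; have [lt|lt|E'] := ltngtP i j; first exact: (H i j).
    by apply: (H j i) => //; rewrite eq_sym.
  by move/val_inj: E' => E'; rewrite E' eqxx in ij.
exists (j - i)%N; split; first by rewrite subn_gt0.
  by rewrite dvdn_fact// subn_gt0 ltij /= (leq_trans (leq_subr _ _))// -ltnS.
have := VU _ _ (hP j) (hP i); rewrite hij opprB addrA subrK mulrnBr//.
exact: ltnW.
Qed.

Section SmallMultiples.
Variable R : realType.

Lemma near_int_half (e s : R) : e <= 1 / 4 -> near_int (1 / 4) s ->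
  near_int e (s *+ 2) -> near_int (e / 2) s.
Proof.
move=> e4 [k sk] [l sl]; exists k.
suff lk : l = k *+ 2.
  move: sl; rewrite lk rmorphMn /= -mulrnBl normrMn.
  by move: (`|s - _|) => t; lra.
move: sk sl; rewrite !ltr_norml => /andP[? ?] /andP[? ?].
have H1 : (l - k *+ 2)%:~R < 1%:~R :> R by rewrite intrB rmorphMn /=; lra.
have H2 : (-1)%:~R < (l - k *+ 2)%:~R :> R by rewrite intrB rmorphMn /=; lra.
by move: H1 H2; rewrite !ltr_int => H1 H2; lia.
Qed.

(** The circle has no small subgroups: a bound valid for all doubled multiples can be halved, and
    this repeats. *)
Lemma near_int_multiples (r : R) : (forall k, near_int (1 / 4) (r *+ k)) ->
  r \is a Num.int.
Proof.
move=> H.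
have H' j : forall k, near_int (1 / 4 / 2 ^+ j) (r *+ k).
  elim: j => [|j IH] k; first by rewrite expr0 divr1.
  rewrite exprSr invfM mulrA; apply: near_int_half => //; last first.
    by rewrite -mulrnA; exact: IH.
  by rewrite ler_pdivrMr ?exprn_gt0//; apply: ler_peMr; rewrite ?divr_ge0// exprn_ege1// ler1n.
apply: near_int_lim => e e0.
pose j := Num.truncn (e^-1); apply: near_int_le (H' j 1%N).
have ej : e^-1 < 2 ^+ j :> R.
  apply: lt_le_trans (truncnS_gt _) _.
  by rewrite -natrX ler_nat ltn_expl.
rewrite -ler_pdivlMr ?invr_gt0 ?exprn_gt0// invrK.
have : 1 < e * 2 ^+ j by rewrite mulrC -ltr_pdivrMr// div1r.
lra.
Qed.

End SmallMultiples.

(** * Compact annihilators *)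

Section CompactAnnihilator.
Variables (R : realType) (G : topologicalZmodType).
Hypothesis hG : hausdorff_space G.
Hypothesis Gcomp : sequentially_complete G.
Hypothesis Gmin : minimal_group G.
Hypothesis Gdisc : totally_disconnected [set: G].

Local Notation X := (@torus_char R G).

Lemma minimal_chars_separate x : (forall f, X f -> f x \is a Num.int) -> x = 0.
Proof.
move=> fx; apply/eqP; apply: contrapT => /negP x0.
have [f Xf] := precompact_chars_separate R hG (minimal_precompact R hG Gmin) x0.
by rewrite fx.
Qed.

Lemma char_nbhs (U : set G) : nbhs (0 : G) U -> exists m (y : nat -> G -> R) (e : R),
  [/\ 0 < e, forall t, X (y t) &
    forall x, (forall t, (t < m)%N -> near_int e (y t x)) -> U x].
Proof.
apply: char_bohr_cvg => //; first exact: torus_char_group.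
exact: minimal_chars_separate.
Qed.

Definition cvg_mod1 (z : nat -> R) (a : R) := forall e, 0 < e ->
  exists N, forall n, (N <= n)%N -> near_int e (z n - a).

(** Characters generate the topology, so a sequence along which all of them converge modulo 1 is
    Cauchy. *)
Lemma char_seq_lim (u : nat -> G) :
  (forall f, X f -> exists a, cvg_mod1 (f \o u) a) ->
  exists l, forall f a, X f -> cvg_mod1 (f \o u) a -> f l - a \is a Num.int.
Proof.
move=> ucv.
have /Gcomp[l ul] : cauchy_seq u.
  move=> U U0; have [m [y [e [e0 Xy yU]]]] := char_nbhs U0.
  have e20 : 0 < e / 2 by rewrite divr_gt0.
  have /choice[N NP] : forall t, exists N, exists a,
      forall n, (N <= n)%N -> near_int (e / 2) (y t (u n) - a).
    by move=> t; have [a /(_ _ e20)[N NP]] := ucv _ (Xy t); exists N, a.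
  pose M := (\max_(t < m) N t)%N.
  exists ([set n | (M <= n)%N], [set n | (M <= n)%N]).
    by split; exact: nbhs_infty_ge.
  move=> [i j] [/= Mi Mj]; apply: yU => t tm.
  have NM : (N t <= M)%N by exact: (@bigop.leq_bigmax _ (fun t : 'I_m => N t) (Ordinal tm)).
  have [a aP] := NP t.
  have := near_intB (aP i (leq_trans NM Mi)) (aP j (leq_trans NM Mj)).
  rewrite -splitr; apply: near_int_eqmod; rewrite -rpredN.
  by have := torus_charB (u i) (u j) (Xy t); congr (_ \is a Num.int); ring.
exists l => f a Xf fa; apply: near_int_lim => e e0.
have e20 : 0 < e / 2 by rewrite divr_gt0.
have [N NP] := fa _ e20.
have Ul : nbhs l [set x | near_int (e / 2) (f (x - l))].
  apply/nbhs0_shift; apply: filterS (Xf.2 _ e20) => x /= fx.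
  by rewrite addrC addKr.
have ulU : \forall n \near \oo, near_int (e / 2) (f (u n - l)) by exact: ul Ul.
have [n [/= nU nN]] := filter_ex (filterI ulU (nbhs_infty_ge N)).
have := near_intB (NP n nN) nU; rewrite -splitr; apply: near_int_eqmod.
rewrite -rpredN; have := torus_charB (u n) l Xf.
by congr (_ \is a Num.int); rewrite /=; ring.
Qed.

Section Countable.
Variables (Y : set (G -> R)) (xi : nat -> G -> R).
Hypothesis YX : Y `<=` X.
Hypothesis Yxi : forall f, X f -> exists k, Y (fun x => f x - xi k x).

Let K : set G := [set x | forall f, Y f -> f x \is a Num.int].

(** On [K] every character agrees modulo 1 with some [xi k], so countably many limits describe an
    ultrafilter. A sequence in [K] matching more and more of them converges, and the ultrafilter has
    the same limit. *)
Let Kcpt : compact K.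
Proof.
rewrite compact_ultra => F FU FK.
pose fr (r : R) := r - (Num.floor r)%:~R.
have /choice[z zP] : forall k, exists z : R, (fun x => fr (xi k x)) @ F --> z.
  move=> k; apply: ultra_lim => x; rewrite subr_ge0 floor_le /= ltW//.
  by have := floorD1_gt (xi k x); rewrite intrD -ltrBlDl.
have Fz k (e : R) : 0 < e -> F [set x | near_int e (xi k x - z k)].
  move=> e0; have /cvgrPdist_lt/(_ e e0) := zP k; apply: filterS => x.
  rewrite distrC => xe; exists (Num.floor (xi k x)).
  by rewrite addrAC.
have /choice[u uP] : forall j : nat, exists x, K x /\
    forall k, (k <= j)%N -> near_int (j.+1%:R^-1) (xi k x - z k).
  move=> j.
  have H (k : 'I_j.+1) : F [set x | near_int (j.+1%:R^-1) (xi k x - z k)].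
    by apply: Fz; rewrite invr_gt0.
  have [x [Kx xz]] := filter_ex (filterI FK (filter_forall _ H)).
  by exists x; split => // k kj; exact: (xz (Ordinal (kj : (k < j.+1)%N))).
have ucv f k : Y (fun x => f x - xi k x) -> cvg_mod1 (f \o u) (z k).
  move=> Yf e e0; exists (maxn k (Num.truncn e^-1)) => n; rewrite geq_max => /andP[kn en].
  have [Kn nz] := uP n.
  apply: (@near_int_eqmod _ _ (xi k (u n) - z k)); last first.
    apply: near_int_le (nz k kn); rewrite invf_ple ?posrE//.
    by apply: ltW; apply: lt_le_trans (truncnS_gt _) _; rewrite ler_nat ltnS.
  rewrite -rpredN; have := Kn _ Yf; congr (_ \is a Num.int); rewrite /=; ring.
have [f Xf|l lP] := @char_seq_lim u.
  by have [k Yf] := Yxi Xf; exists (z k); exact: ucv.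
have Kl : K l.
  move=> f Yf; have := lP f 0 (YX Yf); rewrite subr0; apply => e e0.
  exists 0%N => n _; have [Kn _] := uP n.
  by have /intrP[k /= ->] := Kn f Yf; rewrite subr0; exact: near_int_int.
exists l; split => // A /nbhs0_shift Al.
have [m [y [e [e0 Xy yA]]]] := char_nbhs Al.
have /choice[k kP] : forall t, exists k, Y (fun x => y t x - xi k x) by move=> t; exact: Yxi.
have H (t : 'I_m) : F [set x | near_int e (xi (k t) x - z (k t))] by exact: Fz.
apply: filterS (filterI FK (filter_forall _ H)) => x [Kx xz].
rewrite -(subrK l x) addrC; apply: yA => t tm.
apply: near_int_eqmod (xz (Ordinal tm)) => /=.
have h1 := lP (y t) _ (Xy t) (ucv _ _ (kP t)).
have h2 := Kx _ (kP t); have h3 := torus_charB x l (Xy t).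
have := rpredB h1 (rpredD h2 h3); congr (_ \is a Num.int); ring.
Qed.

(** On a small subgroup [gen V] of [K] the values of [f] stay within 1/4 of the integers, hence are
    integral; each [x] in [K] has a multiple in it with a factor dividing a fixed [l]. *)
Lemma char_finite_on_annihilator f : X f -> exists2 l, (0 < l)%N &
  forall x, K x -> f x *+ l \is a Num.int.
Proof.
move=> Xf.
have K0 : K 0 by move=> g /YX; exact: torus_char0.
have KB x y : K x -> K y -> K (x - y).
  move=> Kx Ky g Yg'; have := torus_charB x y (YX Yg').
  have := rpredB (Kx g Yg') (Ky g Yg'); move=> /rpredD h /h.
  by congr (_ \is a Num.int); rewrite addrC subrK.
have q0 : 0 < 1 / 4 :> R by rewrite divr_gt0.
have [V V0 Vf] := small_gen hG Gdisc K0 KB Kcpt (Xf.2 _ q0).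
have [l l0 lP] := precompact_mul (minimal_precompact R hG Gmin) V0.
exists l => // x Kx; have [k [k0 /dvdnP[j lE] Vk]] := lP x.
have KMn n : K (x *+ n).
  elim: n => [|n IH]; first by rewrite mulr0n.
  have -> : x *+ n.+1 = x *+ n - (0 - x) by rewrite sub0r opprK mulrSr.
  by apply: (KB _ _ IH); exact: KB.
suff fi : f (x *+ k) \is a Num.int.
  rewrite lE mulnC mulrnA rpredMn//.
  have := rpredB fi (torus_charMn x k Xf); by rewrite subKr.
apply: near_int_multiples => n.
apply: (@near_int_eqmod _ _ (f (x *+ k *+ n))); first exact: torus_charMn.
apply: Vf; exists (nseq n (x *+ k)).
  by move=> y /nseqP[-> _]; split; [exact: KMn|left].
by elim: n => [|n IH]; rewrite ?mulr0n ?big_nil// mulrS IH big_cons.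
Qed.

End Countable.
End CompactAnnihilator.

Lemma combMz (G : zmodType) (a : nat -> G) r c (k : int) :
  comb a r (fun j => c j * k) = comb a r c *~ k.
Proof. by rewrite /comb mulrz_suml; apply: eq_bigr => j _; rewrite mulrzA. Qed.

(** * The character group has finite rank *)

Section FiniteRank.
Variables (R : realType) (G : topologicalZmodType).
Hypothesis hG : hausdorff_space G.
Hypothesis Gcomp : sequentially_complete G.
Hypothesis Gmin : minimal_group G.
Hypothesis Gdisc : totally_disconnected [set: G].

Local Notation X := (@torus_char R G).

Section Independent.
Variable ch : nat -> G -> R.
Hypothesis Xch : forall i, X (ch i).
Hypothesis ch_indep : forall r c, (forall j, (r <= j)%N -> c j = 0) ->
  (forall x, comb (ch^~ x) r c \is a Num.int) -> forall j, c j = 0.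

(** Zorn's lemma. The property is stated for [A] united with [I0] because of the empty chain, whose
    union contains no integer valued function. *)
Let maximal : exists Y : set (G -> R), [/\ char_group Y, Y `<=` X,
  forall r c, (forall j, (r <= j)%N -> c j = 0) ->
    Y (fun x => comb (ch^~ x) r c) -> forall j, c j = 0 &
  forall f, X f -> ~ Y f -> exists y (a : int) r c, [/\ Y y,
    forall j, (r <= j)%N -> c j = 0, ~ (forall j, c j = 0) &
    forall x, y x + f x *~ a = comb (ch^~ x) r c]].
Proof.
pose I0 : set (G -> R) := [set f | forall x, f x \is a Num.int].
pose P (A : set (G -> R)) := [/\ char_group (A `|` I0), A `|` I0 `<=` X &
  forall r c, (forall j, (r <= j)%N -> c j = 0) ->
    (A `|` I0) (fun x => comb (ch^~ x) r c) -> forall j, c j = 0].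
have Xg := torus_char_group R G.
have [F FP Ftot|A [[Ag AX Aind] Amax]] := @Zorn_bigcup _ P.
  have mem2 f g : (\bigcup_(X in F) X `|` I0) f -> (\bigcup_(X in F) X `|` I0) g ->
      (exists A, [/\ F A, (A `|` I0) f & (A `|` I0) g]) \/ (I0 f /\ I0 g).
    move=> [[A FA Af]|If] [[B FB Bg]|Ig].
    - have [AB|BA] := Ftot A B FA FB; left.
        by exists B; split => //; left => //; exact: AB.
      by exists A; split => //; left => //; exact: BA.
    - by left; exists A; split => //; [left|right].
    - by left; exists B; split => //; [right|left].
    - by right.
  have int0 f : I0 f -> X f by exact: Xg.1.
  split.
  - split=> [f If|f g Ff Fg]; first by right.
    have [[A [FA Af Ag]]|[If Ig]] := mem2 f g Ff Fg.
      have [[_ /(_ f g Af Ag)[Afg|Ifg]] _ _] := FP A FA; last by right.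
      by left; exists A.
    by right => x; rewrite rpredB.
  - move=> f [[A FA Af]|/int0//]; have [_ AX _] := FP A FA; apply: AX; by left.
  - move=> r c cr [[A FA Af]|Ic]; last exact: (ch_indep cr Ic).
    by have [_ _ Aind] := FP A FA; apply: Aind cr _; left.
exists (A `|` I0); split => // f Xf nYf.
pose B : set (G -> R) := [set g | exists y (a : int),
  (A `|` I0) y /\ g = fun x => y x + f x *~ a].
have IB : I0 `<=` B.
  move=> g Ig; exists g, 0; split; first by right.
  by apply/funext => x; rewrite mulr0z addr0.
have BB : B `|` I0 = B by apply/seteqP; split => g; [case=> // /IB|left].
have Bg : char_group B.
  split=> [g /IB//|_ _ [y [a [Yy ->]]] [y' [a' [Yy' ->]]]].
  exists (fun x => y x - y' x), (a - a'); split; first exact: char_groupB.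
  by apply/funext => x; rewrite mulrzBr; ring.
have BX : B `<=` X.
  move=> _ [y [a [Yy ->]]]; apply: (char_groupD Xg); first exact: AX.
  exact: (char_groupMz Xg).
have AB : A `<` B.
  split=> [g Ag'|BA].
    exists g, 0; split; first by left.
    by apply/funext => x; rewrite mulr0z addr0.
  apply: nYf; left; apply: BA; exists (fun=> 0), 1; split; first exact: char_group0.
  by apply/funext => x; rewrite mulr1z add0r.
apply: contrapT => H; apply: (Amax B AB); split; rewrite BB => //.
move=> r c cr [y [a [Yy E]]]; apply: contrapT => nc; apply: H.
exists y, a, r, c; split => // x.
by have := congr1 (fun g : G -> R => g x) E => /= <-.
Qed.

(* Let [Y] be maximal with [Y] meeting the span of [ch] trivially.  The
   annihilator of [Y] is compact, so multiples [ch' n] of the [ch n] vanish on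
   it.  Sending [ch' n] to [1 / n!] defines [X / Y -> Q], whose kernel still
   separates points although its index is not torsion. *)
Lemma no_infinite_rank : False.
Proof.
have [Y [Yg YX Yind Ymax]] := maximal; have Xg := torus_char_group R G.
(* [X / Y] is torsion-free by maximality. *)
have Ytf f (l : int) : X f -> l != 0 -> Y (fun x => f x *~ l) -> Y f.
  move=> Xf l0 Yfl; apply: contrapT => nYf.
  have [y [a [r [c [Yy cr nc E]]]]] := Ymax f Xf nYf; apply: nc => j.
  have YH : Y (fun x => comb (ch^~ x) r (fun j => c j * l)).
    have -> : (fun x => comb (ch^~ x) r (fun j => c j * l)) =
        fun x => y x *~ l + f x *~ l *~ a.
      by apply/funext => x; rewrite combMz -E mulrzDl -!mulrzA [a * l]mulrC.
    by apply: (char_groupD Yg); exact: (char_groupMz Yg).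
  have cl0 k : (r <= k)%N -> c k * l = 0 by move=> rk; rewrite cr ?mul0r.
  have /eqP := Yind r (fun j => c j * l) cl0 YH j.
  by rewrite mulf_eq0 (negbTE l0) orbF => /eqP.
have ess f : X f -> exists (a : int) r c, [/\ a != 0,
    forall j, (r <= j)%N -> c j = 0 & Y (fun x => f x *~ a - comb (ch^~ x) r c)].
  move=> Xf; have [Yf|nYf] := pselect (Y f).
    exists 1, 0%N, (fun=> 0); split => //.
    by under eq_fun do rewrite /comb big_ord0 subr0 mulr1z.
  have [y [a [r [c [Yy cr nc E]]]]] := Ymax f Xf nYf.
  exists a, r, c; split => //.
    apply: contra_notN nc => /eqP a0; apply: Yind cr _.
    by under eq_fun do rewrite -E a0 mulr0z addr0.
  under eq_fun do rewrite -E opprD addrCA subrr addr0.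
  exact: (char_groupN Yg).
(* By torsion-freeness a relation between a nonzero multiple of [f] and the [ch j] determines the
   class of [f] in [X / Y]; [unpickle] enumerates the possible relations. *)
have /choice[xi xiP] : forall k : nat, exists f, X f /\ forall (a : int) (s : seq int),
    unpickle k = Some (a, s) ->
    forall g, X g -> Y (fun x => g x *~ a - comb (ch^~ x) (size s) (nth 0 s)) ->
    Y (fun x => f x *~ a - comb (ch^~ x) (size s) (nth 0 s)).
  move=> k; case E : (unpickle k : option (int * seq int)) => [[a s]|]; last first.
    by exists (fun=> 0); split => //; exact: (char_group0 Xg).
  have [[g [Xg' Yg']]|ng] := pselect (exists g, X g /\
      Y (fun x => g x *~ a - comb (ch^~ x) (size s) (nth 0 s))).
    by exists g; split => // a' s' [<- <-].
  exists (fun=> 0); split; first exact: (char_group0 Xg).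
  by move=> a' s' [<- <-] g Xg' Yg'; exfalso; apply: ng; exists g.
have Xxi k : X (xi k) by have [] := xiP k.
have Yxi f : X f -> exists k, Y (fun x => f x - xi k x).
  move=> Xf; have [a [r [c [a0 cr Yf]]]] := ess f Xf.
  pose k := pickle (a, mkseq c r); exists k.
  have fE x : comb (ch^~ x) r c = comb (ch^~ x) (size (mkseq c r)) (nth 0 (mkseq c r)).
    by rewrite size_mkseq; apply: eq_bigr => j _; rewrite nth_mkseq.
  have {}Yf : Y (fun x => f x *~ a - comb (ch^~ x) (size (mkseq c r)) (nth 0 (mkseq c r))).
    by move: Yf; under eq_fun do rewrite fE.
  have Yk := (xiP k).2 a (mkseq c r) (pickleK _) f Xf Yf.
  apply: Ytf a0 _; first exact: (char_groupB Xg).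
  have := char_groupB Yg Yf Yk; congr Y; apply/funext => x.
  by rewrite mulrzBl; ring.
have /choice[l lP] : forall n, exists l, (0 < l)%N /\
    forall x, (forall f, Y f -> f x \is a Num.int) -> ch n x *+ l \is a Num.int.
  move=> n; have [l l0 lP] :=
    char_finite_on_annihilator hG Gcomp Gmin Gdisc YX Yxi (Xch n).
  by exists l.
pose ch' n x := ch n x *+ l n.
have ch'E r c x : comb (ch'^~ x) r c = comb (ch^~ x) r (fun j => c j * (l j)%:Z).
  by apply: eq_bigr => j _; rewrite /ch' pmulrn -mulrzA mulrC.
have Xch' n : X (ch' n) by exact: (char_groupMz Xg (l n)%:Z (Xch n)).
have l_neq0 n : (l n)%:Z != 0 by rewrite eqz_nat -lt0n; have [] := lP n.
have ess' f : X f -> exists (a : int) r c, [/\ a != 0,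
    forall j, (r <= j)%N -> c j = 0 & Y (fun x => f x *~ a - comb (ch'^~ x) r c)].
  move=> Xf; have [a [r [c [a0 cr Yf]]]] := ess f Xf.
  pose L := (\prod_(j < r) l j)%N.
  exists (a * L%:Z), r, (fun j => c j * (L %/ l j)%N%:Z); split.
  - rewrite mulf_neq0// eqz_nat -lt0n prodn_gt0// => j; by have [] := lP j.
  - by move=> j rj; rewrite cr ?mul0r.
  have := char_groupMz Yg L%:Z Yf; congr Y; apply/funext => x.
  rewrite mulrzBl mulrzA; congr (_ - _); rewrite ch'E -combMz.
  apply: eq_bigr => j _; congr (_ *~ _); rewrite -mulrA -PoszM divnK//.
  by rewrite /L (bigD1 j)//= dvdn_mulr.
pose wt (j : nat) : R := (j`!)%:R^-1.
pose Y' : set (G -> R) := [set f | X f /\ exists (a : int) r c, [/\ a != 0,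
  forall j, (r <= j)%N -> c j = 0, comb wt r c = 0 &
  Y (fun x => f x *~ a - comb (ch'^~ x) r c)]].
have YY' : Y `<=` Y'.
  move=> f Yf; split; first exact: YX.
  exists 1, 0%N, (fun=> 0); split => //; first by rewrite /comb big_ord0.
  by under eq_fun do rewrite /comb big_ord0 subr0 mulr1z.
have Y'g : char_group Y'.
  split=> [f fi|f g]; first by apply: YY'; exact: Yg.1.
  move=> [Xf [a [r [c [a0 cr wc Yf]]]]] [Xg' [a' [r' [c' [a'0 cr' wc' Yg']]]]].
  split; first exact: (char_groupB Xg).
  exists (a * a'), (maxn r r'), (fun j => c j * a' - c' j * a); split.
  - exact: mulf_neq0.
  - by move=> j; rewrite geq_max => /andP[? ?]; rewrite cr ?cr' ?mul0r ?subr0.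
  - rewrite combB !combMz (comb_widen wt cr (leq_maxl r r')).
    by rewrite (comb_widen wt cr' (leq_maxr r r')) wc wc' !mul0rz subr0.
  have := char_groupB Yg (char_groupMz Yg a' Yf) (char_groupMz Yg a Yg').
  congr Y; apply/funext => x; rewrite combB !combMz.
  rewrite (comb_widen _ cr (leq_maxl r r')) (comb_widen _ cr' (leq_maxr r r')).
  rewrite !mulrzBl -!mulrzA [a' * a]mulrC; ring.
have Y'sep x : (forall f, Y' f -> f x \is a Num.int) -> x = 0.
  move=> xY'; apply: (minimal_chars_separate (R := R) hG Gmin) => f Xf.
  have xch n : ch' n x \is a Num.int by apply: (lP n).2 => g /YY'; exact: xY'.
  have [a [r [c [a0 cr Yf]]]] := ess' f Xf.
  (* The image of [f] is [u / (a * r!)], which equals [z / n!] since [n! = q * |a| * r!]. *)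
  pose u := \sum_(j < r) c j * (r`! %/ j`!)%N%:Z.
  pose n := (`|a| * r`!)%N.
  have n0 : (0 < n)%N by rewrite muln_gt0 absz_gt0 a0 fact_gt0.
  have /dvdnP[q nq] : (n %| n`!)%N by rewrite dvdn_fact// n0 leqnn.
  pose z := u * q%:Z * Num.sg a.
  have nR : (n`!)%:R != 0 :> R by rewrite pnatr_eq0 -lt0n fact_gt0.
  have rR : (r`!)%:R != 0 :> R by rewrite pnatr_eq0 -lt0n fact_gt0.
  have wu : comb wt r c = u%:~R / (r`!)%:R.
    rewrite /comb /u raddf_sum mulr_suml; apply: eq_bigr => j _ /=.
    have jR : (j`!)%:R != 0 :> R by rewrite pnatr_eq0 -lt0n fact_gt0.
    have jr : (j`! %| r`!)%N.
      have jr := ltnW (ltn_ord j); apply/dvdnP.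
      by exists ('C(r, j) * (r - j)`!)%N; rewrite -(bin_fact jr) -mulnA [(_`! * j`!)%N]mulnC.
    rewrite -mulrzl /wt intrM -pmulrn -mulrA; congr (_ * _).
    have rE : (r`!)%:R = (r`! %/ j`!)%:R * (j`!)%:R :> R by rewrite -natrM divnK.
    have q0 : (r`! %/ j`!)%:R != 0 :> R.
      by rewrite pnatr_eq0 -lt0n divn_gt0 ?fact_gt0// dvdn_leq// fact_gt0.
    by rewrite [in RHS]rE invfM mulrA divff ?mul1r.
  have azn : a%:~R * z%:~R / (n`!)%:R = u%:~R / (r`!)%:R :> R.
    have aa : a * Num.sg a = `|a|%N%:Z by rewrite mulrC -abszEsg.
    apply/eqP; rewrite eqr_div// -intrM !pmulrn -!intrM eqr_int /z nq /n.
    by rewrite !PoszM -aa; apply/eqP; ring.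
  pose d j : int := (j == n)%:Z.
  have : Y' (fun x => f x - ch' n x *~ z).
    split; first by apply: (char_groupB Xg) => //; exact: (char_groupMz Xg).
    exists a, (maxn r n.+1), (fun j => c j - d j * (z * a)); split => //.
    - move=> j; rewrite geq_max => /andP[rj nj].
      by rewrite cr// /d gtn_eqF// mul0r subr0.
    - rewrite combB combMz (comb_widen wt cr (leq_maxl _ _)) wu comb_delta ?leq_maxr//.
      rewrite -azn -[wt n *~ _]mulrzl /wt [(z * a)%:~R]intrM; apply/eqP; rewrite subr_eq0; apply/eqP; ring.
    move: Yf; congr Y; apply/funext => t.
    rewrite combB combMz (comb_widen _ cr (leq_maxl _ _)) comb_delta ?leq_maxr//.
    by rewrite mulrzBl -mulrzA; ring.
  move=> /xY'; have zx : ch' n x *~ z \is a Num.int by rewrite -mulrzl rpredM ?intr_int.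
  by move=> /rpredD/(_ zx); rewrite subrK.
have Y'X : Y' `<=` X by move=> f [].
(* The image of [ch' 0] is [1 / 0! = 1], so no nonzero multiple of it lies in the kernel [Y']. *)
have [k k0 [_ [a [r [c [a0 cr wc]]]]]] :=
  char_group_torsion_index Gmin Y'g Y'X Y'sep (Xch' 0%N).
pose d j : int := (j == 0%N)%:Z.
have -> : (fun x => ch' 0%N x *~ k *~ a - comb (ch'^~ x) r c) =
    fun x => comb (ch^~ x) (maxn r 1) (fun j => (d j * (k * a) - c j) * (l j)%:Z).
  apply/funext => x; rewrite -ch'E combB combMz (comb_widen _ cr (leq_maxl _ _)).
  by rewrite comb_delta ?leq_maxr// -mulrzA.
move=> YH; have H j : c j = d j * (k * a).
  have cl0 i : (maxn r 1 <= i)%N -> (d i * (k * a) - c i) * (l i)%:Z = 0.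
    by rewrite geq_max => /andP[ri i1]; rewrite cr// /d gtn_eqF// mul0r subr0 mul0r.
  have /eqP := Yind (maxn r 1) (fun j => (d j * (k * a) - c j) * (l j)%:Z) cl0 YH j.
  by rewrite mulf_eq0 (negbTE (l_neq0 j)) orbF subr_eq0 => /eqP ->.
have r0 : (0 < r)%N.
  rewrite lt0n; apply/negP => /eqP r0; have := H 0%N; rewrite cr ?r0//.
  by rewrite /d eqxx mul1r => /esym/eqP; rewrite mulf_eq0 (negbTE k0) (negbTE a0).
move: wc; have -> : c = fun j => d j * (k * a) by apply/funext.
rewrite combMz comb_delta// /wt fact0 invr1 -[_ *~ _]/((k * a)%:~R) => /eqP.
by rewrite intr_eq0 mulf_eq0 (negbTE k0) (negbTE a0).
Qed.

End Independent.

Theorem chars_finite_rank : exists r (ch : nat -> G -> R), (forall i, X (ch i)) /\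
  forall f, X f -> exists2 l : int, l != 0 &
    exists c, forall x, f x *~ l - comb (ch^~ x) r c \is a Num.int.
Proof.
apply: contrapT => H; have Xg := torus_char_group R G.
pose nx (s : seq (G -> R)) := nth (fun=> 0) s.
have [s|ch chP] := @exists_seq (G -> R) (fun s f => (forall i, X (nx s i)) ->
    X f /\ forall (l : int) (c : nat -> int), l != 0 ->
      ~ (forall x, f x *~ l - comb (nx s ^~ x) (size s) c \is a Num.int)).
  have [sX|nsX] := pselect (forall i, X (nx s i)); last by exists (fun=> 0).
  apply: contrapT => nf; apply: H; exists (size s), (nx s); split => // f Xf.
  apply: contrapT => nl; apply: nf; exists f => _; split => // l c l0 fl.
  by apply: nl; exists l => //; exists c.
have nxE n i : nx (mkseq ch n) i = if (i < n)%N then ch i else fun=> 0.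
  case: ltnP => ni; first by rewrite /nx nth_mkseq.
  by rewrite /nx nth_default// size_mkseq.
have Xch n : X (ch n).
  elim/ltn_ind: n => n IH; apply: (chP n _).1 => i; rewrite nxE.
  by case: ltnP => [/IH//|_]; exact: (char_group0 Xg).
apply: (no_infinite_rank Xch) => r c cr ci j.
apply: contrapT => /eqP cj.
have jr : (j < r)%N by rewrite ltnNge; apply: contra cj => /cr ->.
have [i [/andP[ji ir] ci0 imax]] := @exists_last (fun j => c j != 0) r j jr cj.
have Xn k : X (nx (mkseq ch i) k) by rewrite nxE; case: ifP => // _; exact: (char_group0 Xg).
apply: ((chP i Xn).2 (c i) (fun j => - c j) ci0) => x.
have := ci x; congr (_ \is a Num.int).
rewrite (@comb_widen _ _ i.+1 r) => [|k ik|//]; last first.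
  have [kr|/cr//] := ltnP k r; apply/eqP.
  by have := imax k; rewrite ik kr negbK => ->.
rewrite /comb big_ord_recr/= addrC size_mkseq -sumrN; congr (_ + _).
by apply: eq_bigr => k _; rewrite nxE ltn_ord mulrNz opprK.
Qed.

End FiniteRank.

(** * One-parameter subgroups *)

Section Path.
Variables (R : realType) (G : topologicalZmodType).
Hypothesis hG : hausdorff_space G.
Hypothesis Gcomp : sequentially_complete G.
Hypothesis Gmin : minimal_group G.
Hypothesis Gdisc : totally_disconnected [set: G].

Local Notation X := (@torus_char R G).

Variables (r : nat) (ch : nat -> G -> R).
Hypothesis Xch : forall i, X (ch i).
Hypothesis chP : forall f, X f -> exists2 l : int, l != 0 &
    exists c, forall x, f x *~ l - comb (ch^~ x) r c \is a Num.int.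

Section Direction.
(** The vectors [v k] of character values at [h k] shrink faster than [1 / k!], and their directions
    [v k / m k] tend to [u]. *)
Variables (h : nat -> G) (m : nat -> R) (v : nat -> 'I_r -> R) (u : 'I_r -> R).
Hypothesis hv : forall k (i : 'I_r), ch i (h k) - v k i \is a Num.int.
Hypothesis m0 : forall k, 0 < m k.
Hypothesis mk : forall k, m k * (k`!)%:R <= k.+1%:R^-1.
Hypothesis vu : forall k i, `|v k i - m k * u i| <= m k / k.+1%:R.

(** An approximation of [s / m k] by a multiple of [k!]. Once it is divisible by the [l] that brings
    [f] into the span of the [ch i], the value of [f] at [h k *~ nk s k] can be read off from
    [v k]. *)
Let nk (s : R) k : int := (k`!)%:Z * Num.floor (s / (m k * (k`!)%:R)).

Let nk_m s k : s - k.+1%:R^-1 <= (nk s k)%:~R * m k <= s.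
Proof.
have M0 : 0 < m k * (k`!)%:R by rewrite mulr_gt0// ltr0n fact_gt0.
have h1 := floor_le (s / (m k * (k`!)%:R)).
have h2 := floorD1_gt (s / (m k * (k`!)%:R)).
move: h1 h2; rewrite intrD ler_pdivlMr// ltr_pdivrMr// => h1 h2.
have -> : (nk s k)%:~R * m k =
    (Num.floor (s / (m k * (k`!)%:R)))%:~R * (m k * (k`!)%:R).
  by rewrite /nk intrM -pmulrn; ring.
rewrite h1 andbT; have := mk k; move: h2; rewrite mulrDl mul1r.
by move: (k.+1%:R^-1) (m k * _) (_ * _) => x y t; lra.
Qed.

Let nk_v s k i : `|(nk s k)%:~R * v k i - s * u i| <= (`|s| + 1 + `|u i|) / k.+1%:R.
Proof.
have K0 : 0 < k.+1%:R^-1 :> R by rewrite invr_gt0.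
have K1 : k.+1%:R^-1 <= 1 :> R by rewrite invf_le1// ler1n.
have := nk_m s k; set n := (nk s k)%:~R : R => /andP[n1 n2].
have -> : n * v k i - s * u i = n * (v k i - m k * u i) + (n * m k - s) * u i by ring.
rewrite [leRHS]mulrDl; apply: le_trans (ler_normD _ _) _; apply: lerD; last first.
  rewrite normrM [leLHS]mulrC ler_wpM2l// distrC ger0_norm ?subr_ge0//.
  by rewrite lerBlDr -lerBlDl.
rewrite normrM; apply: (@le_trans _ _ (`|n| * (m k / k.+1%:R))); first by rewrite ler_wpM2l.
rewrite mulrA ler_wpM2r ?(ltW K0)//.
have -> : `|n| * m k = `|n * m k| by rewrite normrM (ger0_norm (ltW (m0 k))).
have := ler_norm s; have := ler_norm (- s); rewrite normrN => s1 s2.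
rewrite ler_norml; move: n1 n2 K1 K0; move: (n * m k) (k.+1%:R^-1) => p q *.
by apply/andP; split; lra.
Qed.

Let nk_cvg s f (l : int) c : X f -> l != 0 ->
  (forall x, f x *~ l - comb (ch^~ x) r c \is a Num.int) ->
  cvg_mod1 (f \o (fun k => h k *~ nk s k)) (s * (\sum_i u i *~ c (i : nat)) / l%:~R).
Proof.
move=> Xf l0 fc e e0.
pose B := \sum_(i < r) `|(c i)%:~R| * (`|s| + 1 + `|u i|).
have B0 : 0 <= B by apply: sumr_ge0 => i _; rewrite mulr_ge0// !addr_ge0.
exists (maxn `|l| (Num.truncn (B / e))) => k; rewrite geq_max => /andP[lk ek].
have lR : l%:~R != 0 :> R by rewrite intr_eq0.
have l1 : 1 <= `|l%:~R : R|.
  by rewrite -intr_norm -[1]/(1%:~R) ler_int -abszE lez_nat absz_gt0.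
have /dvdzP[q nq] : (l %| nk s k)%Z.
  by rewrite /nk dvdz_mulr// dvdzE /= dvdn_fact// absz_gt0 l0 lk.
pose w := \sum_i v k i *~ c (i : nat).
apply: (@near_int_eqmod _ _ (w *~ q - s * (\sum_i u i *~ c (i : nat)) / l%:~R)).
  rewrite opprB addrA subrK /=.
  have a1 := torus_charMz (h k) (nk s k) Xf.
  have a2 : (f (h k) *~ l - comb (ch^~ (h k)) r c) *~ q \is a Num.int.
    by rewrite -mulrzl rpredM ?intr_int.
  have a3 : (comb (ch^~ (h k)) r c - w) *~ q \is a Num.int.
    rewrite -mulrzl rpredM ?intr_int// /comb /w -sumrB rpred_sum// => i _.
    by rewrite -mulrzBl -mulrzl rpredM ?intr_int.
  rewrite -rpredN; have := rpredD (rpredD a1 a2) a3; congr (_ \is a Num.int).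
  by rewrite nq !mulrzBl -mulrzA [l * q]mulrC; ring.
apply: near_int_norm.
have -> : w *~ q - s * (\sum_i u i *~ c (i : nat)) / l%:~R =
    (\sum_(i < r) (c i)%:~R * ((nk s k)%:~R * v k i - s * u i)) / l%:~R.
  rewrite nq intrM; under [X in _ = X / _]eq_bigr do rewrite mulrBr.
  rewrite sumrB mulrBl; congr (_ - _).
    rewrite /w mulrz_suml mulr_suml; apply: eq_bigr => i _.
    by rewrite -mulrzA -mulrzl intrM; field.
  congr (_ / _); rewrite mulr_sumr; apply: eq_bigr => i _.
  by rewrite -mulrzl; ring.
rewrite normrM normfV; apply: (@le_lt_trans _ _ (B / k.+1%:R)).
  rewrite ler_pdivrMr ?(lt_le_trans ltr01)//.
  apply: (@le_trans _ _ (B / k.+1%:R)); last first.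
    by rewrite ler_peMr// mulr_ge0// invr_ge0.
  apply: le_trans (ler_norm_sum _ _ _) _; rewrite /B mulr_suml; apply: ler_sum => i _.
  by rewrite normrM -mulrA ler_wpM2l.
rewrite ltr_pdivrMr// mulrC -ltr_pdivrMr//.
by apply: lt_le_trans (truncnS_gt _) _; rewrite ler_nat ltnS.
Qed.

(** The limits [gam s] of [h k *~ nk s k] form a continuous curve on which [ch i] is [s * u i]
    modulo 1. Its range is connected, hence a point, which fails at [s = 1 / (2 * u i0)] unless
    [u i0 = 0]. *)
Lemma no_direction i0 : u i0 = 0.
Proof.
have /choice[gam gamP] : forall s, exists g, forall f (l : int) c, X f -> l != 0 ->
    (forall x, f x *~ l - comb (ch^~ x) r c \is a Num.int) ->
    f g - s * (\sum_i u i *~ c (i : nat)) / l%:~R \is a Num.int.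
  move=> s; have [f Xf|g gP] := char_seq_lim (R := R) hG Gcomp Gmin (u := fun k => h k *~ nk s k).
    have [l l0 [c fc]] := chP Xf.
    by exists (s * (\sum_i u i *~ c (i : nat)) / l%:~R); exact: nk_cvg.
  by exists g => f l c Xf l0 fc; apply: gP => //; exact: nk_cvg.
have cgam : continuous gam.
  move=> s U /nbhs0_shift U0; have [t [y [e [e0 Xy yU]]]] := char_nbhs R hG Gmin U0.
  have /choice[ph phP] : forall j, exists p : R, forall s, y j (gam s) - s * p \is a Num.int.
    move=> j; have [l l0 [c fc]] := chP (Xy j).
    by exists ((\sum_i u i *~ c (i : nat)) / l%:~R) => s'; rewrite mulrA; exact: gamP.
  have H (j : 'I_t) : \forall s' \near s, `|s' - s| * (`|ph j| + 1) < e.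
    have p0 : 0 < `|ph j| + 1 by rewrite ltr_wpDl.
    near=> s'; rewrite -ltr_pdivlMr// distrC; near: s'.
    by apply: cvgr_dist_lt => //; rewrite divr_gt0.
  apply: filterS (filter_forall _ H) => s' Hs' /=.
  rewrite -(subrK (gam s) (gam s')) addrC; apply: yU => j jt.
  apply: (@near_int_eqmod _ _ ((s' - s) * ph j)).
    have := rpredD (torus_charB (gam s') (gam s) (Xy j)) (rpredB (phP j s') (phP j s)).
    by rewrite -rpredN; congr (_ \is a Num.int); ring.
  apply: near_int_norm; rewrite normrM.
  apply: le_lt_trans (Hs' (Ordinal jt)).
  by rewrite ler_wpM2l// lerDl.
have cR : connected (range gam).
  apply: connected_continuous_connected; last exact: continuous_subspaceT.
  by apply/connected_intervalP.
have g0 s : gam s = gam 0.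
  have := @connected_component_max _ setT (range gam) (gam 0) _ (@subsetT _ _) cR (gam s).
  rewrite (Gdisc Logic.I); apply; by [exists 0|exists s].
apply: contrapT => /eqP u0.
have gi s : ch i0 (gam s) - s * u i0 \is a Num.int.
  pose d (j : nat) : int := (j == i0)%:Z.
  have rel x : ch i0 x *~ 1 - comb (ch^~ x) r d \is a Num.int.
    by rewrite comb_delta// subrr rpred0.
  have := gamP s _ _ _ (Xch i0) (oner_neq0 _) rel.
  by rewrite (bigD1 i0)//= /d eqxx mulr1z big1 ?addr0 ?divr1// => j /negbTE; rewrite -val_eqE /= => ->.
have := rpredB (gi 0) (gi (1 / 2 / u i0)); rewrite g0 mul0r subr0 subKr divfK//.
move=> /intrP[k kE]; have k1 : (k * 2)%:~R = 1%:~R :> R by rewrite intrM -kE; lra.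
by move/eqP: k1; rewrite eqr_int => /eqP; lia.
Unshelve. all: end_near. Qed.

End Direction.

(** Ever smaller nonzero vectors of character values, divided by their largest coordinate, have a
    limit direction with a nonzero coordinate, contrary to [no_direction]. *)
Lemma chars_torsion_of_rank f0 : X f0 ->
  exists2 l : int, l != 0 & forall x, f0 x *~ l \is a Num.int.
Proof.
move=> Xf0; apply: contrapT => ntor.
(* If all [ch i] were integral at every such [x], a fixed multiple of each [ch i], and so of [f0],
   would be integer valued. *)
have tiny (e : R) : 0 < e -> exists x, (forall i, (i < r)%N -> near_int e (ch i x)) /\
    exists i, (i < r)%N /\ ch i x \isn't a Num.int.
  move=> e0; apply: contrapT => nt; apply: ntor.
  have U0 : nbhs (0 : G) [set x | forall i : 'I_r, near_int e (ch i x)].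
    by apply: filter_forall => i; exact: (Xch i).2.
  have [n n0 nP] := precompact_mul (minimal_precompact R hG Gmin) U0.
  have [l l0 [c fc]] := chP Xf0; exists (l * n%:Z).
    by rewrite mulf_neq0// eqz_nat -lt0n.
  move=> x; have [k [k0 /dvdnP[q nE] kx]] := nP x.
  have ck (i : 'I_r) : ch i x *+ n \is a Num.int.
    rewrite nE mulnC mulrnA rpredMn//.
    have : ch i (x *+ k) \is a Num.int.
      apply: contrapT => /negP ni; apply: nt; exists (x *+ k); split.
        by move=> j jr; exact: (kx (Ordinal jr)).
      by exists i.
    by move=> /rpredB/(_ (torus_charMn x k (Xch i))); rewrite subKr.
  have cn : comb (ch^~ x) r c *~ n \is a Num.int.
    rewrite /comb mulrz_suml rpred_sum// => i _.
    by rewrite -mulrzA mulrC mulrzA -pmulrn -mulrzl rpredM ?intr_int.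
  have : (f0 x *~ l - comb (ch^~ x) r c) *~ n \is a Num.int.
    by rewrite -mulrzl rpredM ?intr_int.
  by move=> /rpredD/(_ cn); rewrite mulrzBl subrK -mulrzA.
pose eps k : R := (k`!)%:R^-1 / k.+1%:R.
have eps0 k : 0 < eps k by rewrite divr_gt0 ?invr_gt0 ?ltr0n ?fact_gt0.
have /choice[h hP] : forall k, exists x, (forall i, (i < r)%N -> near_int (eps k) (ch i x)) /\
    exists i, (i < r)%N /\ ch i x \isn't a Num.int by move=> k; exact: tiny.
have /choice[v vP] : forall ki : nat * 'I_r, exists z : R,
    `|z| < eps ki.1 /\ ch ki.2 (h ki.1) - z \is a Num.int.
  move=> [k i] /=; have [z hz] := (hP k).1 i (ltn_ord i).
  by exists (ch i (h k) - z%:~R); split => //; rewrite subKr intr_int.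
have /choice[im imP] : forall k, exists i, 0 < `|v (k, i)| /\
    forall j, `|v (k, j)| <= `|v (k, i)|.
  move=> k; have [_ [i [ir ni]]] := hP k.
  case: (@Order.TotalTheory.arg_maxP _ _ _ (Ordinal ir) predT (fun i => `|v (k, i)|) isT).
  move=> j _ jmax; exists j; split; last by move=> j'; exact: jmax.
  apply: lt_le_trans (jmax (Ordinal ir) isT); rewrite normr_gt0.
  apply: contra ni => /eqP v0; have := (vP (k, Ordinal ir)).2.
  by rewrite v0 subr0.
pose M k := `|v (k, im k)|; have M0 k : 0 < M k by exact: (imP k).1.
have [Om [OmU Omoo]] := ultraFilterLemma eventually_filter.
have /choice[z zP] : forall i, exists z : R, (fun k => (v (k, i) / M k + 1) / 2) @ Om --> z.
  move=> i; apply: ultra_lim => k.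
  have : `|v (k, i) / M k| <= 1 by rewrite normrM normfV (ger0_norm (ltW (M0 k))) ler_pdivrMr// mul1r (imP k).2.
  by rewrite ler_norml => /andP[? ?]; apply/andP; split; lra.
pose u i := z i * 2 - 1.
have Omu i (e : R) : 0 < e -> Om [set k | `|v (k, i) / M k - u i| < e].
  move=> e0; have e20 : 0 < e / 2 by rewrite divr_gt0.
  have /cvgrPdist_lt/(_ _ e20) := zP i; apply: filterS => k /=.
  rewrite /u !ltr_norml => /andP[? ?]; apply/andP; split; lra.
have [i0 Omi0] : exists i0, Om [set k | im k = i0].
  apply: contrapT => H.
  have H' (i : 'I_r) : Om [set k | im k <> i].
    have [Ok|//] := in_ultra_setVsetC [set k | im k = i] OmU.
    by exfalso; apply: H; exists i.
  by have [k /(_ (im k))] := filter_ex (filter_forall _ H').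
have u0 : u i0 != 0.
  have h0 : 0 < 1 / 2 :> R by rewrite divr_gt0.
  have [k [/= ik]] := filter_ex (filterI Omi0 (Omu i0 _ h0)).
  apply: contraTneq => ->; rewrite subr0 normrM normfV (ger0_norm (ltW (M0 k))) -leNgt.
  by rewrite -ik -/(M k) divff ?lt0r_neq0//; lra.
have /choice[ph phP] : forall k : nat, exists j, (k <= j)%N /\
    forall i, `|v (j, i) / M j - u i| < k.+1%:R^-1.
  move=> k.
  have H (i : 'I_r) : Om [set j | `|v (j, i) / M j - u i| < k.+1%:R^-1].
    by apply: Omu; rewrite invr_gt0.
  have Hk : Om [set j | (k <= j)%N] by apply: Omoo; exact: nbhs_infty_ge.
  by have [j [kj ju]] := filter_ex (filterI Hk (filter_forall _ H)); exists j.
move/eqP: u0; apply.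
apply: (@no_direction (h \o ph) (M \o ph) (fun k i => v (ph k, i)) u) => [k i|k|k|k i] /=.
- exact: (vP (ph k, i)).2.
- exact: M0.
- have [kp _] := phP k.
  have := (vP (ph k, im (ph k))).1 => /ltW Mle.
  apply: (@le_trans _ _ (eps (ph k) * ((ph k)`!)%:R)).
    apply: ler_pM; rewrite ?(ltW (M0 _))// ler_nat.
    exact: leq_fact.
  rewrite /eps mulrAC mulVf ?pnatr_eq0 -?lt0n ?fact_gt0// mul1r.
  by rewrite lef_pV2 ?posrE// ler_nat ltnS.
- have [_ /(_ i) /ltW H] := phP k.
  have -> : v (ph k, i) - M (ph k) * u i = (v (ph k, i) / M (ph k) - u i) * M (ph k).
    by rewrite mulrBl divfK ?lt0r_neq0// mulrC.
  by rewrite normrM (ger0_norm (ltW (M0 _))) mulrC ler_wpM2l// ltW.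
Qed.

End Path.

Theorem chars_torsion (R : realType) (G : topologicalZmodType) :
  hausdorff_space G -> sequentially_complete G -> minimal_group G ->
  totally_disconnected [set: G] -> forall f : G -> R, torus_char f ->
  exists2 l : int, l != 0 & forall x, f x *~ l \is a Num.int.
Proof.
move=> hG Gcomp Gmin Gdisc f Xf.
have [r [ch [Xch chP]]] := chars_finite_rank R hG Gcomp Gmin Gdisc.
exact: (chars_torsion_of_rank hG Gcomp Gmin Gdisc Xch chP Xf).
Qed.

(** * The primary decomposition *)

Section OpenSubgroups.
Variable G : topologicalZmodType.
Implicit Types (x y : G) (V : set G) (n : nat).

(** An open subgroup [V] with some [n > 0] annihilating [G / V]. *)
Definition bounded_open V n := [/\ (0 < n)%N, nbhs (0 : G) V, V 0,
  (forall x y, V x -> V y -> V (x - y)) & forall x, V (x *+ n)].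

Lemma torsion_chars_bounded_open (R : realType) : hausdorff_space G -> minimal_group G ->
  (forall f : G -> R, torus_char f ->
    exists2 l : int, l != 0 & forall x, f x *~ l \is a Num.int) ->
  forall U, nbhs (0 : G) U -> exists V n, bounded_open V n /\ V `<=` U.
Proof.
move=> hG Gmin tor U U0; have [m [y [e [e0 Xy yU]]]] := char_nbhs R hG Gmin U0.
have /choice[l lP] : forall t, exists l : int, l != 0 /\ forall x, y t x *~ l \is a Num.int.
  by move=> t; have [l l0 lP] := tor _ (Xy t); exists l.
pose V : set G := [set x | forall t : 'I_m, y t x \is a Num.int].
exists V, (\prod_(t < m) `|l t|)%N; split; last first.
  move=> x Vx; apply: yU => t tm.
  by have /intrP[k ->] := Vx (Ordinal tm); exact: near_int_int.
split.
- by rewrite prodn_gt0// => t; rewrite absz_gt0; have [] := lP t.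
(* The values of [y t] are multiples of [1 / l t], so one closer than [1 / (2 * |l t|)] to an
   integer is an integer. *)
- apply: filter_forall => t; have [lt0 ltP] := lP t.
  have lR : 0 < (`|l t|.*2)%:R :> R by rewrite ltr0n double_gt0 absz_gt0.
  have el : 0 < (`|l t|.*2)%:R^-1 :> R by rewrite invr_gt0.
  apply: filterS ((Xy t).2 _ el) => x [k kx]; have /intrP[z zE] := ltP x.
  suff zk : z = k * l t.
    have lR' : (l t)%:~R != 0 :> R by rewrite intr_eq0.
    have : y t x * (l t)%:~R = k%:~R * (l t)%:~R by rewrite -intrM -zk -zE mulrzr.
    by move=> /(mulIf lR') ->; exact: intr_int.
  have : `|(z - k * l t)%:~R| < 1 :> R.
    rewrite intrB intrM -zE -mulrzr -mulrBl normrM.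
    have -> : `|(l t)%:~R| = `|l t|%N%:R :> R by rewrite -intr_norm -abszE.
    apply: (@lt_trans _ _ (1 / 2)); last by lra.
    have l0R : 0 < `|l t|%N%:R :> R by rewrite ltr0n absz_gt0.
    rewrite -ltr_pdivlMr//; apply: lt_le_trans kx _.
    by rewrite -mul2n natrM invfM div1r.
  by rewrite -intr_norm -[1]/(1%:~R) ltr_int -abszE ltz_nat ltnS leqn0 absz_eq0 subr_eq0 => /eqP.
- by move=> t; exact: torus_char0.
- move=> x x' Vx Vx' t; have := rpredB (Vx t) (Vx' t) => /rpredD.
  by move=> /(_ _ (torus_charB x x' (Xy t))); rewrite addrC subrK.
move=> x t; have [lt0 ltP] := lP t.
set n := (\prod_t _)%N; have /dvdnP[q nE] : (`|l t| %| n)%N.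
  by rewrite /n (bigD1 t)//= dvdn_mulr.
have : y t x *+ n \is a Num.int.
  rewrite nE mulnC mulrnA rpredMn//.
  have := ltP x; case: (l t) => k; rewrite ?NegzE ?mulrNz ?rpredN -?pmulrn//.
by move=> /(rpredD (torus_charMn x n (Xy t))); rewrite subrK.
Qed.

Section Bounded.
Variables (V : set G) (n : nat).
Hypothesis Vn : bounded_open V n.

Lemma bounded_openB x y : V x -> V y -> V (x - y).
Proof. by case: Vn => _ _ _ + _; apply. Qed.
Lemma bounded_open0 : V 0. Proof. by case: Vn. Qed.
Lemma bounded_openN x : V x -> V (- x).
Proof. by move=> Vx; rewrite -sub0r; apply: bounded_openB => //; exact: bounded_open0. Qed.
Lemma bounded_openD x y : V x -> V y -> V (x + y).
Proof. by move=> Vx Vy; rewrite -[y]opprK; apply: bounded_openB => //; exact: bounded_openN. Qed.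
Lemma bounded_openMn x k : V x -> V (x *+ k).
Proof.
move=> Vx; elim: k => [|k IH]; first by rewrite mulr0n; exact: bounded_open0.
by rewrite mulrS; exact: bounded_openD.
Qed.
Lemma bounded_openMz x (k : int) : V x -> V (x *~ k).
Proof.
move=> Vx; case: k => k; first exact: bounded_openMn.
by rewrite NegzE mulrNz; apply: bounded_openN; exact: bounded_openMn.
Qed.
Lemma bounded_open_dvd x a b : (a %| b)%N -> V (x *+ a) -> V (x *+ b).
Proof. by move=> /dvdnP[q ->] Va; rewrite mulnC mulrnA; exact: bounded_openMn. Qed.
Lemma bounded_open_mod x a u v : u = v %[mod a] -> V (x *+ a) -> V (x *+ u - x *+ v).
Proof.
move=> uv Va.
have H w : V (x *+ w - x *+ (w %% a)).
  rewrite {1}(divn_eq w a) mulrnDr addrK mulnC mulrnA; exact: bounded_openMn.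
by have := bounded_openB (H u) (H v); rewrite uv opprB addrA subrK.
Qed.
Lemma bounded_open_gcd x a b : V (x *+ a) -> V (x *+ b) -> V (x *+ gcdn a b).
Proof.
have [->|a0] := posnP a; first by rewrite gcd0n.
move=> Va Vb; have [u v uv _] := egcdnP b a0.
have -> : x *+ gcdn a b = x *+ a *+ u - x *+ b *+ v.
  by rewrite -!mulrnA [(a * u)%N]mulnC uv mulrnDr [(v * b)%N]mulnC [RHS]addrAC subrr add0r.
by apply: bounded_openB; exact: bounded_openMn.
Qed.
Lemma bounded_open_sum (I : Type) (r : seq I) (P : pred I) (F : I -> G) :
  (forall i, P i -> V (F i)) -> V (\sum_(i <- r | P i) F i).
Proof.
move=> PF; elim/big_rec: _ => [|i x Pi Vx]; first exact: bounded_open0.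
by apply: bounded_openD => //; exact: PF.
Qed.
Lemma bounded_open_nbhs x : nbhs x [set y | V (y - x)].
Proof.
apply/nbhs0_shift; case: Vn => _ V0 _ _ _; apply: filterS V0 => y Vy /=.
by rewrite addrC addKr.
Qed.

End Bounded.
End OpenSubgroups.

Section Decomposition.
Variable G : topologicalZmodType.
Hypothesis hG : hausdorff_space G.
Hypothesis Gcomp : sequentially_complete G.
Hypothesis Gbase : forall U, nbhs (0 : G) U -> exists V n, bounded_open V n /\ V `<=` U.
Implicit Types (x y : G) (V : set G) (n k p : nat).

Let eq_bounded x y : (forall V n, bounded_open V n -> V (x - y)) -> x = y.
Proof.
move=> xV; apply/eqP; rewrite -subr_eq0; apply/eqP; apply: nbhs0_eq0 => // U /Gbase.
by move=> [V [n [Vn VU]]]; apply: VU; exact: xV Vn.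
Qed.

(** The exponent [n] doubles as a threshold: multiples by [z p k] settle modulo [V] once [n] divides
    [k!], and sums over primes settle because no [i > n] divides [n]. *)
Let bounded_lim (u : nat -> G) :
  (forall V n, bounded_open V n -> forall i j, (n <= i)%N -> (n <= j)%N -> V (u i - u j)) ->
  exists l, forall V n, bounded_open V n -> forall k, (n <= k)%N -> V (l - u k).
Proof.
move=> uV; have /Gcomp[l ul] : cauchy_seq u.
  move=> U /Gbase[V [n [Vn VU]]].
  exists ([set k | (n <= k)%N], [set k | (n <= k)%N]); first by split; exact: nbhs_infty_ge.
  by move=> [i j] [/= ni nj]; apply/VU/(uV V n).
exists l => V n Vn k nk.
have ulV : \forall j \near \oo, V (u j - l) by exact: ul (bounded_open_nbhs Vn l).
have [j [/= Vj nj]] := filter_ex (filterI ulV (nbhs_infty_ge n)).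
have := bounded_openB Vn (uV V n Vn j k nj nk) Vj.
by rewrite opprB addrC addrA subrK.
Qed.

(* [z p k] tends to the idempotent of the profinite integers that is 1 at
   [p] and 0 at the other primes. *)
Let z p k := chinese (k`!)`_p (k`!)`_(negn p) 1 0.

Let z_p p n k : (0 < n)%N -> (n <= k)%N -> z p k = 1 %[mod n`_p].
Proof.
move=> n0 nk; have nd : (n`_p %| (k`!)`_p)%N.
  by rewrite partn_dvd ?fact_gt0// dvdn_fact// n0.
have := chinese_modl (coprime_partC p (k`!) (k`!)) 1 0; rewrite -/(z p k).
by move=> /(congr1 (fun w => w %% n`_p)%N); rewrite !modn_dvdm.
Qed.

Let z_p' p n k : (0 < n)%N -> (n <= k)%N -> (n`_(negn p) %| z p k)%N.
Proof.
move=> n0 nk; have nd : (n`_(negn p) %| (k`!)`_(negn p))%N.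
  by rewrite partn_dvd ?fact_gt0// dvdn_fact// n0.
apply: dvdn_trans nd _; have := chinese_modr (coprime_partC p (k`!) (k`!)) 1 0.
by rewrite -/(z p k) mod0n => /eqP.
Qed.

Let z_mod p n i j : (0 < n)%N -> (n <= i)%N -> (n <= j)%N -> z p i = z p j %[mod n].
Proof.
move=> n0 ni nj; rewrite -(partnC p n0); apply/eqP.
rewrite chinese_remainder ?coprime_partC//; apply/andP; split; apply/eqP.
  by rewrite !z_p.
by rewrite !(eqP (z_p' _ _ _)).
Qed.

Let pr_ex p x : exists l, forall V n, bounded_open V n ->
  forall k, (n <= k)%N -> V (l - x *+ z p k).
Proof.
apply: bounded_lim => V n Vn i j ni nj; have [n0 _ _ _ VM] := Vn.
by apply: (bounded_open_mod Vn (z_mod p n0 ni nj)).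
Qed.

(** Multiplication by the limit idempotent: the projection onto the [p]-part. *)
Let pr p x : G := projT1 (cid (pr_ex p x)).

Let prP p x V n k : bounded_open V n -> (n <= k)%N -> V (pr p x - x *+ z p k).
Proof. by move=> Vn; apply: (projT2 (cid (pr_ex p x))) Vn _. Qed.

Let prB p x y : pr p (x - y) = pr p x - pr p y.
Proof.
apply: eq_bounded => V n Vn.
have := bounded_openB Vn (prP p (x - y) Vn (leqnn n))
  (bounded_openB Vn (prP p x Vn (leqnn n)) (prP p y Vn (leqnn n))).
congr V; rewrite mulrnBl; set a := pr p (x - y); set b := pr p x; set c := pr p y.
set u := x *+ _; set v := y *+ _.
have -> : b - u - (c - v) = (b - c) - (u - v).
  by rewrite !opprB addrACA [RHS]addrACA [- u - c]addrC.
have subDD (d e w : G) : d - w - (e - w) = d - e by rewrite opprB addrA subrK.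
exact: subDD.
Qed.

Let pr0 p : pr p 0 = 0.
Proof. by have := prB p 0 0; rewrite !subrr. Qed.

Let prD p x y : pr p (x + y) = pr p x + pr p y.
Proof. by have := prB p (x + y) y; rewrite addrK => ->; rewrite subrK. Qed.

Let pr_in p x V n : bounded_open V n -> V x -> V (pr p x).
Proof.
move=> Vn Vx; rewrite -(subrK (x *+ z p n) (pr p x)); apply: (bounded_openD Vn).
  exact: (prP _ _ Vn (leqnn n)).
exact: (bounded_openMn Vn).
Qed.

Let pr_part p x V n : bounded_open V n -> V (pr p x *+ n`_p).
Proof.
move=> Vn; have [n0 _ _ _ VM] := Vn.
rewrite -(subrK (x *+ z p n) (pr p x)) mulrnDl; apply: (bounded_openD Vn).
  by apply: (bounded_openMn Vn); exact: (prP _ _ Vn (leqnn n)).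
rewrite -mulrnA; apply: (bounded_open_dvd Vn _ (VM x)).
by rewrite -{1}(partnC p n0) mulnC dvdn_mul// z_p'.
Qed.

Let pr_id p x V n : bounded_open V n -> V (x *+ n`_p) -> V (pr p x - x).
Proof.
move=> Vn Vx; have [n0 _ _ _ _] := Vn.
have := bounded_openD Vn (prP p x Vn (leqnn n))
  (bounded_open_mod Vn (z_p p n0 (leqnn n)) Vx).
by rewrite mulr1n addrA subrK.
Qed.

Let td_part p x V n : prime p -> td G p x -> bounded_open V n -> V (x *+ n`_p).
Proof.
move=> pp /quasi_p_torsion_small sx Vn; have [n0 V0 _ _ VM] := Vn.
have [k kV] := sx V V0; have := kV 1; rewrite mul1r -pmulrn => Vk.
apply: (bounded_open_dvd Vn _ (bounded_open_gcd Vn Vk (VM x))).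
have pd : p.-nat (gcdn (p ^ k) n).
  by apply: pnat_dvd (dvdn_gcdl _ _) _; rewrite pnatX pnat_id.
by rewrite -(part_pnat_id pd) partn_dvd// dvdn_gcdr.
Qed.

Let td_pr p x : prime p -> td G p x -> pr p x = x.
Proof.
move=> pp tx; apply: eq_bounded => V n Vn.
by apply: (pr_id Vn); exact: td_part.
Qed.

Let pr_td p x : prime p -> td G p (pr p x).
Proof.
move=> pp; apply: small_quasi_p_torsion => // U /Gbase[V [n [Vn VU]]].
exists (logn p n) => q; apply: VU; rewrite mulrC mulrzA -pmulrn -p_part.
by apply: (bounded_openMz Vn); exact: pr_part.
Qed.

(** These are the fixed points of the projection [pr p], which maps each bounded open subgroup into
    itself. *)
Lemma td_closed p : prime p -> closed (td G p).
Proof.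
move=> pp x clx; suff <- : pr p x = x by exact: pr_td.
apply: eq_bounded => V n Vn.
have [y [ty /= Vy]] := clx _ (bounded_open_nbhs Vn x).
have := bounded_openB Vn (pr_in p Vn (bounded_openN Vn Vy)) (bounded_openN Vn Vy).
rewrite opprB prB (td_pr pp ty) opprB; congr V.
by rewrite addrA subrK.
Qed.

Local Notation P := {p : nat | prime p}.
Local Notation H := (fun p : P => subgroup_type (td_subgroup hG p)).

Let f (x : G) : prod_group H := fun p : P =>
  exist _ (pr (val p) x) (mem_set (pr_td x (valP p))).

Let fB : zmod_morphism f.
Proof.
move=> x x'; apply: functional_extensionality_dep => p; apply: val_inj.
rewrite /= prB.
by transitivity (val (f x p) - val (f x' p)); rewrite // -raddfB.
Qed.

(** The value 0 at nonprimes lets partial sums run over all [i < k]. *)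
Let t (y : prod_group H) (i : nat) : G := if insub i is Some p then val (y p) else 0.

Let t_val (y : prod_group H) (p : P) : t y (val p) = val (y p).
Proof. by rewrite /t valK. Qed.

Let t_td (y : prod_group H) i : prime i -> td G i (t y i).
Proof.
move=> pi; rewrite /t insubT /=; set p := Sub i _.
by have := set_mem (valP (y p)).
Qed.

Let t_in (y : prod_group H) i V n : bounded_open V n -> (i %| n)%N = false -> V (t y i).
Proof.
move=> Vn ni; have [n0 _ V0 _ _] := Vn.
have [pi|npi] := boolP (prime i); last by rewrite /t insubN.
have := td_part pi (t_td y pi) Vn.
by rewrite p_part lognE pi n0 ni expn0 mulr1n.
Qed.

Let S (y : prod_group H) k : G := \sum_(i < k) t y i.

Let g_ex (y : prod_group H) : exists l, forall V n, bounded_open V n ->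
  forall k, (n < k)%N -> V (l - S y k).
Proof.
have key V n : bounded_open V n -> forall i, (n < i)%N -> V (S y i - S y n.+1).
  move=> Vn; elim=> // i IH; rewrite ltnS leq_eqVlt => /predU1P[->|ni].
    by rewrite subrr; exact: (bounded_open0 Vn).
  rewrite /S big_ord_recr /= -/(S y i) addrAC; apply: (bounded_openD Vn); first exact: IH.
  apply: (t_in _ Vn); apply/negbTE/negP => iN; have [n0 _ _ _ _] := Vn.
  by have := dvdn_leq n0 iN; rewrite leqNgt ni.
have [|l lP] := @bounded_lim (fun k => S y k.+1).
  move=> V n Vn i j ni nj; have := bounded_openB Vn (key V n Vn i.+1 ni) (key V n Vn j.+1 nj).
  by rewrite opprB addrA subrK.
exists l => V n Vn [//|k] nk; exact: lP Vn k nk.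
Qed.

Let g (y : prod_group H) : G := projT1 (cid (g_ex y)).

Let gP (y : prod_group H) V n k : bounded_open V n -> (n < k)%N -> V (g y - S y k).
Proof. by move=> Vn; apply: (projT2 (cid (g_ex y))) Vn _. Qed.

Let pr_g (y : prod_group H) (p : P) : pr (val p) (g y) = val (y p).
Proof.
have pp := valP p; apply: eq_bounded => V n Vn; have [n0 _ _ _ _] := Vn.
pose k := (maxn n (val p)).+1.
have nk : (n < k)%N by rewrite ltnS leq_maxl.
have pk : (val p < k)%N by rewrite ltnS leq_maxr.
have prS : pr (val p) (S y k) = \sum_(i < k) pr (val p) (t y i).
  by rewrite /S (big_morph (pr (val p)) (@prD _) (pr0 _)).
rewrite -(subrK (pr (val p) (S y k)) (pr (val p) (g y))) -addrA; apply: (bounded_openD Vn).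
  by rewrite -prB; apply: (pr_in _ Vn); exact: (gP y Vn nk).
rewrite prS (bigD1 (Ordinal pk))//= t_val td_pr//; last by have := set_mem (valP (y p)).
rewrite addrAC subrr add0r; apply: (bounded_open_sum Vn) => i.
rewrite -val_eqE /= => ip.
have [pi|npi] := boolP (prime i); last first.
  by rewrite /t insubN//; apply: (pr_in _ Vn); exact: (bounded_open0 Vn).
(* The [i]-part of [n] is prime to [p] and so divides [z p n]: the other components project into
   [V]. *)
rewrite -(subrK (t y i *+ z (val p) n) (pr _ _)); apply: (bounded_openD Vn).
  exact: (prP _ _ Vn (leqnn n)).
apply: (bounded_open_dvd Vn _ (td_part pi (t_td y pi) Vn)).
apply: dvdn_trans (z_p' (val p) n0 (leqnn n)).
have pd : (negn (val p)).-nat (n`_i)%N by rewrite p_part pnatX pnatE// inE /= inE ip.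
by rewrite -(part_pnat_id pd) partn_dvd// dvdn_part.
Qed.

(** If the order [d] of [x] modulo [V] had a prime divisor [p], then [z p n] would bring [x] into
    [V], so [p] would divide [z p n], which is 1 modulo [p]. *)
Let pr_inj x : (forall p, prime p -> pr p x = 0) -> x = 0.
Proof.
move=> x0; apply: eq_bounded => V n Vn; rewrite subr0; have [n0 _ _ _ VM] := Vn.
have ex : exists d, (0 < d)%N && `[< V (x *+ d) >].
  by exists n; rewrite n0; apply/asboolP.
case: (ex_minnP ex) => d /andP[d0 /asboolP Vd] dmin.
have dvd b : V (x *+ b) -> (d %| b)%N.
  move=> Vb; have := dmin (gcdn d b); rewrite gcdn_gt0 d0 /=.
  move=> /(_ (asboolT (bounded_open_gcd Vn Vd Vb))) dg.
  by have /gcdn_idPl -> // : gcdn d b = d by apply/eqP; rewrite eqn_leq dg dvdn_leq// dvdn_gcdl.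
have [d1|d1] := leqP d 1.
  by move: Vd; have -> : d = 1%N by apply/eqP; rewrite eqn_leq d1.
pose p := pdiv d; have pp : prime p by exact: pdiv_prime.
have pd : (p %| d)%N by exact: pdiv_dvd.
have : V (x *+ z p n).
  by have := bounded_openN Vn (prP p x Vn (leqnn n)); rewrite x0// sub0r opprK.
move=> /dvd dz; have pz := dvdn_trans pd dz.
have pn : (p %| n`_p)%N.
  have pn : (p %| n)%N by exact: dvdn_trans (dvd _ (VM x)).
  by rewrite p_part -[X in (X %| _)%N]expn1 dvdn_exp2l// logn_gt0 mem_primes pp n0.
have := z_p p n0 (leqnn n) => /(congr1 (modn^~ p)); rewrite !modn_dvdm//.
by rewrite (eqP pz) modn_small ?prime_gt1.
Qed.

Let pr_cont p : continuous (pr p).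
Proof.
move=> x U /nbhs0_shift/Gbase[V [n [Vn VU]]].
apply: filterS (bounded_open_nbhs Vn x) => x' /= Vx'.
by have := VU _ (pr_in p Vn Vx'); rewrite /= prB addrC subrK.
Qed.

Let f_cont : continuous f.
Proof.
move=> x; apply: (@prod_group_cvg _ H (f @ x) (f x) _) => p.
by apply: (@subgroup_cvg _ _ _ (f x p)); exact: pr_cont.
Qed.

Let t_cont (y : prod_group H) i V n : bounded_open V n -> nbhs y [set y' | V (t y' i - t y i)].
Proof.
move=> Vn; rewrite /t; case: insubP => [p _ _|_]; last first.
  by apply: filterE => y'; rewrite /= subrr; exact: (bounded_open0 Vn).
apply: (@prod_group_proj_continuous _ H p y [set w | V (val w - val (y p))]).
exact: (@subgroup_val_continuous _ _ (y p) _ (bounded_open_nbhs Vn (val (y p)))).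
Qed.

Let g_cont : continuous g.
Proof.
move=> y U /nbhs0_shift/Gbase[V [n [Vn VU]]].
have Hn (i : 'I_n.+1) : nbhs y [set y' | V (t y' i - t y i)] by exact: (t_cont y i Vn).
apply: filterS (filter_forall _ Hn) => y' Hy' /=.
suff Vg : V (g y' - g y) by have := VU _ Vg; rewrite /= addrC subrK.
have V1 := gP y' Vn (ltnSn n); have V2 := gP y Vn (ltnSn n).
have V3 : V (S y' n.+1 - S y n.+1).
  by rewrite /S -sumrB; apply: (bounded_open_sum Vn) => i _; exact: Hy'.
have := bounded_openB Vn (bounded_openD Vn V1 V3) V2.
by rewrite addrA subrK opprB addrA subrK.
Qed.

Lemma top_iso_prod_td : top_iso G (prod_group H).
Proof.
pose fM := GRing.isZmodMorphism.Build G (prod_group H) f fB.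
pose F : {additive G -> prod_group H} := HB.pack f fM.
have gK : cancel g f.
  by move=> y; apply: functional_extensionality_dep => p; apply: val_inj; exact: pr_g.
exists F, g; split => //.
move=> x; apply/eqP; rewrite -subr_eq0; apply/eqP; apply: pr_inj => p pp.
rewrite prB; have := pr_g (f x) (exist _ p pp); rewrite /= => ->.
exact: subrr.
Qed.

End Decomposition.

From mathcomp Require Import Rstruct.

Theorem theorem2p10 (G : topologicalZmodType) (hG : hausdorff_space G)
    (G_complete : sequentially_complete G)
    (G_minimal : minimal_group G)
    (G_disconnected : totally_disconnected [set: G]) :
  (forall p : nat, prime p -> closed (td G p)) /\
  top_iso G (prod_group (fun p : {p : nat | prime p} =>
    subgroup_type (td_subgroup hG p))).
Proof.
(* The statement mentions no real field, so a concrete one is supplied for the values of the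
   characters. *)
have Gbase := torsion_chars_bounded_open hG G_minimal
  (chars_torsion (R := Rdefinitions.R) hG G_complete G_minimal G_disconnected).
split; last exact: top_iso_prod_td.
by move=> p pp; exact: td_closed.
Qed.
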